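(* Let $v_0\in\mathscr M_+([0,\infty))$ satisfy $X_\eta(v_0)<\infty$ for some $\eta>\frac{1-\theta}2$, and let $v\in C([0,\infty),\mathscr M_+([0,\infty)))$ be a weak solution with initial data $v_0$ of $$\frac{\partial v}{\partial t}(t,k)=v(t,k)\int_{[0,\infty)}v(t,k')\big(e^{-k}-e^{-k'}\big)\frac{\mathcal B(k,k')\Phi(k,k')}{kk'}\,dk'$$ satisfying $M_0(v(t))=M_0(v_0)$ and $X_\eta(v(t))\le X_\eta(v_0)$ for all $t>0$. Then, as $t\to\infty$, $v(t)$ converges in $C([0,\infty),\mathscr M_+([0,\infty)))$ (i.e. $s\mapsto v(t+s)$ converges, locally uniformly in $s\geq 0$ for the narrow topology, to a constant map) to a measure $$\mu=\sum_{i}M_i'\,\delta_{k_i'}$$ (an at most countable sum, possibly finite), where $M_i'\ge0$ and $k_i'\ge0$ satisfy: 1. $k_i'\in\operatorname{supp}(v_0)$ for all $i$; 2. $\Phi(k_i',k_j')=0$ for all $i\ne j$; 3. for all $n$, if $\mathcal J_n=\{i: k_i'\in A_n(v_0),\ M_i'>0\}$, then $\sum_{i\in\mathcal J_n}M_i'=M_n$, where $M_n=\int_{A_n(v_0)}v_0(k)\,dk$; 4. for all $n$, if $k_n=\min\{k\in A_n(v_0)\}>0$, then there exists $i$ such that $k_i'=k_n$.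
   Context: Measures. $\mathscr M_+([0,\infty))$ is the set of nonnegative bounded Radon measures on $[0,\infty)$ with the narrow topology (metrized by $d_0(\mu,\nu)=\sup\{\int\varphi\,d(\mu-\nu):\varphi \text{ 1-Lipschitz},\ \|\varphi\|_\infty\le1\}$); one writes $\int\varphi(k)v(k)\,dk$ for $\int\varphi\,dv$. $M_0(v)=\int_{[0,\infty)} v(k)\,dk$ and $X_\eta(v)=\int_{[0,\infty)}e^{\eta k}v(k)\,dk$. Kernel. Fix $m>0$ and, for $k,k'\ge0$ not both zero, $$\mathcal B(k,k')=e^{\frac{k+k'}2}\int_{-1}^1\frac{1+s^2}{w}\,\exp\Big(-\frac{m(k-k')^2}{2w^2}-\frac{w^2}{8m}\Big)ds,\qquad w=\sqrt{k^2+k'^2-2kk's}.$$ Cut-off. Fix $\theta\in(0,1)$, $\delta_*>0$ and $\rho_*=\frac{1-\theta}{\sqrt{\theta(1+\theta)\delta_*}}$. Let $D\subset[0,\infty)^2$ be the set of $(k,k')$ such that $|k-k'|\le\rho_*\sqrt{kk'(k+k')}$ if $(k,k')\in[0,\delta_*]^2$, and $\theta k\le k'\le\theta^{-1}k$ if $(k,k')\notin[0,\delta_*]^2$. The function $\Phi$ satisfies: $0\le\Phi\le1$; $\Phi(k,k')=\Phi(k',k)$; $\Phi\in C([0,\infty)^2\setminus\{(0,0)\})$; $\operatorname{supp}\Phi=D$; and $\Phi=1$ on the set $D_1\subset D$ of $(k,k')$ such that $|k-k'|\le\rho_1\sqrt{kk'(k+k')}$ if $(k,k')\in[0,\delta_*]^2$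 and $\theta_1k\le k'\le\theta_1^{-1}k$ otherwise, for some $\theta_1\in(\theta,1)$ and $\rho_1>0$. The objects above are for inverse-temperature parameter $\beta=1$. Weak solution with initial data $v_0$: (i) for all $\varphi\in C_b([0,\infty))$, $t\mapsto\int v(t,k)\varphi(k)dk$ is continuous on $[0,\infty)$ and equals $\int v_0(k)\varphi(k)dk$ at $t=0$; (ii) for all $\varphi\in C^1_b([0,\infty))$ (bounded $C^1$ with bounded derivative) with $\varphi'(0)=0$, $t\mapsto\int v(t,k)\varphi(k)dk$ is in $W^{1,\infty}_{loc}([0,\infty))$ and for a.e. $t>0$ $$\frac{d}{dt}\int v(t,k)\varphi(k)dk=\frac12\iint_{[0,\infty)^2}\frac{\Phi\mathcal B}{kk'}(e^{-k}-e^{-k'})(\varphi(k)-\varphi(k'))v(t,k)v(t,k')\,dk\,dk',$$ where the function $\frac{\Phi\mathcal B}{kk'}(e^{-k}-e^{-k'})(\varphi(k)-\varphi(k'))$ is extended continuously by $0$ to $kk'=0$. The sets $A_n(v_0)$. Let $\gamma_1(k)=\min\{k'\ge0:(k,k')\in D\}$ for $k\ge0$. Write $[0,\infty)\setminus\operatorname{supp}v_0$ as the disjoint union of its connected components $I_j$ (relatively open intervals, with endpoints $a_j<b_j$, where $a_j=0$ if $I_j=[0,b_j)$, and with the convention $\gamma_1(\infty)=\infty$). Let $\mathcal I=\{I_j:\gamma_1(b_j)\ge a_j\}$ and let $\{E_n\}$ be the (at most countably many) connected components of $[0,\infty)\setminus\bigcup_{I\in\mathcal I}I$. Then $A_n(v_0)=E_n\cap\operatorname{supp}v_0$;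 these are closed, pairwise disjoint, with union $\operatorname{supp}v_0$. *)

(* Defs.v *)
From HB Require Import structures.
From mathcomp Require Import all_boot all_order all_algebra.
From mathcomp Require Import all_classical all_reals all_analysis.
Import Order.TTheory GRing.Theory Num.Theory.
Import numFieldNormedType.Exports.

Set Implicit Arguments.
Unset Strict Implicit.
Unset Printing Implicit Defensive.

Local Open Scope classical_set_scope.
Local Open Scope ring_scope.

(** A bounded Radon measure on [0, +oo[ is a finite Borel measure on [R]
    satisfying [on_halfline]; a function on [0, +oo[ is a function on [R] of
    which only the restriction to [0, +oo[ is ever constrained or used. *)

Definition halfline (R : realType) : set R := `[0, +oo[%classic.

Notation fmeasure R := {finite_measure set (measurableTypeR R) -> \bar R}.

Section measures.
Variable R : realType.
Implicit Types mu nu : fmeasure R.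

Definition on_halfline mu : Prop := mu (`]-oo, 0[%classic : set R) = 0%E.

Definition M0 mu : \bar R := mu (@halfline R).

Definition Xexp (eta : R) mu : \bar R :=
  (\int[mu]_(k in @halfline R) (expR (eta * k))%:E)%E.

Definition pairing mu (phi : R -> R) : R :=
  \int[mu]_(k in @halfline R) phi k.

Definition msupp mu : set R :=
  [set x | forall U : set R, open U -> U x -> (0 < mu U)%E].

Definition d0_test (phi : R -> R) : Prop :=
  (forall x y : R, 0 <= x -> 0 <= y -> `|phi x - phi y| <= `|x - y|) /\
  (forall x : R, 0 <= x -> `|phi x| <= 1).

Definition d0 mu nu : R :=
  sup [set pairing mu phi - pairing nu phi | phi in d0_test].

Definition narrow_continuous (v : R -> fmeasure R) : Prop :=
  forall t : R, 0 <= t ->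
    d0 (v s) (v t) @[s --> within (@halfline R) (nbhs t)] --> 0.

(** Convergence of [s |-> v (t + s)], as [t --> +oo], to the constant map [mu]
    in the space of narrowly continuous maps on [0, +oo[, endowed with locally
    uniform convergence. *)
Definition shifts_converge (v : R -> fmeasure R) mu : Prop :=
  forall S eps : R, 0 <= S -> 0 < eps ->
    exists t0 : R, 0 <= t0 /\
      forall t s : R, t0 <= t -> 0 <= s <= S -> d0 (v (t + s)) mu < eps.

End measures.

Section kernel.
Variables (R : realType) (m : R).

(** At [k = k' > 0] the integrand is the (junk) value 0 at the single point
    [s = 1], which is negligible. *)
Definition kernelB (k k' : R) : R :=
  let w s := Num.sqrt (k ^+ 2 + k' ^+ 2 - 2 * k * k' * s) in
  expR ((k + k') / 2) *
  \int[@lebesgue_measure R]_(s in `[-1, 1])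
    ((1 + s ^+ 2) / w s *
     expR (- (m * (k - k') ^+ 2 / (2 * w s ^+ 2)) - w s ^+ 2 / (8 * m))).

End kernel.

Section cutoff.
Variable R : realType.

Definition region (theta rho delta : R) : set (R * R) :=
  [set p | [/\ 0 <= p.1, 0 <= p.2 &
    if (p.1 <= delta) && (p.2 <= delta)
    then `|p.1 - p.2| <= rho * Num.sqrt (p.1 * p.2 * (p.1 + p.2))
    else theta * p.1 <= p.2 <= theta^-1 * p.1]].

Definition rho_star (theta delta : R) : R :=
  (1 - theta) / Num.sqrt (theta * (1 + theta) * delta).

Definition Dset (theta delta : R) : set (R * R) :=
  region theta (rho_star theta delta) delta.

Definition quadrant : set (R * R) := [set p | 0 <= p.1 /\ 0 <= p.2].

(** The value at the origin, where no continuity is assumed, is fixed to 1 by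
    the last field. *)
Record is_cutoff (theta delta : R) (Phi : R * R -> R) : Prop := IsCutoff {
  cutoff_range : forall p, quadrant p -> 0 <= Phi p <= 1 ;
  cutoff_sym : forall k k' : R, 0 <= k -> 0 <= k' ->
    Phi (k, k') = Phi (k', k) ;
  cutoff_cont : {within quadrant `\ (0, 0), continuous Phi} ;
  cutoff_supp :
    closure [set p | quadrant p /\ Phi p != 0] = Dset theta delta ;
  cutoff_one : exists theta1 rho1 : R,
    [/\ theta < theta1 < 1, 0 < rho1,
        region theta1 rho1 delta `<=` Dset theta delta &
        forall p, region theta1 rho1 delta p -> Phi p = 1]
}.

End cutoff.

Section weak_solution.
Variable R : realType.

Definition is_Cb (phi : R -> R) : Prop :=
  {within @halfline R, continuous phi} /\
  [bounded phi k | k in @halfline R].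

(** [dphi] is the derivative of [phi] on [0, +oo[, one-sided at 0. *)
Definition is_C1b (phi dphi : R -> R) : Prop :=
  [/\ forall k : R, 0 <= k ->
        (phi x - phi k) / (x - k)
          @[x --> within (@halfline R `\ k) (nbhs k)] --> dphi k,
      is_Cb phi & is_Cb dphi].

Definition Linfty_loc (f : R -> R) : Prop :=
  measurable_fun (@halfline R) f /\
  forall T : R, 0 < T -> exists C : R,
    {ae @lebesgue_measure R, forall t : R, 0 <= t <= T -> `|f t| <= C}.

(** [C^1] functions with compact support in ]0, +oo[. *)
Definition is_C1c (psi : R -> R) : Prop :=
  [/\ forall t : R, derivable psi t 1,
      continuous (derive1 psi) &
      exists a b : R, 0 < a /\ forall t : R, t < a \/ b < t -> psi t = 0].

(** [f] is in [W^{1,oo}_loc([0,+oo[)], with weak derivative [g]. *)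
Definition is_W1infty_loc (f g : R -> R) : Prop :=
  [/\ Linfty_loc f, Linfty_loc g &
      forall psi, is_C1c psi ->
        \int[@lebesgue_measure R]_(t in `]0, +oo[) (f t * derive1 psi t) =
        - \int[@lebesgue_measure R]_(t in `]0, +oo[) (g t * psi t)].

Definition weak_integrand (m : R) (Phi : R * R -> R) (phi : R -> R)
    (p : R * R) : R :=
  if p.1 * p.2 == 0 then 0 else
  Phi p * kernelB m p.1 p.2 / (p.1 * p.2) *
  (expR (- p.1) - expR (- p.2)) * (phi p.1 - phi p.2).

Definition weak_rhs (m : R) (Phi : R * R -> R) (phi : R -> R)
    (mu : fmeasure R) : R :=
  2^-1 * \int[(mu \x mu)%E]_(p in @halfline R `*` @halfline R)
           weak_integrand m Phi phi p.

Record weak_solution (m : R) (Phi : R * R -> R) (v0 : fmeasure R)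
    (v : R -> fmeasure R) : Prop := WeakSolution {
  weak_cont : forall phi, is_Cb phi ->
    {within @halfline R, continuous (fun t => pairing (v t) phi)} /\
    pairing (v 0) phi = pairing v0 phi ;
  weak_eq : forall phi dphi, is_C1b phi dphi -> dphi 0 = 0 ->
    exists g : R -> R,
      is_W1infty_loc (fun t => pairing (v t) phi) g /\
      {ae @lebesgue_measure R, forall t : R, 0 < t ->
        g t = weak_rhs m Phi phi (v t)}
}.

End weak_solution.

Section clusters.
Variable R : realType.
Implicit Types (D : set (R * R)) (A C E I : set R).

Definition components A : set (set R) :=
  [set connected_component A x | x in A].

(** For [D = Dset theta delta] the infimum is a minimum. *)
Definition gamma1 D (k : R) : R := inf [set k' : R | 0 <= k' /\ D (k, k')].

Definition egamma1 D (b : \bar R) : \bar R :=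
  if b is b'%:E then (gamma1 D b')%:E else +oo%E.

Definition gap_selected D I : Prop :=
  (ereal_inf (EFin @` I) <= egamma1 D (ereal_sup (EFin @` I)))%E.

Definition selected_gaps D (v0 : fmeasure R) : set (set R) :=
  [set I | components (@halfline R `\` msupp v0) I /\ gap_selected D I].

Definition blocks D (v0 : fmeasure R) : set (set R) :=
  components (@halfline R `\` \bigcup_(I in selected_gaps D v0) I).

(** The family of the sets [A_n(v_0)]. *)
Definition clusters D (v0 : fmeasure R) : set (set R) :=
  [set E `&` msupp v0 | E in blocks D v0].

End clusters.

(* Main.v *)
(** Every decreasing test function has a nondecreasing pairing with [v t], because
    the factors [exp(-k) - exp(-k')] and [phi k - phi k'] then have the same sign:
    mass only moves to the left.  So the distribution functions of [v t] increase
    with [t], and their limit, made right-continuous, is the distribution function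
    of the limit [mu].  If [p < q] in the support of [mu] had [Phi (p, q) != 0],
    the dissipation would be bounded below for large times and a bounded pairing
    would grow linearly; hence [Phi] vanishes on pairs of distinct support points.
    As [Phi = 1] near the diagonal of [(0, +oo)^2], the support is discrete there
    and [mu] is a countable sum of atoms.

    A Gronwall argument with test functions supported in a gap of [supp v0] shows
    that gaps stay empty.  Across a selected gap [Phi] vanishes, so no mass crosses
    it and the mass of each block is conserved.  Finally, the minimum [kn > 0] of a
    cluster is preceded by a conserved gap, while the mass of [[0, x]] cannot
    decrease: mass remains arbitrarily close to [kn]. *)

Require Import Defs.
From HB Require Import structures.
From mathcomp Require Import all_boot all_order all_algebra.
From mathcomp Require Import all_classical all_reals all_analysis.
From mathcomp Require Import measurable_realfun.
From mathcomp Require Import ring lra.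
Import Order.TTheory GRing.Theory Num.Theory.
Import numFieldNormedType.Exports.
Local Open Scope classical_set_scope.
Local Open Scope ring_scope.
Set Implicit Arguments.
Unset Strict Implicit.

(** * Integrals and finite measures on the line *)

Import HBNNSimple.

(** The integrand of the weak equation has a factor [1 / (k * k')] and a kernel that grows
    exponentially. Both are tamed by test functions that are constant near 0 and near infinity: a
    pair of [D] at which such a function takes two values stays in a compact subset of the open
    quadrant, whence a bound by a constant times the difference of the two values. Constancy near 0
    also gives [dphi 0 = 0]. Indicators of half-lines and intervals are squeezed between smooth
    ramps of this kind.

    The origin is the delicate point. The width of [D] shrinks there faster than the distance to 0,
    so atoms of the limit and selected gaps may both accumulate at 0, and a support point at 0 is
    treated apart.

    Convergence in [d0] must be uniform over all test functions. It is obtained on a grid of points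
    off the support of [mu]: there the distribution functions converge, and between two neighbours a
    1-Lipschitz function varies by at most the mesh. Discreteness of the support away from 0 makes
    such points dense. *)

Section integral_order.
Context d (T : measurableType d) (R : realType).
Variable mu : {measure set T -> \bar R}.
Implicit Types (D : set T).

(* The integral of a nonnegative function is a supremum over the simple
   functions below it, hence monotone without any measurability assumption.
   This spares proving that [kernelB] is jointly measurable. *)
Lemma ge0_le_integral_nonmeasurable D (f g : T -> \bar R) :
  (forall x, D x -> 0 <= f x)%E -> (forall x, D x -> f x <= g x)%E ->
  (\int[mu]_(x in D) f x <= \int[mu]_(x in D) g x)%E.
Proof.
move=> f0 fg.
have g0 x : D x -> (0 <= g x)%E by move=> Dx; rewrite (le_trans (f0 _ Dx)) ?fg.
rewrite !ge0_integralE//; apply: le_ereal_sup => _ [h /= hf <-].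
exists h => //= x; apply: (le_trans (hf x)); exact: lee_restrict.
Qed.

(** The integral of [f] is at most that of its positive part, hence at most that of [g]. If it is
    [-oo], its real value is 0, which is still below the integral of the nonnegative [g]. *)
Lemma le_Rintegral_nonmeasurable D (f g : T -> R) :
  (forall x, D x -> 0 <= g x) -> (forall x, D x -> f x <= g x) ->
  (\int[mu]_(x in D) (g x)%:E < +oo)%E ->
  \int[mu]_(x in D) f x <= \int[mu]_(x in D) g x.
Proof.
move=> g0 fg goo; rewrite /Rintegral.
have I0 : (0 <= \int[mu]_(x in D) (g x)%:E)%E.
  by apply: integral_ge0 => x Dx; rewrite lee_fin g0.
have : (\int[mu]_(x in D) (f x)%:E <= \int[mu]_(x in D) (g x)%:E)%E.
  rewrite integralE; apply: (@le_trans _ _ (\int[mu]_(x in D) ((EFin \o f) ^\+ x))%E).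
    by rewrite geeDl// oppe_le0 integral_ge0.
  apply: ge0_le_integral_nonmeasurable => // x Dx.
  by rewrite funeposE /= -EFin_max lee_fin ge_max fg //= g0.
case: (\int[mu]_(x in D) (f x)%:E)%E => [r| |] //= h.
- by rewrite -lee_fin (le_trans h)// fineK// ge0_fin_numE.
- by move: h; rewrite leye_eq => /eqP h; rewrite h in goo.
- exact: fine_ge0.
Qed.

Lemma ge_Rintegral_nonmeasurable D (f g : T -> R) :
  (forall x, D x -> 0 <= g x) -> (forall x, D x -> - g x <= f x) ->
  (\int[mu]_(x in D) (g x)%:E < +oo)%E ->
  - (\int[mu]_(x in D) g x) <= \int[mu]_(x in D) f x.
Proof.
move=> g0 gf goo; rewrite /Rintegral.
have I0 : (0 <= \int[mu]_(x in D) (g x)%:E)%E.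
  by apply: integral_ge0 => x Dx; rewrite lee_fin g0.
have : (- (\int[mu]_(x in D) (g x)%:E) <= \int[mu]_(x in D) (f x)%:E)%E.
  rewrite [leRHS]integralE; apply: (@le_trans _ _ (- (\int[mu]_(x in D) ((EFin \o f) ^\- x)))%E).
    rewrite leeN2; apply: ge0_le_integral_nonmeasurable => // x Dx.
    by rewrite funenegE /= -EFin_max lee_fin ge_max g0// andbT lerNl gf.
  by rewrite leeDr// integral_ge0.
case: (\int[mu]_(x in D) (f x)%:E)%E => [r| |] //= h.
- rewrite -lee_fin; apply: le_trans h.
  by rewrite EFinN fineK// ge0_fin_numE.
- by rewrite oppr_le0 fine_ge0.
- by move: h; rewrite leeNy_eq => /eqP/(congr1 oppe); rewrite oppeK /= => h; rewrite h in goo.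
Qed.

Lemma ge0_le_Rintegral_nonmeasurable D (f g : T -> R) :
  (forall x, D x -> 0 <= f x) -> (forall x, D x -> f x <= g x) ->
  (\int[mu]_(x in D) (g x)%:E < +oo)%E ->
  \int[mu]_(x in D) f x <= \int[mu]_(x in D) g x.
Proof.
move=> f0 fg; apply: le_Rintegral_nonmeasurable => // x Dx.
by rewrite (le_trans (f0 _ Dx)) ?fg.
Qed.

End integral_order.

Section finite_measure_line.
Variable R : realType.
Implicit Types mu nu : fmeasure R.

Definition distf mu (x : R) : R := fine (mu `]-oo, x]%classic).

Definition mass mu : R := fine (mu setT).

Lemma mu_fin mu (A : set (measurableTypeR R)) : measurable A -> mu A \is a fin_num.
Proof. exact: fin_num_measure. Qed.

Lemma distfE mu x : mu `]-oo, x]%classic = (distf mu x)%:E.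
Proof. by rewrite /distf fineK ?mu_fin. Qed.

Lemma massE mu : mu setT = (mass mu)%:E.
Proof. by rewrite /mass fineK ?mu_fin. Qed.

Lemma distf_le_mass mu x : distf mu x <= mass mu.
Proof. by rewrite -lee_fin -distfE -massE le_measure ?inE. Qed.

Lemma mass_ge0 mu : 0 <= mass mu.
Proof. exact: fine_ge0. Qed.

Lemma distf_nd mu x y : x <= y -> distf mu x <= distf mu y.
Proof.
move=> xy; rewrite -lee_fin -!distfE le_measure ?inE//.
exact: subitvPr.
Qed.

Lemma mu_itv_oc mu x y : x <= y ->
  mu `]x, y]%classic = (distf mu y - distf mu x)%:E.
Proof.
move=> xy.
have -> : `]x, y]%classic = `]-oo, y]%classic `\` `]-oo, x]%classic :> set R.
  apply/seteqP; split => z /=; rewrite !in_itv/=.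
    by move=> /andP[xz ->]; split => //; apply/negP; rewrite -ltNge.
  by move=> [-> /negP]; rewrite -ltNge => ->.
rewrite measureD//=; last by rewrite distfE ltry.
rewrite setIidr ?distfE//; exact: subitvPr.
Qed.

Lemma mu_itv_oy mu x : mu `]x, +oo[%classic = (mass mu - distf mu x)%:E.
Proof.
have -> : `]x, +oo[%classic = setT `\` `]-oo, x]%classic :> set R.
  apply/seteqP; split => z /=; rewrite !in_itv/= ?andbT.
    by move=> xz; split => //; apply/negP; rewrite -ltNge.
  by move=> [_ /negP]; rewrite -ltNge.
by rewrite measureD//= ?setTI ?distfE massE ?ltry.
Qed.

Lemma distf_right mu x e : 0 < e ->
  exists2 h, 0 < h & distf mu (x + h) < distf mu x + e.
Proof.
move=> e0; pose F n : set (measurableTypeR R) := `]-oo, x + n.+1%:R^-1]%classic.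
have : mu (F n) @[n --> \oo] --> mu (\bigcap_n F n).
  apply: nonincreasing_cvg_mu => //.
  - by rewrite /F/= distfE ltry.
  - by move=> k; exact: measurable_itv.
  - by apply: bigcapT_measurable => k; exact: measurable_itv.
  - move=> m n mn; apply/subsetPset; apply: subset_itvl.
    by rewrite bnd_simp lerD2l lef_pV2 ?posrE// ler_nat.
rewrite -itvNycEbigcap distfE => /fine_cvg /= /cvgrPdist_lt /(_ e e0) [n _ /(_ n (leqnn n))] /= h.
exists n.+1%:R^-1 => //; move: h; rewrite -/(distf mu _) distrC.
by move=> /(le_lt_trans (ler_norm _)); rewrite ltrBlDl.
Qed.

Lemma distf_near_mass mu e : 0 < e ->
  exists2 L, 0 < L & mass mu - e < distf mu L.
Proof.
move=> e0; pose F n : set (measurableTypeR R) := `]-oo, n.+1%:R]%classic.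
have FT : \bigcup_n F n = setT.
  rewrite -subTset => t _; exists (Num.bound (`|t|)) => //; rewrite /F/= in_itv/=.
  by rewrite (le_trans (ler_norm _))// (le_trans (ltW (archi_boundP (normr_ge0 t))))// ler_nat.
have : mu (F n) @[n --> \oo] --> mu (\bigcup_n F n).
  apply: nondecreasing_cvg_mu; [move=> k; exact: measurable_itv|by apply: bigcupT_measurable => k; exact: measurable_itv|].
  move=> m n mn; apply/subsetPset; apply: subset_itvl.
  by rewrite bnd_simp ler_nat.
rewrite FT massE => /fine_cvg /= /cvgrPdist_lt /(_ e e0) [n _ /(_ n (leqnn n))] /= h.
exists n.+1%:R => //; move: h; rewrite -/(distf mu _).
by move=> /(le_lt_trans (ler_norm _)); rewrite ltrBlDr -ltrBlDl.
Qed.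

Lemma notin_msupp mu x : ~ msupp mu x -> exists2 e, 0 < e & mu `]x - e, x + e[%classic = 0%E.
Proof.
move=> /existsNP[U /not_implyP[oU /not_implyP[Ux /negP]]].
rewrite -leNgt measure_le0 => /eqP U0.
move: (oU); rewrite openE => /(_ _ Ux) /nbhs_ballP[e /= e0 eU].
exists e => //; apply: (@subset_measure0 _ _ _ mu _ U _ (open_measurable oU) _ U0) => //.
move=> y /=; rewrite in_itv/= => ye; apply: eU; rewrite /ball/=.
by rewrite ltr_distlC.
Qed.

Lemma msupp_itv mu x a b : msupp mu x -> a < x < b -> (0 < mu `]a, b[%classic)%E.
Proof. by move=> mx axb; apply: mx => //=; rewrite in_itv. Qed.

Lemma closed_msupp mu : closed (msupp mu).
Proof.
rewrite -openC openE => x /= /notin_msupp[e e0 m0].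
apply/nbhs_ballP; exists e => //= y; rewrite /ball/= ltr_distlC => xy my.
by have := msupp_itv my xy; rewrite m0 ltxx.
Qed.

(** The complement of the support is covered by the null open intervals with rational ends, of which
    there are countably many. *)
Lemma mu_compl_msupp mu : mu (~` msupp mu) = 0%E.
Proof.
have [pk [upk upkK]] : exists pk : rat * rat -> nat, exists upk, pcancel pk upk.
  by exists pickle, unpickle; exact: pickleK.
pose F (n : nat) : set (measurableTypeR R) := if upk n is Some pq then
  let I := `]ratr pq.1, ratr pq.2[%classic : set (measurableTypeR R) in
  if mu I == 0%E then I else set0 else set0.
have F0 k : mu.-negligible (F k).
  rewrite /F; case: (upk k) => [[p q]|] /=; last exact: negligible_set0.
  by case: ifPn => [/eqP h|_]; [apply/negligibleP|exact: negligible_set0].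
apply: measure_negligible.
  by apply: measurableC; apply: closed_measurable; exact: closed_msupp.
apply: negligibleS (negligible_bigcup F0) => x /notin_msupp[e e0 m0].
have /rat_in_itvoo[p] : x - e < x by rewrite ltrBlDr ltrDl.
have /rat_in_itvoo[q] : x < x + e by rewrite ltrDl.
rewrite !in_itv/= => /andP[xq qe] /andP[ep px].
exists (pk (p, q)) => //; rewrite /F upkK/=.
have m1 : mu `]ratr p, ratr q[%classic = 0%E.
  apply: (@subset_measure0 _ _ _ mu _ `]x - e, x + e[%classic) m0; try exact: measurable_itv.
  move=> y /=; rewrite !in_itv/= => /andP[py yq].
  by rewrite (lt_trans ep py) (lt_trans yq qe).
by rewrite m1 eqxx /= in_itv/= px xq.
Qed.

Lemma mu_disj_msupp mu (A : set (measurableTypeR R)) : measurable A ->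
  (forall x, A x -> ~ msupp mu x) -> mu A = 0%E.
Proof.
move=> mA Am; apply: (subset_measure0 mA _ _ (mu_compl_msupp mu)) => //.
by apply: measurableC; apply: closed_measurable; exact: closed_msupp.
Qed.

(** The sets [Z n] on which the measures agree need not be monotone; continuity from below is
    applied to the [Y n] inside them. In the applications [Z n] is a half-line cut at a point of a
    selected gap, and these points only approximate the end of a block. *)
Lemma eq_mu_exhaust mu nu (X : set (measurableTypeR R)) (Y Z : nat -> set (measurableTypeR R)) :
  \bigcup_n Y n = X -> (forall m n, (m <= n)%N -> Y m `<=` Y n) ->
  (forall n, measurable (Y n)) -> (forall n, measurable (Z n)) ->
  (forall n, Y n `<=` Z n) -> (forall n, Z n `<=` X) ->
  (forall n, mu (Z n) = nu (Z n)) -> mu X = nu X.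
Proof.
move=> YX ndY mY mZ YZ ZX muZ.
have mX : measurable X by rewrite -YX; exact: bigcup_measurable.
suff H (m1 m2 : fmeasure R) : (forall n, m1 (Z n) = m2 (Z n)) -> (m1 X <= m2 X)%E.
  by apply/eqP; rewrite eq_le !H.
move=> m12; have : m1 (Y n) @[n --> \oo] --> m1 (\bigcup_n Y n).
  apply: nondecreasing_cvg_mu => //; first by rewrite YX.
  by move=> m n mn; apply/subsetPset; exact: ndY.
rewrite YX => /cvg_lim <- //; apply: lime_le.
  by apply: ereal_nondecreasing_is_cvgn => m n mn; rewrite le_measure ?inE//; exact: ndY.
apply: nearW => n; apply: (@le_trans _ _ (m1 (Z n))).
  by rewrite le_measure ?inE.
by rewrite m12 le_measure ?inE.
Qed.

End finite_measure_line.

(** * Smooth ramps *)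

Section smooth_step.
Variable R : realType.
Implicit Types (a h x y : R).

Definition pospart x : R := Num.max 0 x.

Lemma pospart_pos x : 0 <= x -> pospart x = x.
Proof. by rewrite /pospart => /max_idPr. Qed.

Lemma pospart_neg x : x <= 0 -> pospart x = 0.
Proof. by rewrite /pospart => /max_idPl. Qed.

(* Written with positive parts, so that the quadratic Taylor bounds
   [step_taylor] and [ramp_taylor] hold on the whole line. *)
Definition step x : R :=
  2 * (pospart x ^+ 2 - 2 * pospart (x - 2^-1) ^+ 2 + pospart (x - 1) ^+ 2).

Definition dstep x : R :=
  4 * (pospart x - 2 * pospart (x - 2^-1) + pospart (x - 1)).

Lemma stepP x :
  [\/ x <= 0 /\ step x = 0 /\ dstep x = 0,
      0 <= x <= 2^-1 /\ step x = 2 * x ^+ 2 /\ dstep x = 4 * x,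
      2^-1 <= x <= 1 /\ step x = 1 - 2 * (1 - x) ^+ 2 /\ dstep x = 4 * (1 - x)
    | 1 <= x /\ step x = 1 /\ dstep x = 0].
Proof.
rewrite /step /dstep.
have [x0|x0] := leP x 0.
  have [e1 e2] : x - 2^-1 <= 0 /\ x - 1 <= 0 by split; lra.
  by apply: Or41; rewrite !pospart_neg//; split => //; split; ring.
have [x2|x2] := leP x 2^-1.
  have [e1 e2] : x - 2^-1 <= 0 /\ x - 1 <= 0 by split; lra.
  apply: Or42; rewrite (pospart_pos (ltW x0)) (pospart_neg e1) (pospart_neg e2).
  by rewrite (ltW x0); split => //; split; ring.
have [x1|x1] := leP x 1.
  have [e1 e2] : 0 <= x - 2^-1 /\ x - 1 <= 0 by split; lra.
  apply: Or43; rewrite (pospart_pos (ltW x0)) (pospart_pos e1) (pospart_neg e2).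
  by rewrite (ltW x2); split => //; split; field.
have [e1 e2] : 0 <= x - 2^-1 /\ 0 <= x - 1 by split; lra.
apply: Or44; rewrite (pospart_pos (ltW x0)) (pospart_pos e1) (pospart_pos e2).
by rewrite (ltW x1); split => //; split; field.
Qed.

Lemma step_itv x : 0 <= step x <= 1.
Proof. by case: (stepP x) => -[xx [-> _]]; nra. Qed.

Lemma step_le0 x : x <= 0 -> step x = 0.
Proof. by case: (stepP x) => -[xx [-> _]]; nra. Qed.

Lemma step_ge1 x : 1 <= x -> step x = 1.
Proof. by case: (stepP x) => -[xx [-> _]]; nra. Qed.

Lemma dstep_itv x : 0 <= dstep x <= 2.
Proof. by case: (stepP x) => -[xx [_ ->]]; lra. Qed.

Lemma dstep_le0 x : x <= 0 -> dstep x = 0.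
Proof. by case: (stepP x) => -[xx [_ ->]]; lra. Qed.

Lemma dstep_ge1 x : 1 <= x -> dstep x = 0.
Proof. by case: (stepP x) => -[xx [_ ->]]; lra. Qed.

Lemma step_nd x y : x <= y -> step x <= step y.
Proof.
by case: (stepP x) => -[xx [-> _]]; case: (stepP y) => -[yy [-> _]] xy; nra.
Qed.

Lemma pospart2_taylor x y :
  0 <= pospart y ^+ 2 - pospart x ^+ 2 - 2 * pospart x * (y - x) <= (y - x) ^+ 2.
Proof.
have s := sqr_ge0 (y - x).
have [x0|x0] := leP x 0; have [y0|y0] := leP y 0.
- rewrite (pospart_neg x0) (pospart_neg y0); apply/andP; split; nra.
- rewrite (pospart_neg x0) (pospart_pos (ltW y0)); apply/andP; split; nra.
- rewrite (pospart_neg y0) (pospart_pos (ltW x0)); apply/andP; split; nra.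
- rewrite (pospart_pos (ltW x0)) (pospart_pos (ltW y0)); apply/andP; split; nra.
Qed.

(** The three squared positive parts have remainders between 0 and [(y - x) ^+ 2]. They enter with
    weights 2, -4 and 2, so the total lies within [4 * (y - x) ^+ 2] of 0. *)
Lemma step_taylor x y :
  `|step y - step x - dstep x * (y - x)| <= 4 * (y - x) ^+ 2.
Proof.
have h1 := pospart2_taylor x y.
have h2 := pospart2_taylor (x - 2^-1) (y - 2^-1).
have h3 := pospart2_taylor (x - 1) (y - 1).
rewrite ler_norml /step /dstep.
have e c : (y - c) - (x - c) = y - x by ring.
rewrite !e in h2 h3; apply/andP; split; lra.
Qed.

Definition ramp a h x : R := step ((x - a) / h).
Definition dramp a h x : R := dstep ((x - a) / h) / h.

Section ramp.
Variables (a h : R).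
Hypothesis h0 : 0 < h.

Lemma ramp_itv x : 0 <= ramp a h x <= 1.
Proof. exact: step_itv. Qed.

Lemma ramp_le x : x <= a -> ramp a h x = 0.
Proof. by move=> xa; rewrite /ramp step_le0// ler_pdivrMr// mul0r subr_le0. Qed.

Lemma ramp_ge x : a + h <= x -> ramp a h x = 1.
Proof. by move=> xa; rewrite /ramp step_ge1// ler_pdivlMr// mul1r; lra. Qed.

Lemma ramp_nd x y : x <= y -> ramp a h x <= ramp a h y.
Proof. by move=> xy; rewrite /ramp step_nd// ler_pM2r ?invr_gt0// lerB. Qed.

Lemma dramp_itv x : 0 <= dramp a h x <= 2 / h.
Proof.
have /andP[d0 d2] := dstep_itv ((x - a) / h).
by rewrite /dramp divr_ge0 ?(ltW h0)//= ler_pM2r ?invr_gt0.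
Qed.

Lemma dramp_le x : x <= a -> dramp a h x = 0.
Proof. by move=> xa; rewrite /dramp dstep_le0 ?mul0r// ler_pdivrMr// mul0r subr_le0. Qed.

Lemma dramp_ge x : a + h <= x -> dramp a h x = 0.
Proof. by move=> xa; rewrite /dramp dstep_ge1 ?mul0r// ler_pdivlMr// mul1r; lra. Qed.

Lemma ramp_taylor x y :
  `|ramp a h y - ramp a h x - dramp a h x * (y - x)| <= 4 / h ^+ 2 * (y - x) ^+ 2.
Proof.
have := step_taylor ((x - a) / h) ((y - a) / h).
have -> : (y - a) / h - (x - a) / h = (y - x) / h by field; rewrite gt_eqF.
rewrite /ramp /dramp => H; apply: le_trans (_ : _ <= 4 * ((y - x) / h) ^+ 2) _.
  by rewrite [_ / h * _]mulrAC -mulrA.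
by rewrite le_eqVlt; apply/orP; left; apply/eqP; field; rewrite gt_eqF.
Qed.

Lemma continuous_pospart : continuous (@pospart : R -> R).
Proof. by move=> x; apply: continuous_max; [exact: cvg_cst|exact: cvg_id]. Qed.

Lemma continuous_dramp : continuous (dramp a h).
Proof.
have c b : continuous (fun x => pospart ((x - a) / h - b)).
  move=> x; apply: (@continuous_comp _ _ _ (fun x => (x - a) / h - b) pospart); last exact: continuous_pospart.
  by apply: cvgB; [apply: cvgMl; apply: cvgB; [exact: cvg_id|exact: cvg_cst]|exact: cvg_cst].
move=> x; rewrite /dramp /dstep; apply: cvgMl; apply: cvgMr.
apply: cvgD; last exact: c.
apply: cvgB; last by apply: cvgMr; exact: c.
by have := c 0 x; rewrite /continuous_at; under eq_fun do rewrite subr0; rewrite subr0.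
Qed.

Lemma is_derive_ramp x : is_derive x 1 (ramp a h) (dramp a h x).
Proof.
suff H : (fun k => k^-1 *: ((ramp a h \o shift x) (k *: (1 : R)) - ramp a h x)) @ 0^' -->
    dramp a h x.
  apply: DeriveDef; first by apply/cvg_ex; exists (dramp a h x).
  exact: cvg_lim.
have K0 : 0 < 4 / h ^+ 2 by apply: divr_gt0 => //; exact: exprn_gt0.
apply/cvgrPdist_le => e e0.
near=> k.
have k0 : k != 0 by near: k; exact: nbhs_dnbhs_neq.
rewrite /= /GRing.scale /= mulr1 distrC.
have := ramp_taylor x (k + x); rewrite addrK => H.
have -> : k^-1 * (ramp a h (k + x) - ramp a h x) - dramp a h x =
  k^-1 * (ramp a h (k + x) - ramp a h x - dramp a h x * k) by field.
rewrite normrM normfV ler_pdivrMl ?normr_gt0//; apply: (le_trans H).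
rewrite -(ger0_norm (sqr_ge0 k)) normrX expr2 mulrCA ler_pM2l ?normr_gt0//.
rewrite -ler_pdivlMl//.
by near: k; apply: dnbhs0_le; rewrite mulr_gt0// invr_gt0.
Unshelve. all: by end_near. Qed.

End ramp.
End smooth_step.

(** * Weak derivatives in time *)

Section weak_derivative.
Variable R : realType.
Notation leb := (@lebesgue_measure R).
Implicit Types (f g : R -> R) (s t c e : R).

Lemma within_halfline_near f s e : {within @halfline R, continuous f} -> 0 <= s ->
  0 < e -> exists2 h, 0 < h & forall x, 0 <= x -> `|x - s| <= h -> `|f x - f s| < e.
Proof.
move=> cf s0 e0.
have hs : halfline s by rewrite /halfline /= in_itv/= s0.
move/subspace_continuousP : cf => /(_ s hs).
move=> /cvgrPdist_lt /(_ e e0); rewrite near_withinE => /nbhs_ballP[h /= h0 H].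
exists (h / 2); first by rewrite divr_gt0.
move=> x x0 xs; rewrite distrC; apply: H.
  by rewrite /ball/= distrC (le_lt_trans xs)// ltr_pdivrMr//; lra.
by rewrite /halfline /= in_itv/= x0.
Qed.

Lemma ae_lebesgue_filter : Filter (almost_everywhere leb).
Proof. exact: (ae_filter_ringOfSetsType (leb : {measure set _ -> \bar R})). Qed.

Lemma Rintegral_support (F : R -> R) s t : 0 < s ->
  (forall x, x < s \/ t < x -> F x = 0) ->
  \int[leb]_(x in `]0, +oo[) F x = \int[leb]_(x in `[s, t]) F x.
Proof.
move=> s0 F0.
have <- : `]0, +oo[%classic `&` `[s, t]%classic = `[s, t]%classic :> set R.
  apply/setIidr => x /=; rewrite !in_itv/= andbT => /andP[sx _].
  exact: lt_le_trans sx.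
rewrite Rintegral_mkcondr; apply: eq_Rintegral => x _; rewrite patchE.
case: ifPn => //; rewrite notin_setE /= in_itv/= => /negP.
by rewrite negb_and -!ltNge => /orP ?; rewrite F0.
Qed.

Lemma lebesgue_itv_cc s t : s <= t -> leb `[s, t]%classic = (t - s)%:E.
Proof.
rewrite le_eqVlt => /predU1P[->|st].
  by rewrite set_itv1 lebesgue_measure_set1 subrr.
by rewrite lebesgue_measure_itv /= lte_fin st -EFinB.
Qed.

Lemma integrable_itv_cont (F : R -> R) s t :
  {within `[s, t], continuous F} -> leb.-integrable `[s, t] (EFin \o F).
Proof. by move=> cF; apply: continuous_compact_integrable => //; exact: segment_compact. Qed.

Lemma integral_dramp s t a h : 0 < h -> s < t ->
  \int[leb]_(x in `[s, t]) dramp a h x = ramp a h t - ramp a h s.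
Proof.
move=> h0 st; rewrite /Rintegral (@continuous_FTC2 _ _ (ramp a h)) //=.
- exact/continuous_subspaceT/continuous_dramp.
- have cr : continuous (ramp a h).
    move=> x; apply: differentiable_continuous; apply/derivable1_diffP.
    exact: (@ex_derive _ _ _ _ _ _ _ (is_derive_ramp a h0 x)).
  split; [|exact/cvg_at_right_filter/cr|exact/cvg_at_left_filter/cr].
  by move=> x _; exact: (@ex_derive _ _ _ _ _ _ _ (is_derive_ramp a h0 x)).
- move=> x _; rewrite derive1E.
  exact: (@derive_val _ _ _ _ _ _ _ (is_derive_ramp a h0 x)).
Qed.

Lemma continuous_ramp a h : 0 < h -> continuous (ramp a h : R -> R).
Proof.
move=> h0 x; apply: differentiable_continuous; apply/derivable1_diffP.
exact: (@ex_derive _ _ _ _ _ _ _ (is_derive_ramp a h0 x)).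
Qed.

(** The bump equals 1 on [[s, t]] except on two end intervals of length [h]; there it lies between 0
    and 1, so the integrand falls short of [c] by at most [|c|]. *)
Lemma integral_ramp_bump_ge s t h c : 0 < h -> s + h + h <= t ->
  c * (t - s) - 2 * `|c| * h <=
  \int[leb]_(x in `[s, t]) (c * (ramp s h x - ramp (t - h) h x)).
Proof.
move=> h0 sht.
have st : s <= t by lra.
pose A : set R := `[s, s + h]%classic; pose B : set R := `[t - h, t]%classic.
pose b x : R := c - `|c| * (\1_A x + \1_B x).
have ci : {within `[s, t], continuous (fun x => c * (ramp s h x - ramp (t - h) h x))}.
  apply: continuous_subspaceT => x; apply: cvgMr; apply: cvgB; exact: continuous_ramp.
have fin : (leb `[s, t]%classic < +oo)%E by rewrite lebesgue_itv_cc ?ltry.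
have mA : measurable A by exact: measurable_itv.
have mB : measurable B by exact: measurable_itv.
have iA (C : set R) : measurable C -> leb.-integrable `[s, t] (EFin \o (\1_C : R -> R)).
  move=> mC; apply: measurable_bounded_integrable => //.
  by exists 1; split => // M M1 x _; rewrite /= ger0_norm ?(le_trans _ (ltW M1))//.
have iAB : leb.-integrable `[s, t] (EFin \o (fun x => \1_A x + \1_B x : R)).
  by apply: eq_integrable (integrableD _ (iA A mA) (iA B mB)).
have ic r : leb.-integrable `[s, t] (EFin \o (fun=> r : R)).
  by apply: integrable_itv_cont; apply: continuous_subspaceT => x; exact: cvg_cst.
have iAB' : leb.-integrable `[s, t] (EFin \o (fun x => `|c| * (\1_A x + \1_B x) : R)).
  by apply: eq_integrable (integrableZl _ `|c| iAB).
have Rind (C : set R) : measurable C -> C `<=` `[s, t]%classic ->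
    \int[leb]_(x in `[s, t]) (\1_C x : R) = fine (leb C).
  by move=> mC Cst; rewrite /Rintegral integral_indic// setIidl.
have -> : c * (t - s) - 2 * `|c| * h = \int[leb]_(x in `[s, t]) b x.
  rewrite /b RintegralB//. rewrite Rintegral_cst; last exact: measurable_itv.
  have -> : fine (lebesgue_measure (`[s, t]%classic : set (measurableTypeR R))) = t - s.
    exact: (congr1 fine (lebesgue_itv_cc st)).
  rewrite RintegralZl//.
  rewrite RintegralD ?iA// !Rind//.
  - rewrite /A /B !lebesgue_itv_cc/=; [ring|lra|lra].
  - by move=> x; rewrite /A /B /= !in_itv/= => /andP[? ->]; rewrite andbT; lra.
  - by move=> x; rewrite /A /B /= !in_itv/= => /andP[-> ?] /=; lra.
apply: le_Rintegral => //.
- by apply: eq_integrable (integrableB _ (ic c) iAB').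
- exact: integrable_itv_cont.
move=> x /=; rewrite in_itv/= => /andP[sx xt]; rewrite /b !indicE.
have /andP[r0 r1] := ramp_itv s h x.
have /andP[q0 q1] := ramp_itv (t - h) h x.
have [xs|xs] := leP x (s + h).
  rewrite (_ : x \in A) ?mulr1n; last by rewrite inE /A /= in_itv/= sx xs.
  rewrite (@ramp_le _ (t - h)); [|lra..].
  have : 0 <= (x \in B)%:R :> R by [].
  have := ler_norm c; have := ler_norm (- c); rewrite normrN; nra.
rewrite (@ramp_ge _ s)//; last exact: ltW.
have [xh|xh] := leP (t - h) x.
  rewrite (_ : x \in B) ?mulr1n; last by rewrite inE /B /= in_itv/= xt xh.
  have : 0 <= (x \in A)%:R :> R by [].
  have := ler_norm c; have := ler_norm (- c); rewrite normrN; nra.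
rewrite (@ramp_le _ (t - h))//; last exact: ltW.
have : 0 <= `|c| * ((x \in A)%:R + (x \in B)%:R) by rewrite mulr_ge0// addr_ge0.
lra.
Qed.

(* The test function [psi] ramps up right after [s] and back down right before
   [t]; the continuity of [f] localizes both ramps. *)
Lemma weak_derivative_ge_pos f g c s t : {within @halfline R, continuous f} ->
  is_W1infty_loc f g -> 0 < s -> s < t ->
  {ae leb, forall x, s < x < t -> c <= g x} -> c * (t - s) <= f t - f s.
Proof.
move=> cf [_ [mg bg] wfg] s0 st gc.
have t0 : 0 < t by exact: lt_trans st.
apply/ler_addgt0Pr => e e0.
have e4 : 0 < e / 4 by rewrite divr_gt0.
have [h1 h10 H1] := within_halfline_near cf (ltW s0) e4.
have [h2 h20 H2] := within_halfline_near cf (ltW t0) e4.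
have [h [h0 hh1 hh2 hst hc]] : exists h, [/\ 0 < h, h <= h1, h <= h2, s + h + h <= t &
    2 * `|c| * h <= e / 4].
  exists (Num.min (Num.min h1 h2) (Num.min ((t - s) / 2) (e / 4 / (2 * `|c| + 1)))).
  have c0 : 0 < 2 * `|c| + 1 by rewrite ltr_wpDl// mulr_ge0.
  have ts0 : 0 < (t - s) / 2 by lra.
  set h := Num.min _ _.
  have : h <= Num.min h1 h2 by rewrite ge_min lexx.
  have : h <= Num.min ((t - s) / 2) (e / 4 / (2 * `|c| + 1)) by rewrite ge_min lexx orbT.
  rewrite !le_min => /andP[hA hB] /andP[hC hD]; split => //.
  - by rewrite /h !lt_min h10 h20 ts0 divr_gt0.
  - lra.
  - move: hB; rewrite ler_pdivlMr// mulrDr mulr1 mulrC => hB.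
    suff : 0 <= h by lra.
    by rewrite /h !le_min (ltW h10) (ltW h20) (ltW ts0) divr_ge0// ltW.
pose psi x := ramp s h x - ramp (t - h) h x.
pose dpsi x := dramp s h x - dramp (t - h) h x.
have dpsiE (x : R) : is_derive x (1 : R) psi (dpsi x).
  exact: is_deriveB (is_derive_ramp s h0 x) (is_derive_ramp (t - h) h0 x).
have d1 : derive1 psi = dpsi.
  by apply/funext => x; rewrite derive1E; exact: (@derive_val _ _ _ _ _ _ _ (dpsiE x)).
have cpsi : continuous psi by move=> x; apply: cvgB; exact: continuous_ramp.
have cdpsi : continuous dpsi by move=> x; apply: cvgB; exact: continuous_dramp.
have psi0 x : x < s \/ t < x -> psi x = 0.
  rewrite /psi => -[xs|tx]; first by rewrite !ramp_le ?subrr//; lra.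
  by rewrite !ramp_ge ?subrr//; lra.
have dpsi0 x : x < s \/ t < x -> dpsi x = 0.
  rewrite /dpsi => -[xs|tx]; first by rewrite !dramp_le ?subrr//; lra.
  by rewrite !dramp_ge ?subrr//; lra.
have : is_C1c psi.
  split; [by move=> x; exact: (@ex_derive _ _ _ _ _ _ _ (dpsiE x))|by rewrite d1|].
  by exists s, t.
move=> /wfg; rewrite d1.
rewrite (@Rintegral_support _ s t)//; last by move=> x /dpsi0 ->; rewrite mulr0.
rewrite (@Rintegral_support _ s t)//; last by move=> x /psi0 ->; rewrite mulr0.
have cfst : {within `[s, t], continuous f}.
  apply: continuous_subspaceW cf => x; rewrite /halfline/= !in_itv/= andbT => /andP[sx _].
  by rewrite (le_trans (ltW s0)).
have cwst (F : R -> R) : continuous F -> {within `[s, t], continuous F}.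
  by move=> ?; exact: continuous_subspaceT.
have iu a : leb.-integrable `[s, t] (EFin \o dramp a h).
  by apply: integrable_itv_cont; apply: cwst; exact: continuous_dramp.
have iuZ r a : leb.-integrable `[s, t] (EFin \o (fun x => r * dramp a h x)).
  apply: integrable_itv_cont; apply: cwst => x; apply: cvgMr; exact: continuous_dramp.
(* The derivative of each ramp is nonnegative with integral 1, and [f] stays within [e / 4] of [f s]
   on the first ramp and of [f t] on the second. *)
have lhs : f s - f t - e / 2 <= \int[leb]_(x in `[s, t]) (f x * dpsi x).
  have -> : f s - f t - e / 2 = \int[leb]_(x in `[s, t])
      ((f s - e / 4) * dramp s h x - (f t + e / 4) * dramp (t - h) h x).
    rewrite RintegralB// !RintegralZl// !integral_dramp//.
    rewrite !(@ramp_ge _ _ _ _ t) ?(@ramp_le _ _ _ _ s)//; try lra.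
  apply: le_Rintegral => //.
  - by apply: eq_integrable (integrableB _ (iuZ (f s - e / 4) s) (iuZ (f t + e / 4) (t - h))).
  - apply: integrable_itv_cont => x; apply: cvgM; first exact: cfst.
    exact: (cwst _ cdpsi).
  move=> x; rewrite /= in_itv/= => /andP[sx xt]; rewrite /dpsi mulrBr.
  have x0 : 0 <= x by rewrite (le_trans (ltW s0)).
  apply: lerB.
    have [xs|xs] := leP (s + h) x; first by rewrite dramp_ge// !mulr0.
    have /andP[d0 _] := @dramp_itv R s h h0 x.
    apply: ler_wpM2r => //.
    have := H1 x x0; rewrite ger0_norm ?subr_ge0// => /(_ _).
    by move=> /(_ ltac:(lra)); rewrite ltr_norml => /andP[? _]; lra.
  have [xs|xs] := leP x (t - h); first by rewrite dramp_le// !mulr0.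
  have /andP[d0 _] := @dramp_itv R (t - h) h h0 x.
  apply: ler_wpM2r => //.
  have := H2 x x0; rewrite distrC ger0_norm ?subr_ge0// => /(_ _).
  by move=> /(_ ltac:(lra)); rewrite ltr_norml => /andP[_ ?]; lra.
have [C bC] := bg t t0.
(* The truncation [g2] of [g] agrees with [g] almost everywhere on []s, t[]. It is bounded and at
   least [c] everywhere, so the integrals can be compared pointwise. *)
pose K := Num.max `|C| `|c|.
pose g2 x := Num.max c (Num.min K (g x)).
have mg' : measurable_fun (`[s, t] : set R) g.
  apply: measurable_funS mg; first exact: measurable_itv.
  by move=> x; rewrite /halfline/= !in_itv/= andbT => /andP[sx _]; rewrite (le_trans (ltW s0)).
have mpsi : measurable_fun (`[s, t] : set R) psi.
  by apply: measurable_funTS; exact: continuous_measurable_fun.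
have mg2 : measurable_fun (`[s, t] : set R) g2.
  by apply: measurable_maxr => //; apply: measurable_minr.
have g2E : \int[leb]_(x in `[s, t]) (g x * psi x) = \int[leb]_(x in `[s, t]) (g2 x * psi x).
  congr fine; apply: ae_eq_integral => //.
  - by apply/measurable_EFinP; exact: measurable_funM.
  - by apply/measurable_EFinP; exact: measurable_funM.
  move: gc bC; apply: (@filterS2 _ _ ae_lebesgue_filter) => x gx Cx /=; rewrite in_itv/= => /andP[sx xt].
  have [->|xs] := eqVneq x s; first by rewrite /psi !ramp_le ?subrr ?mulr0//; lra.
  have [->|xt'] := eqVneq x t; first by rewrite /psi !ramp_ge ?subrr ?mulr0//; lra.
  have gx' : c <= g x by apply: gx; rewrite !lt_neqAle eq_sym xs sx xt' xt.
  have Cx' : `|g x| <= C by apply: Cx; rewrite xt (le_trans (ltW s0)).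
  congr (_ * _)%:E; rewrite /g2.
  have -> : Num.min K (g x) = g x.
    apply/min_idPr; rewrite (le_trans (ler_norm _))// (le_trans Cx')//.
    by rewrite (le_trans (ler_norm C))// /K le_max lexx.
  by apply/esym/max_idPr.
rewrite g2E => lr.
have rhs : c * (t - s) - e / 4 <= \int[leb]_(x in `[s, t]) (g2 x * psi x).
  apply: (@le_trans _ _ (c * (t - s) - 2 * `|c| * h)); first lra.
  apply: (le_trans (integral_ramp_bump_ge c h0 hst)).
  have K0 : 0 <= K by rewrite /K le_max normr_ge0.
  apply: le_Rintegral => //.
  - by apply: integrable_itv_cont; apply: cwst => x; apply: cvgMr; exact: cpsi.
  - have fin : (leb `[s, t]%classic < +oo)%E by rewrite lebesgue_itv_cc ?ltry// ltW.
    apply: measurable_bounded_integrable => //; first exact: measurable_funM.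
    exists K; split; [exact: num_real|move=> M KM x]; rewrite /= in_itv/= => /andP[sx xt].
    have psi1 : `|psi x| <= 1.
      rewrite /psi; have := ramp_itv s h x; have := ramp_itv (t - h) h x.
      by rewrite ler_norml; lra.
    rewrite normrM (le_trans _ (ltW KM))// -[leRHS]mulr1 ler_pM//.
    rewrite /g2 ler_norml; apply/andP; split.
      rewrite le_max; apply/orP; left; rewrite lerNl.
      by rewrite (le_trans (ler_norm _))// normrN /K le_max lexx orbT.
    rewrite ge_max ge_min lexx andbT (le_trans (ler_norm c))//.
    by rewrite /K le_max lexx orbT.
  move=> x _; rewrite -/(psi x); apply: ler_wpM2r; last by rewrite /g2 le_max lexx.
  rewrite /psi subr_ge0.
  have [xt|xt] := leP x (t - h).
    by rewrite (@ramp_le _ (t - h))//; case/andP: (ramp_itv s h x).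
  by rewrite (@ramp_ge _ s)//; [case/andP: (ramp_itv (t - h) h x)|lra].
lra.
Qed.

(** The test functions in time vanish near 0, so the starting time [s = 0] is reached from [s + r]
    by continuity of [f]. *)
Lemma weak_derivative_ge f g c s t : {within @halfline R, continuous f} ->
  is_W1infty_loc f g -> 0 <= s -> s <= t ->
  {ae leb, forall x, s < x < t -> c <= g x} -> c * (t - s) <= f t - f s.
Proof.
move=> cf wfg s0; rewrite le_eqVlt => /predU1P[->|st gc]; first by rewrite !subrr mulr0.
apply/ler_addgt0Pr => e e0.
have e2 : 0 < e / 2 by rewrite divr_gt0.
have [h h0 H] := within_halfline_near cf s0 e2.
pose r := Num.min h (Num.min ((t - s) / 2) (e / 2 / (`|c| + 1))).
have c0 : 0 < `|c| + 1 by rewrite ltr_wpDl.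
have r0 : 0 < r by rewrite !lt_min h0 !divr_gt0// subr_gt0.
have rh : r <= h by rewrite /r ge_min lexx.
have rts : r <= (t - s) / 2 by rewrite /r !ge_min lexx !orbT.
have rc : `|c| * r <= e / 2.
  have : r <= e / 2 / (`|c| + 1) by rewrite /r !ge_min lexx !orbT.
  by rewrite ler_pdivlMr// mulrDr mulr1 mulrC; lra.
have : c * (t - (s + r)) <= f t - f (s + r).
  apply: (weak_derivative_ge_pos cf wfg); [lra|lra|].
  by apply: (@filterS _ _ ae_lebesgue_filter) gc => x xs /andP[sx xt]; apply: xs; rewrite xt andbT; lra.
have : `|f (s + r) - f s| < e / 2.
  by apply: H; [lra|rewrite (_ : s + r - s = r) ?gtr0_norm//; ring].
rewrite ltr_norml => /andP[? ?].
have : c * r <= `|c| * r by rewrite ler_wpM2r ?ler_norm ?ltW.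
lra.
Qed.

End weak_derivative.

(** * The cut-off region *)

Section region_geometry.
Variables (R : realType) (theta delta : R).
Hypotheses (theta01 : 0 < theta < 1) (delta0 : 0 < delta).
Notation rho := (rho_star theta delta).
Notation D := (Dset theta delta).

Let theta_gt0 : 0 < theta. Proof. by case/andP: theta01. Qed.
Let theta_lt1 : theta < 1. Proof. by case/andP: theta01. Qed.

Lemma rho_star_sqr : rho ^+ 2 = (1 - theta) ^+ 2 / (theta * (1 + theta) * delta).
Proof.
rewrite /rho_star expr_div_n sqr_sqrtr//.
by rewrite !mulr_ge0 ?addr_ge0 ?(ltW theta_gt0) ?(ltW delta0).
Qed.

Lemma rho_star_gt0 : 0 < rho.
Proof.
by rewrite /rho_star divr_gt0 ?subr_gt0// sqrtr_gt0 !mulr_gt0// addr_gt0.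
Qed.

Lemma le_mul_sqrt (u r Y : R) : 0 <= u -> 0 <= r -> 0 <= Y ->
  (u <= r * Num.sqrt Y) = (u ^+ 2 <= r ^+ 2 * Y).
Proof.
move=> u0 r0 Y0; rewrite -[in RHS](sqr_sqrtr Y0) -exprMn ler_sqr//.
by rewrite nnegrE mulr_ge0// sqrtr_ge0.
Qed.

Lemma Dset_sym k k' : D (k, k') -> D (k', k).
Proof.
move=> [/= k0 k'0]; rewrite /Dset /region /= andbC distrC [k' * k]mulrC [k' + k]addrC.
case: ifP => // _ /andP[h1 h2]; split => //; apply/andP; split.
  by rewrite -ler_pdivlMl.
by rewrite ler_pdivlMl.
Qed.

Lemma Dset_axis k : 0 < k -> ~ D (k, 0).
Proof.
move=> k0 [_ _] /=; case: ifP => _.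
  by rewrite mulr0 mul0r sqrtr0 mulr0 subr0 normr_le0 gt_eqF.
by rewrite pmulr_rle0// leNgt k0.
Qed.

(** The quotient [(c - x) ^+ 2 / (c * (c + x))] is nondecreasing in [c >= x], as the product of
    [(c - x) / c] and [(c - x) / (c + x)]. *)
Lemma square_region_mono (x b c : R) : 0 < x -> x <= b -> b <= c ->
  (c - x) ^+ 2 <= rho ^+ 2 * (c * x * (c + x)) ->
  (b - x) ^+ 2 <= rho ^+ 2 * (b * x * (b + x)).
Proof.
move=> x0 xb bc h.
have b0 : 0 < b by lra.
have c0 : 0 < c by lra.
have cx0 : 0 < c * (c + x) by rewrite mulr_gt0// addr_gt0.
rewrite -(ler_pM2r cx0).
have h1 : (b - x) * c <= (c - x) * b by nra.
have h2 : (b - x) * (c + x) <= (c - x) * (b + x) by nra.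
have h3 : (b - x) ^+ 2 * (c * (c + x)) <= (c - x) ^+ 2 * (b * (b + x)).
  rewrite (_ : _ * (c * _) = ((b - x) * c) * ((b - x) * (c + x))); last by ring.
  rewrite (_ : _ * (b * _) = ((c - x) * b) * ((c - x) * (b + x))); last by ring.
  by apply: ler_pM => //; apply: mulr_ge0; lra.
apply: (le_trans h3).
rewrite (_ : rho ^+ 2 * (b * x * (b + x)) * (c * (c + x)) =
  rho ^+ 2 * (c * x * (c + x)) * (b * (b + x))); last by ring.
by apply: ler_wpM2r => //; rewrite mulr_ge0// ?addr_ge0// ltW.
Qed.

(* The two descriptions of [D] match at [k' = delta], by the choice of
   [rho_star]: there [delta - x <= rho * sqrt (delta * x * (delta + x))] holds
   as soon as [theta * delta <= x]. *)
Lemma Dset_toward_diagonal x b k' : 0 < x -> x <= b -> b <= k' -> D (x, k') -> D (b, x).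
Proof.
move=> x0 xb bk' [/= _ k'0 xk'].
have b0 : 0 < b by lra.
have r0 := ltW rho_star_gt0.
split => /=; [lra|lra|].
have sq c : 0 < c -> x <= c -> (`|c - x| <= rho * Num.sqrt (c * x * (c + x))) =
    ((c - x) ^+ 2 <= rho ^+ 2 * (c * x * (c + x))).
  move=> c0 xc; rewrite le_mul_sqrt ?real_normK ?num_real//.
  by rewrite !mulr_ge0// ?addr_ge0// ltW.
have [k'd|k'd] := leP k' delta.
  have [bd xd] : b <= delta /\ x <= delta by split; lra.
  rewrite bd xd/=.
  move: xk'; rewrite k'd xd /=.
  rewrite distrC [x * k']mulrC [x + k']addrC sq; [|lra|lra].
  by rewrite sq//; exact: square_region_mono.
move: xk'; rewrite (leNgt k') k'd andbF => /andP[_ ].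
rewrite ler_pdivlMl// => xk'.
have [bd|bd] /= := leP b delta.
  have xd : x <= delta by lra.
  rewrite xd /=.
  rewrite sq//; apply: (square_region_mono x0 xb bd).
  have tx : theta * delta <= x by apply: le_trans xk'; rewrite ler_pM2l// ltW.
  rewrite rho_star_sqr mulrAC ler_pdivlMr; last by rewrite !mulr_gt0// addr_gt0.
  have h1 : (delta - x) ^+ 2 <= ((1 - theta) * delta) ^+ 2 by rewrite ler_sqr ?nnegrE; nra.
  have h2 : theta * delta * ((1 + theta) * delta) <= x * (delta + x).
    by apply: ler_pM; rewrite ?mulr_ge0 ?addr_ge0 ?ltW//; nra.
  rewrite -(ler_pM2r delta0).
  have -> : (delta - x) ^+ 2 * (theta * (1 + theta) * delta) * delta =
    (delta - x) ^+ 2 * (theta * delta * ((1 + theta) * delta)) by ring.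
  have -> : (1 - theta) ^+ 2 * (delta * x * (delta + x)) * delta =
    ((1 - theta) * delta) ^+ 2 * (x * (delta + x)) by ring.
  by apply: ler_pM => //; rewrite ?sqr_ge0// !mulr_ge0 ?addr_ge0 ?ltW.
apply/andP; split; first by apply: le_trans xk'; rewrite ler_pM2l.
by rewrite ler_pdivlMl//; nra.
Qed.

Lemma Dset_bounded p q : 0 < p -> exists c A, [/\ 0 < c, c <= p, q <= A &
  forall k k', p <= k <= q -> D (k, k') -> c <= k' <= A].
Proof.
move=> p0.
(* The second term serves outside the square [[0, delta]^2]. Inside it, either [k' > p / 2], or [(p
   / 2) ^+ 2 <= (k - k') ^+ 2 <= 2 * rho ^+ 2 * delta ^+ 2 * k'], which is the third term. *)
pose c := Num.min (p / 2) (Num.min (theta * p) (p ^+ 2 / (8 * rho ^+ 2 * delta ^+ 2))).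
pose A := Num.max (theta^-1 * q) (Num.max q delta).
have r0 := rho_star_gt0.
have den0 : 0 < 8 * rho ^+ 2 * delta ^+ 2.
  by apply: mulr_gt0; [apply: mulr_gt0 => //|]; exact: exprn_gt0.
exists c, A; split.
- by rewrite /c !lt_min divr_gt0//= mulr_gt0//= divr_gt0// exprn_gt0.
- by rewrite /c ge_min; apply/orP; left; lra.
- by rewrite /A !le_max lexx !orbT.
move=> k k' /andP[pk kq] [/= k0 k'0].
have cp : c <= p / 2 by rewrite /c !ge_min lexx ?orbT.
have ct : c <= theta * p by rewrite /c !ge_min lexx ?orbT.
have cr : c <= p ^+ 2 / (8 * rho ^+ 2 * delta ^+ 2) by rewrite /c !ge_min lexx ?orbT.
have Aq : theta^-1 * q <= A by rewrite /A !le_max lexx ?orbT.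
have Ad : delta <= A by rewrite /A !le_max lexx ?orbT.
case: ifP => [/andP[kd k'd] h|_ /andP[h1 h2]].
  apply/andP; split; last lra.
  have [k'p|k'p] := leP (p / 2) k'; first lra.
  apply: (le_trans cr); rewrite ler_pdivrMr//.
  move: h; rewrite le_mul_sqrt ?normr_ge0 ?(ltW r0) ?real_normK ?num_real//; last first.
    by rewrite !mulr_ge0// addr_ge0.
  move=> h.
  have h1 : (p / 2) ^+ 2 <= (k - k') ^+ 2 by rewrite ler_sqr ?nnegrE; lra.
  have h3 : k * k' * (k + k') <= delta * k' * (2 * delta).
    by apply: ler_pM; rewrite ?mulr_ge0 ?addr_ge0//; [rewrite ler_wpM2r|lra].
  have h2 : rho ^+ 2 * (k * k' * (k + k')) <= rho ^+ 2 * (delta * k' * (2 * delta)).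
    by rewrite ler_wpM2l// sqr_ge0.
  have : (p / 2) ^+ 2 = p ^+ 2 / 4 by field.
  have -> : k' * (8 * rho ^+ 2 * delta ^+ 2) = 4 * (rho ^+ 2 * (delta * k' * (2 * delta))) by ring.
  lra.
apply/andP; split.
  by apply: (le_trans ct); apply: le_trans h1; rewrite ler_pM2l.
by apply: (le_trans h2); apply: le_trans Aq; rewrite ler_pM2l// invr_gt0.
Qed.

Lemma region_near_diagonal theta1 rho1 p : theta1 < 1 -> 0 < theta1 -> 0 < rho1 -> 0 < p ->
  exists2 r, 0 < r < p & forall k k', `|k - p| < r -> `|k' - p| < r ->
    region theta1 rho1 delta (k, k').
Proof.
move=> t1 t0 r1 p0.
(* [w] bounds the square-root width from below when both [k] and [k'] exceed [p / 2]. Each branch of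
   the region is checked for all such pairs, so the position of [p] relative to [delta] does not
   matter. *)
pose w := rho1 * Num.sqrt (p / 2 * (p / 2) * p).
have w0 : 0 < w by rewrite mulr_gt0// sqrtr_gt0 !mulr_gt0// divr_gt0.
have t2 : 0 < (1 - theta1) * p / 4 by rewrite divr_gt0// mulr_gt0// subr_gt0.
pose r := Num.min (p / 2) (Num.min (w / 2) ((1 - theta1) * p / 4)).
have rp : r <= p / 2 by rewrite /r !ge_min lexx ?orbT.
have rw : r <= w / 2 by rewrite /r !ge_min lexx ?orbT.
have rt : r <= (1 - theta1) * p / 4 by rewrite /r !ge_min lexx ?orbT.
exists r.
  by apply/andP; split; [rewrite /r !lt_min t2 !divr_gt0|lra].
move=> k k'; rewrite !ltr_norml => /andP[k1 k2] /andP[k3 k4].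
split => /=; [lra|lra|].
case: ifP => _.
  apply: (@le_trans _ _ w); first by rewrite ler_norml; apply/andP; split; lra.
  rewrite /w ler_pM2l// ler_sqrt; last by apply: mulr_ge0; [apply: mulr_ge0|]; lra.
  by apply: ler_pM; [apply: mulr_ge0; lra|lra|apply: ler_pM; lra|lra].
apply/andP; split; first nra.
by rewrite ler_pdivlMl//; nra.
Qed.

End region_geometry.

Section cutoff_theory.
Variables (R : realType) (theta delta : R) (Phi : R * R -> R).
Hypotheses (theta01 : 0 < theta < 1) (delta0 : 0 < delta).
Hypothesis Phi_cutoff : is_cutoff theta delta Phi.
Notation D := (Dset theta delta).

Lemma cutoff_neq0 k k' : 0 <= k -> 0 <= k' -> Phi (k, k') != 0 -> D (k, k').
Proof.
move=> k0 k'0 P0; rewrite -(cutoff_supp Phi_cutoff); apply: subset_closure.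
by split.
Qed.

Lemma cutoff_ge0 k k' : 0 <= k -> 0 <= k' -> 0 <= Phi (k, k') <= 1.
Proof. by move=> k0 k'0; apply: (cutoff_range Phi_cutoff). Qed.

Lemma cutoff_axis k : 0 < k -> Phi (k, 0) = 0 /\ Phi (0, k) = 0.
Proof.
move=> k0; have P0 : Phi (k, 0) = 0.
  have [//|P0] := eqVneq (Phi (k, 0)) 0.
  by case: (@Dset_axis R theta delta theta01 k k0); apply: cutoff_neq0; rewrite ?(ltW k0).
by split=> //; rewrite (cutoff_sym Phi_cutoff) ?P0//; exact: ltW.
Qed.

Lemma cutoff_near_diagonal p : 0 < p ->
  exists2 r, 0 < r < p & forall k k', `|k - p| < r -> `|k' - p| < r ->
    Phi (k, k') = 1 /\ D (k, k').
Proof.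
move=> p0; have [t1 [r1 [/andP[tt1 t11] r10 sub P1]]] := cutoff_one Phi_cutoff.
have t10 : 0 < t1 by case/andP: theta01 => ? _; lra.
have [r rp H] := @region_near_diagonal R delta t1 r1 p t11 t10 r10 p0.
by exists r => // k k' kp k'p; have := H k k' kp k'p; split; [exact: P1|exact: sub].
Qed.

Lemma cutoff_lower_near p q : 0 < p -> 0 < q -> Phi (p, q) != 0 ->
  exists r c, [/\ 0 < r, r < p, r < q, 0 < c &
    forall k k', `|k - p| <= r -> `|k' - q| <= r -> c <= Phi (k, k')].
Proof.
move=> p0 q0 P0.
have Pp : 0 < Phi (p, q).
  by rewrite lt_neqAle eq_sym P0; case/andP: (cutoff_ge0 (ltW p0) (ltW q0)).
have pq : (@quadrant R `\ (0, 0)) (p, q).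
  by split; [split; exact: ltW|move=> [/eqP]; rewrite gt_eqF].
have c20 : 0 < Phi (p, q) / 2 by rewrite divr_gt0.
have /subspace_continuousP/(_ (p, q) pq)/cvgrPdist_lt/(_ _ c20) := cutoff_cont Phi_cutoff.
rewrite near_withinE => /nbhs_ballP[e /= e0 H].
pose r := Num.min (e / 2) (Num.min (p / 2) (q / 2)).
have re : r <= e / 2 by rewrite /r !ge_min lexx ?orbT.
have rp : r <= p / 2 by rewrite /r !ge_min lexx ?orbT.
have rq : r <= q / 2 by rewrite /r !ge_min lexx ?orbT.
exists r, (Phi (p, q) / 2); split => //.
- by rewrite /r !lt_min !divr_gt0.
- lra.
- lra.
move=> k k' kp k'q.
have kk : ball (p, q) e (k, k').
  by split; rewrite /ball /= distrC; [apply: le_lt_trans kp _|apply: le_lt_trans k'q _]; lra.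
have := H (k, k') kk; rewrite ltr_distl => /(_ _) Hk.
move: kp k'q; rewrite !ler_norml => /andP[? ?] /andP[? ?].
have : (@quadrant R `\ (0, 0)) (k, k').
  split; first by split => /=; lra.
  by move=> [k0 _]; lra.
move=> /Hk /andP[_ h].
have {}h : Phi (p, q) < Phi (k, k') + Phi (p, q) / 2 := h.
lra.
Qed.

(** This is the effect of a selected gap. If [Phi (k, k') != 0], then by continuity [D] contains
    [(k - r, k')] for a small [r]; moving toward the diagonal, it contains [(b, k - r)], whence
    [gamma1 D b <= k - r < a]. *)
Lemma cutoff_decoupled a b k k' : 0 <= a -> a < b -> a <= gamma1 D b ->
  0 <= k <= a -> b <= k' -> k * k' != 0 -> Phi (k, k') = 0.
Proof.
move=> a0 ab ag /andP[k0 ka] bk' kk'; apply/eqP; apply: contraT => P0.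
have kgt0 : 0 < k by rewrite lt_neqAle k0 andbT eq_sym; apply: contra_neq kk' => ->; rewrite mul0r.
have k'0 : 0 < k' by lra.
have [r [c [r0 rk _ c0 H]]] := cutoff_lower_near kgt0 k'0 P0.
(* The shift by [r] makes the final inequality strict even when [k = a]. *)
have DD : D (k - r, k').
  apply: cutoff_neq0; [lra|lra|].
  rewrite gt_eqF// (lt_le_trans c0)// H ?subrr ?normr0 ?(ltW r0)//.
  by rewrite addrAC subrr add0r normrN gtr0_norm.
have Db : D (b, k - r).
  by apply: Dset_toward_diagonal DD => //; lra.
have : gamma1 D b <= k - r.
  by apply: ge_inf; [exists 0 => x []|split => //; lra].
lra.
Qed.

End cutoff_theory.

(** * Kernel bounds *)

Section kernel_bounds.
Variables (R : realType) (m : R).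
Hypothesis m0 : 0 < m.
Implicit Types k : R.

Let leb2 : fine (@lebesgue_measure R `[-1, 1]%classic) = 2.
Proof. by rewrite lebesgue_itv_cc//=; lra. Qed.

Lemma kernelB_ge0 k k' : 0 <= kernelB m k k'.
Proof.
rewrite /kernelB mulr_ge0 ?expR_ge0// Rintegral_ge0// => s _.
by rewrite mulr_ge0 ?expR_ge0// divr_ge0 ?sqrtr_ge0// addr_ge0// sqr_ge0.
Qed.

Lemma integral_cst_lty (c : R) :
  (\int[@lebesgue_measure R]_(s in `[(-1)%R, 1%R]) (fun=> c%:E) s < +oo)%E.
Proof.
rewrite integral_cst//; have h : (-1 : R) <= 1 by lra.
apply: (eq_ind_r (fun z => (c%:E * z < +oo)%E) _ (lebesgue_itv_cc h)).
by rewrite -EFinM ltry.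
Qed.

Lemma expR_diff_le k k' : 0 <= k -> 0 <= k' -> `|expR (- k) - expR (- k')| <= `|k - k'|.
Proof.
wlog kk' : k k' / k <= k' => [H|k0 k'0].
  by have [/H|/ltW/H h k0 k'0] := leP k k' => //; rewrite distrC [leRHS]distrC h.
rewrite ger0_norm ?subr_ge0 ?ler_expR ?lerN2// distrC [leRHS]ger0_norm ?subr_ge0//.
have -> : expR (- k') = expR (- k) * expR (- (k' - k)) by rewrite -expRD; congr expR; ring.
have e1 : expR (- k) <= 1 by rewrite expR_le1 oppr_le0.
have := expR_ge1Dx (- (k' - k)).
have := expR_gt0 (- k); set a := expR (- k) in e1 *; set b := expR (- (k' - k)) => a0 h.
have : b <= 1 by rewrite /b expR_le1 oppr_le0 subr_ge0.
nra.
Qed.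

(* [|exp(-k) - exp(-k')| <= |k - k'| <= w s] absorbs the factor [1 / w s], which
   is singular on the diagonal. *)
Lemma kernelB_diff_le k k' : 0 < k -> 0 < k' ->
  kernelB m k k' * `|expR (- k) - expR (- k')| <= 4 * expR ((k + k') / 2).
Proof.
move=> k0 k'0; have [->|kk'] := eqVneq k k'.
  by rewrite subrr normr0 mulr0 mulr_ge0// expR_ge0.
have dk : 0 < `|k - k'| by rewrite normr_gt0 subr_eq0.
have B : kernelB m k k' <= expR ((k + k') / 2) * (4 / `|k - k'|).
  rewrite /kernelB ler_pM2l ?expR_gt0//.
  apply: (@le_trans _ _ (\int[@lebesgue_measure R]_(s in `[-1, 1]) (2 / `|k - k'|))).
    apply: le_Rintegral_nonmeasurable; [|move=> s|exact: integral_cst_lty].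
      by move=> s _; rewrite divr_ge0.
    rewrite /= in_itv/= => /andP[s1 s2].
    set w := Num.sqrt _.
    have w1 : `|k - k'| <= w.
      rewrite /w -sqrtr_sqr ler_wsqrtr//.
      have kk : 0 < k * k' by rewrite mulr_gt0.
      have ks : 0 <= k * k' * (1 - s) by rewrite mulr_ge0 ?subr_ge0// ltW.
      by lra.
    have w0 : 0 < w by exact: lt_le_trans w1.
    rewrite -[leRHS]mulr1; apply: ler_pM; rewrite ?expR_ge0//.
    - by rewrite divr_ge0 ?sqrtr_ge0// addr_ge0// sqr_ge0.
    - apply: ler_pM => //; rewrite ?invr_ge0 ?sqrtr_ge0 ?addr_ge0 ?sqr_ge0//.
        nra.
      by rewrite lef_pV2.
    - have h1 : 0 <= m * (k - k') ^+ 2 / (2 * w ^+ 2).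
        by rewrite divr_ge0// mulr_ge0 ?sqr_ge0// ltW.
      have h2 : 0 <= w ^+ 2 / (8 * m) by rewrite divr_ge0 ?sqr_ge0// mulr_ge0// ltW.
      by rewrite expR_le1; lra.
  rewrite Rintegral_cst// (_ : fine _ = 2)//.
  by rewrite le_eqVlt; apply/orP; left; apply/eqP; field; rewrite gt_eqF.
have E := expR_diff_le (ltW k0) (ltW k'0).
apply: (@le_trans _ _ (expR ((k + k') / 2) * (4 / `|k - k'|) * `|k - k'|)).
  by apply: ler_pM => //; exact: kernelB_ge0.
by rewrite -mulrA divfK ?gt_eqF// mulrC.
Qed.

(** Off the diagonal [w] lies between [z - y] and [2 * A], so the integrand is bounded below by a
    positive constant [e] on the interval [[-1, 1]] of length 2; the prefactor is at least 1. *)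
Lemma kernelB_lower x y z A : 0 <= x -> x <= y -> y < z -> z <= A ->
  exists2 c, 0 < c & forall k k', x <= k <= y -> z <= k' <= A ->
    c <= kernelB m k k' /\ c <= kernelB m k' k.
Proof.
move=> x0 xy yz zA.
pose W := 2 * A.
have A0 : 0 < A by lra.
have W0 : 0 < W by rewrite /W mulr_gt0.
have d0 : 0 < z - y by lra.
pose e : R := 1 / W * expR (- (m * A ^+ 2 / (2 * (z - y) ^+ 2)) - W ^+ 2 / (8 * m)).
have e0 : 0 < e by rewrite mulr_gt0 ?expR_gt0// divr_gt0.
suff H k k' : 0 <= k <= A -> 0 <= k' <= A -> z - y <= `|k - k'| -> e * 2 <= kernelB m k k'.
  exists (e * 2); first by rewrite mulr_gt0.
  move=> k k' /andP[xk ky] /andP[zk' k'A].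
  by split; apply: H; rewrite ?ler_normr; lra.
move=> /andP[k0 kA] /andP[k'0 k'A] zy.
rewrite /kernelB; apply: (@le_trans _ _ (1 * (e * 2))); first by rewrite mul1r.
apply: ler_pM => //; [by rewrite mulr_ge0// ltW| |].
  by rewrite -expR0 ler_expR divr_ge0// addr_ge0.
have -> : e * 2 = \int[@lebesgue_measure R]_(s in `[-1, 1]) e.
  by rewrite Rintegral_cst// (_ : fine _ = 2).
have wb s : -1 <= s <= 1 ->
    `|k - k'| <= Num.sqrt (k ^+ 2 + k' ^+ 2 - 2 * k * k' * s) <= W.
  move=> /andP[s1 s2].
  have kk : 0 <= k * k' by rewrite mulr_ge0.
  rewrite -sqrtr_sqr ler_wsqrtr ?andTb; last first.
    by have ks : 0 <= k * k' * (1 - s) by [rewrite mulr_ge0 ?subr_ge0]; lra.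
  rewrite -[W]ger0_norm ?(ltW W0)// -sqrtr_sqr ler_wsqrtr//.
  have h1 : k ^+ 2 + k' ^+ 2 - 2 * k * k' * s <= (k + k') ^+ 2.
    by have ks : 0 <= k * k' * (1 + s) by [rewrite mulr_ge0//; lra]; lra.
  apply: (le_trans h1); rewrite /W; nra.
apply: ge0_le_Rintegral_nonmeasurable.
- by move=> s _; exact: ltW.
- move=> s; rewrite /= in_itv/= => /wb; set w := Num.sqrt _ => /andP[w1 w2].
  have w0 : 0 < w by lra.
  apply: ler_pM; [by rewrite divr_ge0// ltW|exact: expR_ge0| |].
    apply: ler_pM => //; first by rewrite invr_ge0 ltW.
      by have := sqr_ge0 s; lra.
    by rewrite lef_pV2.
  rewrite ler_expR; apply: lerB; first rewrite lerN2.
    apply: ler_pM.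
    + by rewrite mulr_ge0 ?sqr_ge0// ltW.
    + by rewrite invr_ge0 mulr_ge0// sqr_ge0.
    + rewrite ler_pM2l// -[leLHS]real_normK ?num_real// ler_sqr ?nnegrE ?(ltW A0)//.
      by rewrite ler_norml; lra.
    + rewrite lef_pV2 ?posrE ?mulr_gt0 ?exprn_gt0//.
      by rewrite ler_pM2l// ler_sqr ?nnegrE ?(ltW d0) ?(ltW w0)//; lra.
  rewrite ler_pM2r ?invr_gt0 ?mulr_gt0//.
  by rewrite ler_sqr ?nnegrE ?(ltW W0) ?(ltW w0).
(* Finiteness is part of the lower bound: an infinite integral would have the real value 0. *)
apply: le_lt_trans (integral_cst_lty (2 / (z - y))).
apply: ge0_le_integral_nonmeasurable => s; rewrite /= in_itv/= => sI; rewrite lee_fin.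
  by rewrite mulr_ge0 ?expR_ge0// divr_ge0 ?sqrtr_ge0// addr_ge0// sqr_ge0.
have /wb := sI; set w := Num.sqrt _ => /andP[w1 w2].
have w0 : 0 < w by lra.
rewrite -[leRHS]mulr1; apply: ler_pM; rewrite ?expR_ge0//.
- by rewrite divr_ge0 ?sqrtr_ge0// addr_ge0// sqr_ge0.
- apply: ler_pM => //; rewrite ?invr_ge0 ?sqrtr_ge0 ?addr_ge0 ?sqr_ge0//.
    by case/andP: sI; nra.
  by rewrite lef_pV2 ?posrE//; lra.
- have h1 : 0 <= m * (k - k') ^+ 2 / (2 * w ^+ 2).
    by rewrite divr_ge0// mulr_ge0 ?sqr_ge0// ltW.
  have h2 : 0 <= w ^+ 2 / (8 * m) by rewrite divr_ge0 ?sqr_ge0// mulr_ge0// ltW.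
  by rewrite expR_le1; lra.
Qed.

End kernel_bounds.

(** * Pairings with test functions on the half-line *)

Section pairing_theory.
Variable R : realType.
Implicit Types (mu nu : fmeasure R) (phi chi : R -> R).

Lemma halflineE (x : R) : halfline x = (0 <= x) :> Prop.
Proof. by rewrite /halfline /= in_itv/= andbT. Qed.

Lemma measurable_halfline : measurable (@halfline R : set (measurableTypeR R)).
Proof. exact: measurable_itv. Qed.
Hint Resolve measurable_halfline : core.

Lemma on_halflineI mu (A : set (measurableTypeR R)) : on_halfline mu -> measurable A ->
  mu A = mu (A `&` @halfline R).
Proof.
move=> m0 mA; rewrite -[in LHS](setIT A).
have -> : setT = `]-oo, 0[%classic `|` @halfline R :> set R.
  by apply/esym; rewrite -subTset => x _; have [x0|x0] := ltP x 0; [left|right]; rewrite ?halflineE//= in_itv.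
rewrite setIUr measureU//.
- rewrite [X in (X + _)%E](_ : _ = 0%E) ?add0e//.
  apply: (@subset_measure0 _ _ _ mu _ `]-oo, 0[%classic) m0 => //.
  exact: measurableI.
- exact: measurableI.
- exact: measurableI.
- rewrite setIACA setIid (_ : `]-oo, 0[%classic `&` _ = set0) ?setI0//.
  by rewrite -subset0 => x [] /=; rewrite halflineE in_itv/= ltNge => /negP.
Qed.

Lemma distf_lt0 mu x : on_halfline mu -> x < 0 -> distf mu x = 0.
Proof.
move=> m0 x0; rewrite /distf (_ : mu _ = 0%E)//.
apply: (@subset_measure0 _ _ _ mu _ `]-oo, 0[%classic) m0 => //.
by move=> y /=; rewrite !in_itv/= => /le_lt_trans; exact.
Qed.

Lemma Rintegral_indic_halfline mu (A : set (measurableTypeR R)) : on_halfline mu -> measurable A ->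
  \int[mu]_(x in @halfline R) (\1_A x : R) = fine (mu A).
Proof. by move=> m0 mA; rewrite /Rintegral integral_indic// (on_halflineI m0 mA). Qed.

Lemma integral_cst_halfline_lty mu (c : R) :
  (\int[mu]_(x in @halfline R) (fun=> c%:E) x < +oo)%E.
Proof.
rewrite integral_cst//.
have E : mu (@halfline R) = (fine (mu (@halfline R)))%:E by rewrite fineK ?mu_fin.
by apply: (eq_ind_r (fun z => (c%:E * z < +oo)%E) _ E); rewrite -EFinM ltry.
Qed.

Lemma pairing_ge_measure mu phi (A : set (measurableTypeR R)) : on_halfline mu -> measurable A ->
  (forall x, 0 <= x -> 0 <= phi x <= 1) -> (forall x, 0 <= x -> A x -> phi x = 1) ->
  fine (mu A) <= pairing mu phi.
Proof.
move=> m0 mA p01 pA; rewrite -Rintegral_indic_halfline//.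
apply: ge0_le_Rintegral_nonmeasurable => [x _|x|].
- by rewrite indicE.
- rewrite halflineE => x0; rewrite indicE; case: (boolP (x \in A)) => [|_].
    by rewrite inE => /pA ->.
  by case/andP: (p01 x x0).
apply: le_lt_trans (integral_cst_halfline_lty mu 1).
apply: ge0_le_integral_nonmeasurable => x; rewrite halflineE lee_fin => /p01 /andP[]//.
Qed.

Lemma pairing_le_measure mu phi (A : set (measurableTypeR R)) : on_halfline mu -> measurable A ->
  (forall x, 0 <= x -> phi x <= 1) -> (forall x, 0 <= x -> ~ A x -> phi x <= 0) ->
  pairing mu phi <= fine (mu A).
Proof.
move=> m0 mA p01 pA; rewrite -Rintegral_indic_halfline//.
apply: le_Rintegral_nonmeasurable => [x _|x|].
- by rewrite indicE.
- rewrite halflineE => x0; rewrite indicE; case: (boolP (x \in A)) => [_|]; first exact: p01.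
  by rewrite notin_setE => /pA; exact.
apply: le_lt_trans (integral_cst_halfline_lty mu 1).
apply: ge0_le_integral_nonmeasurable => x _; rewrite lee_fin indicE//.
by case: (x \in A).
Qed.

Lemma pairing_ge0 mu phi : (forall x, 0 <= x -> 0 <= phi x) -> 0 <= pairing mu phi.
Proof. by move=> p0; apply: Rintegral_ge0 => x; rewrite halflineE; exact: p0. Qed.

Lemma bounded_integrable_halfline mu phi (K : R) :
  {within @halfline R, continuous phi} -> (forall x, 0 <= x -> `|phi x| <= K) ->
  mu.-integrable (@halfline R) (EFin \o phi).
Proof.
move=> cp pK; apply: measurable_bounded_integrable => //.
- by have /fin_numPlt/andP[] := mu_fin mu measurable_halfline.
- exact: subspace_continuous_measurable_fun.
exists K; split; [exact: num_real|move=> M KM x /=].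
by rewrite -[_ (_ <= _)]/(is_true _) halflineE => x0; rewrite (le_trans (pK _ x0))// ltW.
Qed.

Lemma pairing_opp mu phi (K : R) :
  {within @halfline R, continuous phi} -> (forall x, 0 <= x -> `|phi x| <= K) ->
  pairing mu (fun x => - phi x) = - pairing mu phi.
Proof.
move=> cp pK; rewrite /pairing -[RHS]mulN1r -RintegralZl//.
  by apply: eq_Rintegral => x _; rewrite mulN1r.
exact: bounded_integrable_halfline cp pK.
Qed.

Lemma taylor_is_C1b phi (dphi : R -> R) (K M : R) : 0 < K ->
  (forall x y, `|phi y - phi x - dphi x * (y - x)| <= K * (y - x) ^+ 2) ->
  continuous phi -> continuous dphi ->
  (forall x, `|phi x| <= M) -> (forall x, `|dphi x| <= M) -> is_C1b phi dphi.
Proof.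
move=> K0 tay cphi cdphi bphi bdphi; split.
- move=> k k0; apply/cvgrPdist_le => e e0.
  rewrite near_withinE; apply/nbhs_ballP; exists (e / K) => /=; first by rewrite divr_gt0.
  move=> x; rewrite /ball/= => kx [_ /= /eqP xk].
  have dx : x - k != 0 by rewrite subr_eq0.
  have -> : dphi k - (phi x - phi k) / (x - k) =
     - (phi x - phi k - dphi k * (x - k)) / (x - k) by field.
  rewrite normrM normrN normfV ler_pdivrMr ?normr_gt0//.
  apply: (le_trans (tay _ _)); rewrite -[(x - k) ^+ 2]real_normK ?num_real//.
  rewrite expr2 mulrA ler_pM2r ?normr_gt0// mulrC -ler_pdivlMr//.
  by rewrite distrC ltW.
- split; first exact: continuous_subspaceT.
  exists M; split; [exact: num_real|move=> N MN x _; exact: le_trans (bphi x) (ltW MN)].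
- split; first exact: continuous_subspaceT.
  exists M; split; [exact: num_real|move=> N MN x _; exact: le_trans (bdphi x) (ltW MN)].
Qed.

(** One family that contains every test function in space used below: descending ramps, ascending
    ramps and negatives of bumps. *)
Lemma is_C1b_ramp_comb (a b h l r s : R) : 0 < h ->
  is_C1b (fun x => l + r * ramp a h x + s * ramp b h x)
         (fun x => r * dramp a h x + s * dramp b h x).
Proof.
move=> h0.
pose M := `|l| + (`|r| + `|s|) * (1 + 2 / h).
have h2 : 0 <= 2 / h by rewrite divr_ge0// ltW.
have K0 : 0 < 4 / h ^+ 2 * (`|r| + `|s| + 1).
  by rewrite mulr_gt0 ?divr_gt0 ?exprn_gt0// ltr_wpDl// addr_ge0.
apply: (@taylor_is_C1b _ _ (4 / h ^+ 2 * (`|r| + `|s| + 1)) M) => //.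
- move=> x y.
  have -> : l + r * ramp a h y + s * ramp b h y - (l + r * ramp a h x + s * ramp b h x) -
    (r * dramp a h x + s * dramp b h x) * (y - x) =
    r * (ramp a h y - ramp a h x - dramp a h x * (y - x)) +
    s * (ramp b h y - ramp b h x - dramp b h x * (y - x)) by ring.
  apply: (le_trans (ler_normD _ _)); rewrite !normrM.
  have ta := ramp_taylor a h0 x y; have tb := ramp_taylor b h0 x y.
  have k0 : 0 <= 4 / h ^+ 2 * (y - x) ^+ 2.
    by rewrite mulr_ge0 ?sqr_ge0// divr_ge0// sqr_ge0.
  have := ler_wpM2l (normr_ge0 r) ta; have := ler_wpM2l (normr_ge0 s) tb; lra.
- move=> x; apply: cvgD; [apply: cvgD; [exact: cvg_cst|]|]; apply: cvgMr; exact: continuous_ramp.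
- move=> x; apply: cvgD; apply: cvgMr; exact: continuous_dramp.
- move=> x; have /andP[a0 a1] := ramp_itv a h x; have /andP[b0 b1] := ramp_itv b h x.
  apply: (le_trans (ler_normD _ _)).
  have : `|l + r * ramp a h x| <= `|l| + `|r|.
    apply: (le_trans (ler_normD _ _)); rewrite lerD2l normrM (ger0_norm a0).
    by rewrite ler_piMr.
  have : `|s * ramp b h x| <= `|s| by rewrite normrM (ger0_norm b0) ler_piMr.
  have : 0 <= (`|r| + `|s|) * (2 / h) by rewrite mulr_ge0// addr_ge0.
  rewrite /M; lra.
- move=> x; have /andP[a0 a1] := dramp_itv a h0 x; have /andP[b0 b1] := dramp_itv b h0 x.
  apply: (le_trans (ler_normD _ _)); rewrite (normrM r) (normrM s) (ger0_norm a0) (ger0_norm b0).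
  have := ler_wpM2l (normr_ge0 r) a1; have := ler_wpM2l (normr_ge0 s) b1.
  have := normr_ge0 l; have := normr_ge0 r; have := normr_ge0 s; rewrite /M; lra.
Qed.

(** The descending ramp lies between the indicators of []-oo, x]] and []-oo, x + h]], and [distf nu]
    is right-continuous. For [x < 0] both sides are 0, so the pairings are compared only for
    [0 <= x]. *)
Lemma distf_le_of_pairing mu nu x : on_halfline mu -> on_halfline nu ->
  (forall h, 0 < h -> 0 <= x ->
     pairing mu (fun k => 1 - ramp x h k) <= pairing nu (fun k => 1 - ramp x h k)) ->
  distf mu x <= distf nu x.
Proof.
move=> m0 n0 H; have [x0|x0] := ltP x 0; first by rewrite !distf_lt0.
apply/ler_addgt0Pr => e e0; have [h h0 hx] := distf_right nu x e0.
apply: le_trans (ltW hx); apply: (@le_trans _ _ (pairing mu (fun k => 1 - ramp x h k))).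
  apply: pairing_ge_measure => // k _.
    by have := ramp_itv x h k; lra.
  by rewrite /= in_itv/= => kx; rewrite ramp_le// subr0.
apply: (le_trans (H h h0 x0)); apply: pairing_le_measure => // k _.
  by have := ramp_itv x h k; lra.
rewrite /= in_itv/= => /negP; rewrite -ltNge => xk.
by rewrite ramp_ge// ?subrr// ltW.
Qed.

Lemma eq_distf_mass mu nu : (forall x, distf mu x = distf nu x) -> mass mu = mass nu.
Proof.
move=> H; wlog suff : mu nu H / mass mu <= mass nu.
  by move=> S; apply/eqP; rewrite eq_le !S.
apply/ler_addgt0Pr => e e0; have [L _] := distf_near_mass mu e0.
by have := distf_le_mass nu L; rewrite H; lra.
Qed.

End pairing_theory.

(** * Bounds on the right-hand side of the weak equation *)

Section straddle.
Variables (R : realType) (theta delta : R).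
Hypotheses (theta01 : 0 < theta < 1) (delta0 : 0 < delta).
Notation D := (Dset theta delta).

(** Take [k <= k']. Over [k] in [[p, q]] the sections of [D] are uniformly bounded. If [k < p], then
    [p] lies between [k] and [k'], so [(p, k)] is in [D], which keeps [k] above [c1]; the sections
    over [[c1, p]] then bound [k']. *)
Lemma Dset_straddle p q : 0 < p -> p <= q -> exists c A, 0 < c /\
  forall k k', 0 < k -> 0 < k' -> D (k, k') -> ~~ ((k <= p) && (k' <= p)) ->
    ~~ ((q <= k) && (q <= k')) -> c <= k <= A /\ c <= k' <= A.
Proof.
move=> p0 pq.
have [c1 [A1 [c10 c1p qA1 H1]]] := @Dset_bounded R theta delta theta01 delta0 p q p0.
have [c2 [A2 [c20 c2c1 pA2 H2]]] := @Dset_bounded R theta delta theta01 delta0 c1 p c10.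
exists c2, (Num.max A1 A2); split => //.
have mA x : x <= A1 \/ x <= A2 -> x <= Num.max A1 A2 by rewrite le_max => -[] ->; rewrite ?orbT.
move=> k k' k0 k'0; wlog kk' : k k' k0 k'0 / k <= k'.
  move=> H DD h1 h2; have [|/ltW] := leP k k'; first by move=> h; exact: H.
  move=> h; have [] := H k' k k'0 k0 h (Dset_sym theta01 DD) => //.
  - by rewrite andbC.
  - by rewrite andbC.
move=> DD; rewrite !negb_and -!ltNge => h1 h2.
have pk' : p < k' by case/orP: h1; lra.
have kq : k < q by case/orP: h2; lra.
have [pk|kp] := leP p k.
  have kpq : p <= k <= q by rewrite pk ltW.
  have /andP[? k'A] := H1 _ _ kpq DD.
  by split; rewrite mA ?andbT; [lra|left; lra|lra|left].
have Dp : D (p, k) by apply: Dset_toward_diagonal DD => //; exact: ltW.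
have pp : p <= p <= q by rewrite lexx.
have /andP[c1k _] := H1 _ _ pp Dp.
have kc : c1 <= k <= p by rewrite c1k ltW.
have /andP[? ?] := H2 _ _ kc DD.
by split; rewrite mA ?andbT; [lra|right; lra|lra|right].
Qed.

End straddle.

Section weak_rhs_bounds.
Variables (R : realType) (m theta delta : R) (Phi : R * R -> R).
Hypotheses (m0 : 0 < m) (theta01 : 0 < theta < 1) (delta0 : 0 < delta).
Hypothesis Phi_cutoff : is_cutoff theta delta Phi.
Notation wi := (weak_integrand m Phi).
Implicit Types (mu : fmeasure R) (phi chi : R -> R).

Lemma weak_integrand_abs phi k k' : 0 <= k -> 0 <= k' -> k * k' != 0 ->
  `|wi phi (k, k')| = Phi (k, k') * kernelB m k k' / (k * k') *
     `|expR (- k) - expR (- k')| * `|phi k - phi k'|.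
Proof.
move=> k0 k'0 kk'; have /andP[P0 _] := cutoff_ge0 Phi_cutoff k0 k'0.
rewrite /weak_integrand /= (negbTE kk') normrM normrM; congr (_ * _ * _).
rewrite ger0_norm//; apply: divr_ge0; last exact: mulr_ge0.
by apply: mulr_ge0 => //; exact: kernelB_ge0.
Qed.

(** Where [phi k] and [phi k'] differ and [Phi] does not vanish, both variables lie in some
    [[c, A]]; there [kernelB_diff_le] gives [4 * expR A] and [k * k' >= c * c]. [C] depends only on
    [p] and [q], not on [phi]. *)
Lemma weak_integrand_bound p q : 0 < p -> p <= q -> exists2 C, 0 <= C &
  forall phi, (forall x y, x <= p -> y <= p -> phi x = phi y) ->
    (forall x y, q <= x -> q <= y -> phi x = phi y) ->
  forall k k', 0 <= k -> 0 <= k' -> `|wi phi (k, k')| <= C * `|phi k - phi k'|.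
Proof.
move=> p0 pq; have [c [A [c0 H]]] := Dset_straddle theta01 delta0 p0 pq.
exists (4 * expR A / (c * c)).
  by rewrite divr_ge0 ?mulr_ge0 ?expR_ge0// ltW.
move=> phi phip phiq k k' k0 k'0.
have C0 : 0 <= 4 * expR A / (c * c) by rewrite divr_ge0 ?mulr_ge0 ?expR_ge0// ltW.
have [kk'|kk'] := eqVneq (k * k') 0.
  by rewrite /weak_integrand /= kk' eqxx normr0 mulr_ge0.
rewrite weak_integrand_abs//.
have [->|pp] := eqVneq (phi k) (phi k'); first by rewrite subrr normr0 !mulr0.
apply: ler_wpM2r => //.
have [->|P0] := eqVneq (Phi (k, k')) 0; first by rewrite !mul0r.
have kgt0 : 0 < k by rewrite lt_neqAle k0 andbT eq_sym; apply: contra_neq kk' => ->; rewrite mul0r.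
have k'gt0 : 0 < k' by rewrite lt_neqAle k'0 andbT eq_sym; apply: contra_neq kk' => ->; rewrite mulr0.
have [||/andP[ck kA] /andP[ck' k'A]] := H k k' kgt0 k'gt0 (cutoff_neq0 Phi_cutoff k0 k'0 P0).
- by apply/negP => /andP[? ?]; move/eqP: pp; apply; exact: phip.
- by apply/negP => /andP[? ?]; move/eqP: pp; apply; exact: phiq.
rewrite mulrAC ler_pdivrMr ?mulr_gt0//.
have /andP[P00 P1] := cutoff_ge0 Phi_cutoff k0 k'0.
have B := @kernelB_diff_le R m m0 k k' kgt0 k'gt0.
set b := kernelB _ _ _ * _ in B.
have b0 : 0 <= b by apply: mulr_ge0 => //; exact: kernelB_ge0.
apply: (@le_trans _ _ (4 * expR A)).
  rewrite -mulrA -/b; apply: (@le_trans _ _ b); first by rewrite ler_piMl.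
  apply: (le_trans B); rewrite ler_pM2l// ler_expR; lra.
rewrite -[leRHS]mulrA [(c * c)^-1 * _]mulrC; apply: ler_peMr.
  by rewrite mulr_ge0 ?expR_ge0.
rewrite ler_pdivlMr ?mulr_gt0// mul1r.
by apply: ler_pM => //; exact: ltW.
Qed.

Lemma weak_integrand_ge0 phi k k' : 0 <= k -> 0 <= k' ->
  (forall x y, 0 <= x -> x <= y -> phi y <= phi x) -> 0 <= wi phi (k, k').
Proof.
move=> k0 k'0 nphi; rewrite /weak_integrand /=; case: ifPn => // _.
rewrite -mulrA; apply: mulr_ge0.
  apply: divr_ge0; last exact: mulr_ge0.
  by apply: mulr_ge0; [case/andP: (cutoff_ge0 Phi_cutoff k0 k'0)|exact: kernelB_ge0].
have [kk'|/ltW kk'] := leP k k'.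
  by rewrite mulr_ge0// subr_ge0 ?ler_expR ?lerN2// nphi.
by rewrite mulr_le0// subr_le0 ?ler_expR ?lerN2// nphi.
Qed.

Lemma weak_rhs_ge0 phi mu :
  (forall x y, 0 <= x -> x <= y -> phi y <= phi x) -> 0 <= weak_rhs m Phi phi mu.
Proof.
move=> nphi; rewrite /weak_rhs mulr_ge0// ?invr_ge0//; apply: Rintegral_ge0.
by move=> [k k'] [/= ]; rewrite !halflineE => k0 k'0; exact: weak_integrand_ge0.
Qed.

Lemma integral_affine mu (h : R -> R) (a b : R) : 0 <= a -> 0 <= b ->
  measurable_fun setT h -> (forall x, 0 <= h x <= 1) ->
  (\int[mu]_x (a + b * h x)%:E)%E = (a * mass mu + b * \int[mu]_x h x)%:E.
Proof.
move=> a0 b0 mh h01.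
have h0 x : 0 <= h x by case/andP: (h01 x).
have mhE : measurable_fun setT (EFin \o h) by exact/measurable_EFinP.
have If : (\int[mu]_x (h x)%:E)%E = (\int[mu]_x h x)%:E.
  rewrite /Rintegral fineK// ge0_fin_numE; last by apply: integral_ge0 => x _; rewrite lee_fin.
  apply: (@le_lt_trans _ _ (\int[mu]_x (cst 1%:E x))%E).
    apply: ge0_le_integral_nonmeasurable => x _; rewrite lee_fin//.
    by case/andP: (h01 x).
  rewrite integral_cst//.
  by apply: (eq_ind_r (fun z => (1%:E * z < +oo)%E) _ (massE mu)); rewrite -EFinM ltry.
under eq_integral do rewrite EFinD EFinM.
rewrite ge0_integralD//; last first.
- exact/measurable_funeM.
- by move=> x _; rewrite mule_ge0// lee_fin.
rewrite ge0_integralZl_EFin//; last by move=> x _; rewrite lee_fin.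
rewrite If integral_cst//.
rewrite [X in (a%:E * X)%E](_ : _ = (mass mu)%:E); last exact: massE.
by rewrite -!EFinM -EFinD.
Qed.

(** By Tonelli [chi k + chi k'] integrates to at most [2 * mass mu * pairing mu chi], and the 2
    cancels the factor [2^-1] of [weak_rhs]. With [chi] a bump this feeds the Gronwall argument;
    with [chi] the indicator of an empty gap it makes the right-hand side nonnegative. *)
Lemma weak_rhs_lower phi chi C mu : 0 <= C -> measurable_fun setT chi ->
  (forall x, 0 <= chi x <= 1) ->
  (forall k k', 0 <= k -> 0 <= k' -> - (C * (chi k + chi k')) <= wi phi (k, k')) ->
  - (C * mass mu * pairing mu chi) <= weak_rhs m Phi phi mu.
Proof.
move=> C0 mchi chi01 wichi.
have chi0 x : 0 <= chi x by case/andP: (chi01 x).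
(* Extension by 0 off the half-line turns the integral over the quadrant into one over the plane. *)
pose h : R -> R := chi \_ (@halfline R).
have mh : measurable_fun setT h.
  exact: ((measurable_restrictT chi (@measurable_halfline R)).1 (measurable_funTS mchi)).
have h01 x : 0 <= h x <= 1.
  by rewrite /h patchE; case: ifPn => // _; rewrite lexx ler01.
have h0 x : 0 <= h x by case/andP: (h01 x).
have hI : \int[mu]_x h x = pairing mu chi by rewrite /pairing [RHS]Rintegral_mkcond.
have I0 : 0 <= pairing mu chi by apply: pairing_ge0.
pose H2 := @halfline R `*` @halfline R.
pose g p : R := C * (chi p.1 + chi p.2).
have key : (\int[(mu \x mu)%E]_(p in H2) (g p)%:E <= (2 * (C * mass mu * pairing mu chi))%:E)%E.
  pose G (p : measurableTypeR R * measurableTypeR R) : \bar R := (C * h p.1 + C * h p.2)%:E.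
  have mh' : measurable_fun (setT : set (measurableTypeR R)) (fun x => C * h x).
    by apply: measurable_funM.
  have mG : measurable_fun setT G.
    apply/measurable_EFinP; apply: measurable_funD.
      by apply: (measurableT_comp mh'); exact: measurable_fst.
    by apply: (measurableT_comp mh'); exact: measurable_snd.
  have G0 p : (0 <= G p)%E by rewrite lee_fin addr_ge0// mulr_ge0.
  apply: (@le_trans _ _ (\int[(mu \x mu)%E]_p G p)%E).
    rewrite integral_mkcond; apply: ge0_le_integral_nonmeasurable => -[k k'] _.
      by apply: erestrict_ge0 => p _; rewrite lee_fin mulr_ge0// addr_ge0.
    rewrite patchE; case: ifPn => // /set_mem [/= Hk Hk'].
    by rewrite /G /g /h !patchE !mem_set//= mulrDr.
  rewrite fubini_tonelli1//.
  have inner x : fubini_F mu G x = (C * pairing mu chi + C * mass mu * h x)%:E.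
    rewrite /fubini_F /G /= integral_affine ?mulr_ge0// hI; congr EFin; ring.
  under eq_integral do rewrite inner.
  rewrite integral_affine ?mulr_ge0 ?mass_ge0// hI lee_fin.
  by rewrite le_eqVlt; apply/orP; left; apply/eqP; ring.
have g0 p : 0 <= g p by rewrite mulr_ge0// addr_ge0.
have := @ge_Rintegral_nonmeasurable _ _ _ (mu \x mu)%E H2 (weak_integrand m Phi phi) g.
move=> /(_ _ _ _) B.
have {}B : - (\int[(mu \x mu)%E]_(p in H2) g p) <= \int[(mu \x mu)%E]_(p in H2) weak_integrand m Phi phi p.
  apply: B => [p _|[k k'] [/=]|]; first exact: g0.
    by rewrite !halflineE; exact: wichi.
  by apply: le_lt_trans key _; rewrite ltry.
have gI : \int[(mu \x mu)%E]_(p in H2) g p <= 2 * (C * mass mu * pairing mu chi).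
  rewrite -lee_fin; apply: (le_trans _ key); rewrite /Rintegral fineK// ge0_fin_numE.
    by apply: le_lt_trans key _; rewrite ltry.
  by apply: integral_ge0 => p _; rewrite lee_fin.
rewrite /weak_rhs -/H2.
apply: (@le_trans _ _ (2^-1 * - (\int[(mu \x mu)%E]_(p in H2) g p))).
  by rewrite mulrN lerN2 ler_pdivrMl.
by rewrite ler_pM2l ?invr_gt0.
Qed.

(* The bound [K] matters: the real-valued integral of a nonnegative function
   with infinite integral is the junk value 0. *)
Lemma weak_rhs_product phi mu (A B : set (measurableTypeR R)) c K :
  0 <= c -> measurable A -> measurable B -> A `<=` @halfline R -> B `<=` @halfline R ->
  (forall k k', 0 <= k -> 0 <= k' -> 0 <= wi phi (k, k') <= K) ->
  (forall k k', A k -> B k' -> c <= wi phi (k, k')) ->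
  c * fine (mu A) * fine (mu B) / 2 <= weak_rhs m Phi phi mu.
Proof.
move=> c0 mA mB AH BH wiK wic.
rewrite /weak_rhs mulrC ler_pM2l ?invr_gt0//.
pose f (p : measurableTypeR R * measurableTypeR R) : R := c * \1_(A `*` B) p.
have mH : measurable (@halfline R `*` @halfline R : set (measurableTypeR R * measurableTypeR R)).
  by apply: measurableX; exact: measurable_halfline.
have mAB : measurable (A `*` B) by exact: measurableX.
have E : (\int[(mu \x mu)%E]_(p in @halfline R `*` @halfline R) (f p)%:E)%E =
    (c * fine (mu A) * fine (mu B))%:E.
  rewrite /f; under eq_integral do rewrite EFinM.
  rewrite ge0_integralZl_EFin//; last first.
    by apply/measurable_EFinP; apply: measurable_funTS.
  rewrite integral_indic// setIidl; last by move=> [x y] [/= /AH ? /BH].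
  rewrite [X in (_ * X)%E](_ : _ = (mu A * mu B)%E); last exact: product_measure1E.
  by rewrite !EFinM !fineK ?mu_fin// muleA.
have -> : c * fine (mu A) * fine (mu B) =
    \int[(mu \x mu)%E]_(p in @halfline R `*` @halfline R) f p by rewrite /Rintegral E.
apply: ge0_le_Rintegral_nonmeasurable => [[k k'] _|[k k'] [/=]|].
- by rewrite /f mulr_ge0.
- rewrite !halflineE => k0 k'0; rewrite /f indicE.
  case: (boolP (_ \in _)) => [|_]; last by rewrite mulr0; case/andP: (wiK k k' k0 k'0).
  by rewrite inE /= => -[Ak Bk']; rewrite mulr1 wic.
pose KK := Num.max 0 K.
apply: (@le_lt_trans _ _ (\int[(mu \x mu)%E]_(p in @halfline R `*` @halfline R) (cst KK%:E p))%E).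
  apply: ge0_le_integral_nonmeasurable => -[k k'] [/=]; rewrite !halflineE => k0 k'0;
    case/andP: (wiK k k' k0 k'0) => // w0 wK; rewrite lee_fin//.
  by rewrite /KK le_max wK orbT.
rewrite integral_cst//.
have E2 : ((mu \x mu) (@halfline R `*` @halfline R))%E = (mu (@halfline R) * mu (@halfline R))%E.
  by apply: product_measure1E; exact: measurable_halfline.
apply: (eq_ind_r (fun z => (KK%:E * z < +oo)%E) _ E2).
have -> : mu (@halfline R) = (fine (mu (@halfline R)))%:E.
  by rewrite fineK// mu_fin//; exact: measurable_halfline.
by rewrite -!EFinM ltry.
Qed.

End weak_rhs_bounds.

(** * Evolution of the distribution functions *)

(* On a time interval of length [(2 * L)^-1] starting at a zero of [F], each use
   of the growth hypothesis halves the available upper bound on [F]. *)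
Lemma gronwall_halving (R : realType) (F : R -> R) (L M : R) : 0 < L ->
  (forall t, 0 <= t -> 0 <= F t <= M) -> F 0 = 0 ->
  (forall s t B, 0 <= s -> s <= t -> 0 <= B -> (forall x, s < x < t -> F x <= B) ->
     F t - F s <= L * B * (t - s)) ->
  forall t, 0 <= t -> F t = 0.
Proof.
move=> L0 FM F0 H.
pose tau := (2 * L)^-1.
have tau0 : 0 < tau by rewrite invr_gt0 mulr_gt0.
have M0 : 0 <= M by have := FM 0 (lexx _); lra.
have step s : 0 <= s -> F s = 0 -> forall t, s <= t <= s + tau -> F t = 0.
  move=> s0 Fs.
  have half n : forall t, s <= t <= s + tau -> F t <= M / 2 ^+ n.
    elim: n => [|n IH] t /andP[st ts].
      by rewrite expr0 divr1; have /andP[] := FM t (le_trans s0 st).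
    have B0 : 0 <= M / 2 ^+ n by rewrite divr_ge0// exprn_ge0.
    have := H s t _ s0 st B0 _; rewrite Fs subr0 => /(_ _)/le_trans; apply.
      by move=> x /andP[sx xt]; apply: IH; rewrite !ltW//= (lt_le_trans xt).
    apply: (@le_trans _ _ (L * (M / 2 ^+ n) * tau)).
      by rewrite ler_wpM2l ?mulr_ge0 ?(ltW L0)//; lra.
    rewrite /tau exprS le_eqVlt; apply/orP; left; apply/eqP; field.
    by rewrite !gt_eqF ?exprn_gt0.
  move=> t st; apply/eqP; rewrite eq_le; apply/andP; split; last first.
    by case/andP: st => st _; case/andP: (FM t (le_trans s0 st)).
  apply/ler_addgt0Pr => e e0; rewrite add0r.
  have Me : 0 <= M / e by rewrite divr_ge0// ltW.
  have := archi_boundP Me; set n := Num.bound _ => Mn.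
  apply: (le_trans (half n t st)); rewrite ler_pdivrMr ?exprn_gt0// mulrC -ler_pdivrMr//.
  apply: (le_trans (ltW Mn)); rewrite -natrX ler_nat ltnW//.
  exact: ltn_expl.
have all n : forall t, 0 <= t <= n%:R * tau -> F t = 0.
  elim: n => [|n IH] t /andP[t0]; first by rewrite mul0r => t0'; rewrite (_ : t = 0)//; lra.
  rewrite -natr1 mulrDl mul1r => tn.
  have ntau : 0 <= n%:R * tau by rewrite mulr_ge0// ltW.
  have [tn'|/ltW tn'] := leP t (n%:R * tau); first by apply: IH; rewrite t0.
  apply: (step (n%:R * tau)) => //; last by rewrite tn'.
  by apply: IH; rewrite ntau/=.
move=> t t0; have tt : 0 <= t / tau by rewrite divr_ge0// ltW.
by apply: (all (Num.bound (t / tau))); rewrite t0 -ler_pdivrMr// ltW// archi_boundP.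
Qed.

Section dynamics.
Variables (R : realType) (m theta delta : R) (Phi : R * R -> R).
Hypotheses (m0 : 0 < m) (theta01 : 0 < theta < 1) (delta0 : 0 < delta).
Hypothesis Phi_cutoff : is_cutoff theta delta Phi.
Variables (v0 : fmeasure R) (v : R -> fmeasure R).
Hypothesis v0_half : on_halfline v0.
Hypothesis v_half : forall t, 0 <= t -> on_halfline (v t).
Hypothesis v_sol : weak_solution m Phi v0 v.
Notation leb := (@lebesgue_measure R).
Notation D := (Dset theta delta).

Lemma pairing_growth phi dphi c s t : is_C1b phi dphi -> dphi 0 = 0 -> 0 <= s -> s <= t ->
  (forall x, s < x < t -> c <= weak_rhs m Phi phi (v x)) ->
  c * (t - s) <= pairing (v t) phi - pairing (v s) phi.
Proof.
move=> C1 d0 s0 st H.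
have [g [W gE]] := weak_eq v_sol C1 d0.
have [_ Cb _] := C1; have [cp _] := weak_cont v_sol Cb.
apply: (@weak_derivative_ge R (fun t => pairing (v t) phi) g c s t cp W s0 st).
move: gE; apply: (@filterS _ _ (ae_lebesgue_filter R)) => x gx sxt.
by rewrite gx; [exact: H|case/andP: sxt => sx _; exact: le_lt_trans sx].
Qed.

Lemma C1b_desc (a h : R) : 0 < h -> is_C1b (fun k => 1 - ramp a h k) (fun k => - dramp a h k).
Proof.
move=> h0; have := is_C1b_ramp_comb a a 1 (-1) 0 h0.
congr is_C1b; apply/funext => x; ring.
Qed.

Lemma dist_v_initial x : distf (v 0) x = distf v0 x.
Proof.
apply/eqP; rewrite eq_le; apply/andP; split; apply: distf_le_of_pairing => //; try exact: v_half.
  all: move=> h h0 x0; have [_ Cb _] := C1b_desc x h0.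
  all: by have [_ ->] := weak_cont v_sol Cb.
Qed.

Lemma dist_v_nd s t x : 0 <= s -> s <= t -> distf (v s) x <= distf (v t) x.
Proof.
move=> s0 st; apply: distf_le_of_pairing; try by apply: v_half; lra.
move=> h h0 x0; rewrite -subr_ge0 -[leLHS](mul0r (t - s)).
apply: (pairing_growth (C1b_desc x h0)) => //; first by rewrite dramp_le ?oppr0.
move=> y _; apply: (weak_rhs_ge0 _ Phi_cutoff) => // k k' k0 kk'.
by rewrite lerD2l lerN2 ramp_nd.
Qed.

Lemma dist_v_ge t x : 0 <= t -> distf v0 x <= distf (v t) x.
Proof. by move=> t0; rewrite -dist_v_initial dist_v_nd. Qed.

Hypothesis v_mass : forall t, 0 < t -> M0 (v t) = M0 v0.

Lemma mass_v t : 0 <= t -> mass (v t) = mass v0.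
Proof.
have M0E (mu : fmeasure R) : on_halfline mu -> M0 mu = mu setT.
  by move=> mu0; rewrite /M0 (on_halflineI mu0 measurableT) setTI.
rewrite le_eqVlt => /predU1P[<-|t0]; first exact: (eq_distf_mass dist_v_initial).
by rewrite /mass -!M0E ?v_mass//; apply: v_half; exact: ltW.
Qed.

(** Since [|bump k - bump k'| <= bump k + bump k'], the growth rate of the pairing is at most
    [C * mass v0] times the pairing itself, and Gronwall applies. The equation is tested against
    [- bump] because [pairing_growth] yields lower bounds; [h < p] keeps the bump away from 0. *)
Lemma pairing_bump_zero (p q h : R) (bump := fun k : R => ramp (p - h) h k - ramp q h k) :
  0 < h -> h < p -> p <= q -> pairing v0 bump = 0 -> forall t, 0 <= t -> pairing (v t) bump = 0.
Proof.
move=> h0 hp pq b0.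
pose phi (k : R) := 0 + (-1) * ramp (p - h) h k + 1 * ramp q h k.
have C1 := is_C1b_ramp_comb (p - h) q 0 (-1) 1 h0.
have d0 : -1 * dramp (p - h) h 0 + 1 * dramp q h 0 = 0.
  by rewrite !dramp_le ?mulr0 ?addr0//; lra.
have phiE k : phi k = - bump k by rewrite /phi /bump; ring.
have bump01 k : 0 <= bump k <= 1.
  rewrite /bump; have := ramp_itv (p - h) h k; have := ramp_itv q h k.
  have : ramp q h k <= ramp (p - h) h k.
    have [kq|kq] := leP k q.
      by rewrite (@ramp_le _ q)//; case/andP: (ramp_itv (p - h) h k).
    by rewrite (@ramp_ge _ (p - h))//; [case/andP: (ramp_itv q h k)|lra].
  lra.
have cb : continuous bump by move=> x; apply: cvgB; exact: continuous_ramp.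
have pphi mu : pairing mu phi = - pairing mu bump.
  rewrite -(@pairing_opp _ _ _ 1); last first.
  - by move=> x _; have := bump01 x; rewrite ler_norml; lra.
  - exact: continuous_subspaceT.
  - by congr pairing; apply/funext => x; exact: phiE.
have ph0 : 0 < p - h by lra.
have phq : p - h <= q + h by lra.
have [C C0 HC] := weak_integrand_bound m0 theta01 delta0 Phi_cutoff ph0 phq.
have wib k k' : 0 <= k -> 0 <= k' -> - (C * (bump k + bump k')) <= weak_integrand m Phi phi (k, k').
  move=> k0 k'0; have := HC phi _ _ k k' k0 k'0.
  move=> /(_ _ _)/le_trans/(_ _) B.
  have : `|weak_integrand m Phi phi (k, k')| <= C * (bump k + bump k').
    apply: B => [x y xp yp|x y xq yq|].
    - by rewrite /phi !ramp_le//; lra.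
    - by rewrite /phi !ramp_ge//; lra.
    rewrite ler_wpM2l// !phiE opprK addrC.
    have := bump01 k; have := bump01 k'; rewrite ler_norml; lra.
  by rewrite ler_norml => /andP[].
(* The added 1 keeps [L] positive when [C] or the mass is 0. *)
pose L := C * mass v0 + 1.
have L0 : 0 < L by rewrite ltr_wpDl// mulr_ge0// mass_ge0.
have mb : measurable_fun setT bump by exact: continuous_measurable_fun.
apply: (@gronwall_halving _ (fun t => pairing (v t) bump) L (mass v0)) => //.
- move=> t t0; apply/andP; split.
    by apply: pairing_ge0 => x _; case/andP: (bump01 x).
  rewrite -(mass_v t0); apply: pairing_le_measure => //; first exact: v_half.
    by move=> x _; case/andP: (bump01 x).
  by move=> x _ /(_ Logic.I).
- rewrite -[RHS]b0.
  have [_ Cb _] := C1; have [_] := weak_cont v_sol Cb.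
  by rewrite -/phi !pphi => /oppr_inj.
move=> s t B s0 st B0 FB.
have := @pairing_growth phi _ (- (L * B)) s t C1 d0 s0 st.
rewrite !pphi => /(_ _); rewrite mulNr => G.
suff : - (L * B * (t - s)) <= - pairing (v t) bump - - pairing (v s) bump by lra.
apply: G => x /andP[sx xt]; have x0 : 0 <= x by lra.
apply: (le_trans _ (weak_rhs_lower (v x) C0 mb bump01 wib)).
rewrite lerN2 mass_v//; apply: ler_pM.
- by rewrite mulr_ge0// mass_ge0.
- by apply: pairing_ge0 => y _; case/andP: (bump01 y).
- by rewrite /L; lra.
- by apply: FB; rewrite sx.
Qed.

(** It is enough that no point of the gap supports [v t]. Around each point there is a bump
    supported in the gap; its pairing is 0 at the start and remains 0. *)
Lemma null_interval a b t : 0 <= a -> v0 `]a, b[%classic = 0%E -> 0 <= t ->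
  v t `]a, b[%classic = 0%E.
Proof.
move=> a0 v0ab t0; apply: mu_disj_msupp => [|x]; first exact: measurable_itv.
rewrite /= in_itv/= => /andP[ax xb] xs.
(* A quarter of the distance to the ends leaves room for the half-width and the ramp of the bump,
   which lives on [[x - 2e, x + 2e]]. *)
pose e := Num.min (x - a) (b - x) / 4.
have e0 : 0 < e by rewrite divr_gt0// lt_min !subr_gt0 ax.
have [e1 e2] : e <= (x - a) / 4 /\ e <= (b - x) / 4.
  by split; rewrite ler_pM2r// ge_min lexx ?orbT.
pose bump := fun k : R => ramp (x - e - e) e k - ramp (x + e) e k.
have bump1 k : bump k <= 1.
  by rewrite /bump; have := ramp_itv (x - e - e) e k; have := ramp_itv (x + e) e k; lra.
have bump0 k : 0 <= bump k.
  rewrite /bump; have [kq|kq] := leP k (x + e).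
    by rewrite (@ramp_le _ (x + e))// subr0; case/andP: (ramp_itv (x - e - e) e k).
  by rewrite (@ramp_ge _ (x - e - e))//; [case/andP: (ramp_itv (x + e) e k); lra|lra].
have B0 : pairing v0 bump = 0.
  apply/eqP; rewrite eq_le; apply/andP; split; last by apply: pairing_ge0.
  have <- : fine (v0 `]a, b[%classic) = 0 by rewrite v0ab.
  apply: pairing_le_measure => // y y0; rewrite /= in_itv/= => /negP.
  rewrite negb_and -!leNgt => /orP[ya|yb]; rewrite /bump.
    by rewrite !ramp_le ?subrr//; lra.
  by rewrite !ramp_ge ?subrr//; lra.
have ex : e < x - e by lra.
have xx : x - e <= x + e by lra.
have := pairing_bump_zero e0 ex xx B0 t0 => BT.
have : (0 < v t `](x - e)%R, (x + e)%R[%classic)%E by apply: (msupp_itv xs); lra.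
rewrite -(@fineK _ (v t _)) ?mu_fin ?measurable_itv// lte_fin ltNge => /negP; apply.
rewrite -BT; apply: pairing_ge_measure => //; first exact: v_half.
  by move=> y _; rewrite bump0 bump1.
move=> y _; rewrite /= in_itv/= => /andP[y1 y2].
by rewrite /bump (@ramp_ge _ (x - e - e)) ?(@ramp_le _ (x + e)) ?subr0//; lra.
Qed.

Lemma dist_null (mu : fmeasure R) a b x y : mu `]a, b[%classic = 0%E -> a <= x -> x <= y -> y < b ->
  distf mu x = distf mu y.
Proof.
move=> m0' ax xy yb; have := mu_itv_oc mu xy.
rewrite (_ : mu _ = 0%E); first by move=> [] /esym/eqP; rewrite subr_eq0 => /eqP.
apply: (@subset_measure0 _ _ _ mu _ `]a, b[%classic) m0' => //; try exact: measurable_itv.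
move=> z /=; rewrite !in_itv/= => /andP[xz zy].
by rewrite (le_lt_trans ax xz) (le_lt_trans zy yb).
Qed.

(** Test with a ramp that rises inside the gap. For two points on the same side the ramp takes one
    value; for points on opposite sides the integrand vanishes; the remaining pairs meet the gap,
    which carries no mass. So the mass to the right of the gap cannot decrease, while monotonicity
    says that it cannot increase. *)
Lemma gap_conserved a b t x : 0 <= a -> v0 `]a, b[%classic = 0%E ->
  (forall k k', 0 <= k <= a -> b <= k' -> k * k' != 0 -> Phi (k, k') = 0) ->
  0 <= t -> a <= x < b -> distf (v t) x = distf v0 x.
Proof.
move=> a0 v0ab dec t0; wlog : x / a < x.
  (* The ramp must start at a positive point, so [x = a] is moved into the gap, where all the
     distribution functions are constant. *)
  move=> H /andP[ax xb]; have axb : a < (x + b) / 2 < b by lra.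
  have [x1 x2] : x <= (x + b) / 2 /\ (x + b) / 2 < b by split; lra.
  rewrite (dist_null (null_interval a0 v0ab t0) ax x1 x2) (dist_null v0ab ax x1 x2).
  by apply: H; lra.
move=> ax /andP[_ xb].
have null s : 0 <= s -> v s `]a, b[%classic = 0%E by move=> s0; exact: null_interval.
apply/eqP; rewrite eq_le dist_v_ge// andbT.
pose h := (b - x) / 2; have h0 : 0 < h by rewrite divr_gt0// subr_gt0.
pose phi (k : R) := 0 + 1 * ramp x h k + 0 * ramp x h k.
have phiE : phi = ramp x h by apply/funext => k; rewrite /phi; ring.
have C1 := is_C1b_ramp_comb x x 0 1 0 h0; rewrite -/phi phiE in C1.
have d0 : 1 * dramp x h 0 + 0 * dramp x h 0 = 0.
  by rewrite dramp_le ?mulr0 ?addr0//; lra.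
have x0 : 0 < x by lra.
have xh : x <= x + h by lra.
have [C C0 HC] := weak_integrand_bound m0 theta01 delta0 Phi_cutoff x0 xh.
pose chi : R -> R := \1_(`]a, b[%classic : set R).
have chi01 y : 0 <= chi y <= 1 by rewrite /chi indicE; case: (_ \in _); rewrite ?lexx ?ler01.
have mchi : measurable_fun setT chi by apply: measurable_indic; exact: measurable_itv.
have wib k k' : 0 <= k -> 0 <= k' -> - (C * (chi k + chi k')) <= weak_integrand m Phi (ramp x h) (k, k').
  move=> k0 k'0.
  suff : `|weak_integrand m Phi (ramp x h) (k, k')| <= C * (chi k + chi k').
    by rewrite ler_norml => /andP[].
  have hb : `|weak_integrand m Phi (ramp x h) (k, k')| <= C * `|ramp x h k - ramp x h k'|.
    by apply: HC => // y z yp zp; [rewrite !ramp_le|rewrite !ramp_ge].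
  have r1 : `|ramp x h k - ramp x h k'| <= 1.
    by have := ramp_itv x h k; have := ramp_itv x h k'; rewrite ler_norml; lra.
  have [kab|kab] := boolP (a < k < b).
    apply: (le_trans hb); rewrite ler_wpM2l// (le_trans r1)//.
    rewrite /chi !indicE mem_set/= ?in_itv//=; by rewrite mulr1n lerDl; case: (_ \in _).
  have [k'ab|k'ab] := boolP (a < k' < b).
    apply: (le_trans hb); rewrite ler_wpM2l// (le_trans r1)//.
    rewrite /chi !indicE (@mem_set _ _ k')/= ?in_itv//=; by rewrite mulr1n lerDr; case: (_ \in _).
  have chi0 : 0 <= C * (chi k + chi k').
    by rewrite mulr_ge0// addr_ge0.
  apply: le_trans chi0; rewrite normr_le0.
  have [kk'|kk'] := eqVneq (k * k') 0; first by rewrite /weak_integrand /= kk' eqxx.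
  have zero l l' : 0 <= l -> l <= a -> b <= l' -> l * l' != 0 -> Phi (l, l') = 0.
    by move=> l0 la bl' ll'; apply: dec; rewrite ?l0.
  have van : Phi (k, k') = 0 \/ ramp x h k = ramp x h k'.
    move: kab k'ab; rewrite !negb_and -!leNgt => /orP[ka|bk] /orP[k'a|bk'].
    - by right; rewrite !ramp_le//; lra.
    - by left; apply: zero.
    - by left; rewrite (cutoff_sym Phi_cutoff)//; apply: zero => //; rewrite mulrC.
    - by right; rewrite !ramp_ge// /h; lra.
  rewrite /weak_integrand /= (negbTE kk').
  by case: van => ->; rewrite ?subrr ?mulr0// !mul0r.
have G : 0 * (t - 0) <= pairing (v t) (ramp x h) - pairing (v 0) (ramp x h).
  apply: (pairing_growth C1 d0) => // y /andP[y0 _].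
  apply: (le_trans _ (weak_rhs_lower (v y) C0 mchi chi01 wib)).
  rewrite /pairing Rintegral_indic_halfline; last by [].
    by rewrite null ?(ltW y0)//= mulr0 oppr0.
  exact/v_half/ltW.
have up : pairing (v t) (ramp x h) <= mass v0 - distf (v t) x.
  rewrite -(mass_v t0) -[leRHS]/(fine (mass (v t) - distf (v t) x)%:E) -mu_itv_oy.
  apply: pairing_le_measure => [|//|y _|y _]; first exact: v_half.
    by case/andP: (ramp_itv x h y).
  by rewrite /= in_itv/= andbT => /negP; rewrite -leNgt => yx; rewrite ramp_le.
have low : mass v0 - distf v0 x <= pairing (v 0) (ramp x h).
  rewrite -(mass_v (lexx 0)) -dist_v_initial.
  have [x1 [x2 x3]] : a <= x /\ x <= x + h /\ x + h < b by rewrite /h; lra.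
  rewrite (dist_null (null 0 (lexx 0)) x1 x2 x3).
  rewrite -[leLHS]/(fine (mass (v 0) - distf (v 0) (x + h))%:E) -mu_itv_oy.
  apply: pairing_ge_measure => [|//|y _|y _]; [exact: v_half|exact: ramp_itv|].
  by rewrite /= in_itv/= andbT => xy; rewrite ramp_ge// ltW.
lra.
Qed.

(* Otherwise the pairing with a decreasing ramp, which stays bounded, would grow
   linearly in time. *)
Lemma no_joint_mass (p q : R) : 0 < p -> p < q -> Phi (p, q) != 0 ->
  exists2 r, 0 < r & forall a b T, 0 < a -> 0 < b -> 0 <= T ->
    ~ (forall t, T <= t -> a <= fine (v t `]p - r, p + r]%classic) /\
                          b <= fine (v t `]q - r, q + r]%classic)).
Proof.
move=> p0 pq P0.
have q0 : 0 < q by lra.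
have [r1 [c1 [r10 r1p r1q c10 H1]]] := cutoff_lower_near Phi_cutoff p0 q0 P0.
pose r := Num.min (r1 / 2) ((q - p) / 4).
have [ra rb] : r <= r1 / 2 /\ r <= (q - p) / 4 by rewrite /r !ge_min !lexx orbT.
have r0 : 0 < r by rewrite /r lt_min !divr_gt0// subr_gt0.
exists r => // a b T a0 b0 T0 H.
pose x := p - r; pose y := p + r; pose z := q - r; pose A := q + r.
have x0 : 0 <= x by rewrite /x; lra.
have yz : y < z by rewrite /y /z; lra.
have xy : x <= y by rewrite /x /y; lra.
have zA : z <= A by rewrite /z /A; lra.
have [c2 c20 H2] := @kernelB_lower R m m0 x y z A x0 xy yz zA.
(* The ramp [phi] falls from 1 to 0 exactly between the windows around [p] and [q], so
   [phi k - phi k' = 1] on their product. *)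
pose h := z - y; have h0 : 0 < h by rewrite subr_gt0.
pose phi (k : R) := 1 - ramp y h k.
have C1 := C1b_desc y h0; rewrite -/phi in C1.
have y0 : 0 < y by rewrite /y; lra.
have yh : y <= y + h by lra.
have A0 : 0 < A by rewrite /A; lra.
have [C C0 HC] := weak_integrand_bound m0 theta01 delta0 Phi_cutoff y0 yh.
have nphi k k' : 0 <= k -> k <= k' -> phi k' <= phi k by move=> _ kk'; rewrite /phi lerD2l lerN2 ramp_nd.
pose c := c1 * c2 / (A * A) * (expR (- y) - expR (- z)).
have e0 : 0 < expR (- y) - expR (- z) by rewrite subr_gt0 ltr_expR ltrN2.
have c0 : 0 < c by rewrite !mulr_gt0// invr_gt0 mulr_gt0.
have wiC k k' : 0 <= k -> 0 <= k' -> 0 <= weak_integrand m Phi phi (k, k') <= C.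
  move=> k0 k'0; rewrite (weak_integrand_ge0 _ Phi_cutoff)//=.
  apply: (le_trans (ler_norm _)); apply: (le_trans (HC phi _ _ k k' k0 k'0)).
  - by move=> u w up wp; rewrite /phi !ramp_le.
  - by move=> u w up wp; rewrite /phi !ramp_ge.
  rewrite -[leRHS]mulr1 ler_wpM2l// /phi.
  by have := ramp_itv y h k; have := ramp_itv y h k'; rewrite ler_norml; lra.
have wic k k' : `]x, y]%classic k -> `]z, A]%classic k' -> c <= weak_integrand m Phi phi (k, k').
  rewrite /= !in_itv/= => /andP[xk ky] /andP[zk' k'A].
  have k0 : 0 < k by lra.
  have k'0 : 0 < k' by lra.
  rewrite /weak_integrand /= gt_eqF ?mulr_gt0//.
  rewrite /phi (@ramp_le _ y h _ k)// (@ramp_ge _ y h _ k'); [|by []|by rewrite /h; lra].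
  rewrite subr0 subrr subr0 mulr1 /c; apply: ler_pM.
  - by rewrite divr_ge0 ?mulr_ge0 ?ltW.
  - exact: ltW.
  - apply: ler_pM.
    + by rewrite mulr_ge0 ?ltW.
    + by rewrite invr_ge0 mulr_ge0 ?ltW.
    + apply: ler_pM; rewrite ?(ltW c10) ?(ltW c20)//.
        by apply: H1; rewrite ler_norml; move: xk ky zk' k'A; rewrite /x /y /z /A; lra.
      have xky : x <= k <= y by rewrite (ltW xk).
      have zkA : z <= k' <= A by rewrite (ltW zk').
      exact: (H2 k k' xky zkA).1.
    + rewrite lef_pV2 ?posrE ?mulr_gt0//; apply: ler_pM; rewrite ?(ltW k0) ?(ltW k'0)//.
      by move: ky; rewrite /y /A; lra.
  - by apply: lerB; rewrite ler_expR lerN2 ?(ltW zk').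
pose d := c * a * b / 2.
have d0 : 0 < d by apply: divr_gt0 => //; apply: mulr_gt0 => //; exact: mulr_gt0.
have sub l u : 0 <= l -> `]l, u]%classic `<=` @halfline R.
  by move=> l0 k; rewrite halflineE /= in_itv/= => /andP[lk _]; lra.
have rhs t : T < t -> d <= weak_rhs m Phi phi (v t).
  move=> Tt; have [Ha Hb] := H t (ltW Tt).
  apply: (le_trans _ (weak_rhs_product (v t) (ltW c0) _ _ _ _ wiC wic)); try exact: measurable_itv.
  - rewrite /d ler_pM2r ?invr_gt0//.
    by apply: ler_pM; [apply: mulr_ge0; exact: ltW|exact: ltW|rewrite ler_pM2l|].
  - exact: sub.
  - by apply: sub; lra.
have phi01 k : 0 <= phi k <= 1 by rewrite /phi; have := ramp_itv y h k; lra.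
(* At growth rate [d] the pairing would gain [mass v0 + 1] by this time, more than the total mass
   allows. *)
pose t := T + (mass v0 + 1) / d.
have Tt : T <= t by rewrite /t lerDl divr_ge0 ?(ltW d0)// addr_ge0// mass_ge0.
have t0 : 0 <= t by lra.
have := @pairing_growth phi _ d T t C1 _ T0 Tt.
have -> : d * (t - T) = mass v0 + 1 by rewrite /t; field; rewrite gt_eqF.
rewrite dramp_le ?oppr0 ?(ltW y0)// => /(_ erefl)/(_ _) G.
have {}G : mass v0 + 1 <= pairing (v t) phi - pairing (v T) phi.
  by apply: G => u /andP[Tu _]; exact: rhs.
have : 0 <= pairing (v T) phi by apply: pairing_ge0 => k _; case/andP: (phi01 k).
have : pairing (v t) phi <= mass v0.
  rewrite -(mass_v t0); apply: pairing_le_measure => //; first exact: v_half.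
    by move=> k _; case/andP: (phi01 k).
  by move=> k _ /(_ Logic.I).
lra.
Qed.

End dynamics.

(** * The limit measure *)

Section stieltjes.
Variables (R : realType) (F : R -> R) (M : R).
Hypothesis F_nd : forall x y, x <= y -> F x <= F y.
Hypothesis F_right : forall x e, 0 < e -> exists2 h, 0 < h & F (x + h) < F x + e.
Hypothesis F_neg : forall x, x < 0 -> F x = 0.
Hypothesis F_le : forall x, F x <= M.

Lemma right_continuous_F : right_continuous F.
Proof.
move=> x; apply/cvgrPdist_lt => e e0; have [h h0 hx] := F_right x e0.
near=> y; have xy : x < y by near: y; exact: nbhs_right_gt.
have yh : y < x + h by near: y; apply: nbhs_right_lt; rewrite ltrDl.
have := F_nd (ltW xy); have := F_nd (ltW yh); rewrite ltr_norml => ? ?.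
by apply/andP; split; lra.
Unshelve. all: by end_near. Qed.

Lemma stieltjes_exists : exists mu : fmeasure R, on_halfline mu /\ forall x, distf mu x = F x.
Proof.
pose Fc : cumulative R R := HB.pack F (isCumulative.Build R _ R F F_nd right_continuous_F).
pose mu0 : {measure set (measurableTypeR R) -> \bar R} := lebesgue_stieltjes_measure Fc.
have itv (a b : R) : a <= b -> mu0 `]a, b]%classic = (F b - F a)%:E.
  move=> ab; rewrite /mu0 /= /lebesgue_stieltjes_measure /measure_extension.
  rewrite measurable_mu_extE/=; last exact: is_ocitv.
  by rewrite wlength_itv_bnd.
have Noo x : mu0 `]-oo, x]%classic = (F x)%:E.
  (* Subtracting [|x|] makes every left end negative, where [F] vanishes. *)
  have mI n : measurable (`]x - n.+1%:R - `|x|, x]%classic : set (measurableTypeR R)).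
    exact: measurable_itv.
  have : mu0 `]x - n.+1%:R - `|x|, x]%classic @[n --> \oo] -->
      mu0 (\bigcup_n `]x - n.+1%:R - `|x|, x]%classic).
    apply: nondecreasing_cvg_mu => //; first exact: bigcupT_measurable.
    move=> n k nk; apply/subsetPset; apply: subset_itvr; rewrite bnd_simp.
    by rewrite lerB// lerB// ler_nat.
  have -> : \bigcup_n `]x - n.+1%:R - `|x|, x]%classic = `]-oo, x]%classic :> set R.
    apply/seteqP; split => y /=; first by move=> [n _] /=; rewrite !in_itv/= => /andP[].
    rewrite in_itv/= => yx; have xy : 0 <= x - y by rewrite subr_ge0.
    exists (Num.bound (x - y)) => //=; rewrite in_itv/= yx andbT.
    have := archi_boundP xy; rewrite -natr1; have := normr_ge0 x; lra.
  move/cvg_lim => <- //; apply: lim_near_cst => //.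
  apply: nearW => n; rewrite itv; last by have := normr_ge0 x; have : 0 <= n.+1%:R :> R by []; lra.
  rewrite (F_neg (x := _ - _)) ?subr0//.
  by have := ler_norm x; have : 0 < n.+1%:R :> R by []; lra.
have fin : fin_num_fun mu0.
  apply: lty_fin_num_fun.
  have mI n : measurable (`]-oo, n%:R]%classic : set (measurableTypeR R)).
    exact: measurable_itv.
  have : mu0 `]-oo, n%:R]%classic @[n --> \oo] --> mu0 (\bigcup_n `]-oo, n%:R]%classic).
    apply: nondecreasing_cvg_mu => //; first exact: bigcupT_measurable.
    by move=> n k nk; apply/subsetPset; apply: subset_itvl; rewrite bnd_simp ler_nat.
  have -> : \bigcup_n `]-oo, n%:R]%classic = setT :> set R.
    rewrite -subTset => y _; exists (Num.bound `|y|) => //=; rewrite in_itv/=.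
    by rewrite (le_trans (ler_norm _))// ltW// archi_boundP.
  move=> c; apply: (@le_lt_trans _ _ M%:E); last exact: ltry.
  rewrite -(cvg_lim _ c)//; apply: lime_le; first by apply/cvg_ex; exists (mu0 setT).
  by apply: nearW => n; rewrite Noo lee_fin.
pose mu : fmeasure R := HB.pack (lebesgue_stieltjes_measure Fc)
  (@Measure_isFinite.Build _ _ _ (lebesgue_stieltjes_measure Fc) fin).
have muE A : mu A = mu0 A by [].
exists mu; split; last by move=> x; rewrite /distf muE Noo.
rewrite /on_halfline muE.
have -> : `]-oo, 0[%classic = \bigcup_n `]-oo, - n.+1%:R^-1]%classic :> set R.
  apply/seteqP; split => y /=; rewrite in_itv/=.
    move=> y0; have y1 : 0 <= (- y)^-1 by rewrite invr_ge0; lra.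
    exists (Num.bound (- y)^-1) => //=; rewrite in_itv/= lerNr.
    rewrite invf_ple ?posrE ?oppr_gt0// (le_trans (ltW (archi_boundP y1)))//.
    by rewrite ler_nat.
  by move=> [n _] /=; rewrite in_itv/= => /le_lt_trans; apply; rewrite oppr_lt0 invr_gt0.
apply: measure_negligible; first by apply: bigcupT_measurable => n; exact: measurable_itv.
apply: negligible_bigcup => n; apply/negligibleP; first exact: measurable_itv.
by apply: (etrans (Noo _)); rewrite F_neg// oppr_lt0 invr_gt0.
Qed.

End stieltjes.

Section limit_measure.
Variables (R : realType) (v : R -> fmeasure R) (M : R).
Hypothesis v_half : forall t, 0 <= t -> on_halfline (v t).
Hypothesis v_nd : forall s t x, 0 <= s -> s <= t -> distf (v s) x <= distf (v t) x.
Hypothesis v_mass : forall t, 0 <= t -> mass (v t) = M.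

(** By monotonicity in time, the pointwise limit of the distribution functions as [t --> +oo]. *)
Definition distG (x : R) : R := sup [set distf (v t) x | t in [set t | 0 <= t]].

Let G_ub x : ubound [set distf (v t) x | t in [set t | 0 <= t]] M.
Proof. by move=> _ [t /= t0 <-]; rewrite -(v_mass t0) distf_le_mass. Qed.

Lemma distG_ge t x : 0 <= t -> distf (v t) x <= distG x.
Proof. by move=> t0; apply: ub_le_sup; [exists M; exact: G_ub|exists t]. Qed.

Lemma distG_le x : distG x <= M.
Proof. by apply: ge_sup; [exists (distf (v 0) x); exists 0 => //=|exact: G_ub]. Qed.

Lemma distG_approx x e : 0 < e -> exists2 T, 0 <= T & forall t, T <= t -> distG x - e < distf (v t) x.
Proof.
move=> e0; have [|_ [T /= T0 <-] TE] := @sup_adherent R [set distf (v t) x | t in [set t | 0 <= t]] e e0.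
  by split; [exists (distf (v 0) x); exists 0 => //=|exists M; exact: G_ub].
by exists T => // t Tt; apply: lt_le_trans TE _; exact: v_nd.
Qed.

Lemma distG_nd x y : x <= y -> distG x <= distG y.
Proof.
move=> xy; apply: ge_sup; first by exists (distf (v 0) x); exists 0 => //=.
by move=> _ [t /= t0 <-]; apply: le_trans (distG_ge y t0); exact: distf_nd.
Qed.

(* Mass may drift down to [x] as [t --> +oo], so [distG] need not be
   right-continuous. *)
Definition distL (x : R) : R := inf [set distG y | y in [set y | x < y]].

Let L_lb x : lbound [set distG y | y in [set y | x < y]] (distG x).
Proof. by move=> _ [y /= xy <-]; apply: distG_nd; exact: ltW. Qed.

Lemma distL_le x y : x < y -> distL x <= distG y.
Proof. by move=> xy; apply: ge_inf; [exists (distG x); exact: L_lb|exists y]. Qed.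

Lemma distG_le_L x : distG x <= distL x.
Proof.
by apply: lb_le_inf; [exists (distG (x + 1)); exists (x + 1) => //=; rewrite ltrDl|exact: L_lb].
Qed.

Lemma limit_exists : exists mu : fmeasure R, on_halfline mu /\ forall x, distf mu x = distL x.
Proof.
apply: (@stieltjes_exists R distL M).
- move=> x y; rewrite le_eqVlt => /predU1P[->//|xy].
  by apply: le_trans (distL_le xy) (distG_le_L y).
- move=> x e e0.
  have [|_ [y /= xy <-] yE] := @inf_adherent R [set distG y | y in [set y | x < y]] e e0.
    by split; [exists (distG (x + 1)); exists (x + 1) => //=; rewrite ltrDl|exists (distG x); exact: L_lb].
  exists ((y - x) / 2); first by rewrite divr_gt0// subr_gt0.
  by apply: le_lt_trans yE; apply: distL_le; lra.
- move=> x x0.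
  have G0 y : y < 0 -> distG y = 0.
    move=> y0; apply/eqP; rewrite eq_le; apply/andP; split.
      apply: ge_sup; first by exists (distf (v 0) y); exists 0 => //=.
      by move=> _ [t /= t0 <-]; rewrite distf_lt0//; exact: v_half.
    by rewrite -(distf_lt0 (v_half (lexx 0)) y0) distG_ge.
  apply/eqP; rewrite eq_le; apply/andP; split; last by rewrite -(G0 x x0) distG_le_L.
  by rewrite -(G0 (x / 2)) ?distL_le//; lra.
- by move=> x; apply: le_trans (distL_le (_ : x < x + 1)) (distG_le _); rewrite ltrDl.
Qed.

Variable mu : fmeasure R.
Hypothesis mu_half : on_halfline mu.
Hypothesis muL : forall x, distf mu x = distL x.

Lemma dist_mu_ge t x : 0 <= t -> distf (v t) x <= distf mu x.
Proof. by move=> t0; rewrite muL (le_trans (distG_ge x t0))// distG_le_L. Qed.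

Lemma mass_mu : mass mu = M.
Proof.
apply/eqP; rewrite eq_le; apply/andP; split.
  apply/ler_addgt0Pr => e e0; have [L _] := distf_near_mass mu e0.
  have L1 : L < L + 1 by rewrite ltrDl.
  by rewrite muL; have := distL_le L1; have := distG_le (L + 1); lra.
apply/ler_addgt0Pr => e e0; have [L _] := distf_near_mass (v 0) e0.
by rewrite v_mass//; have := dist_mu_ge L (lexx 0); have := distf_le_mass mu L; lra.
Qed.

(** [distL] is constant near a point off the support, and [distL y <= distG x <= distL x] for
    [y < x]; hence [distG x = distL x]. *)
Lemma dist_mu_lim x : ~ msupp mu x -> forall e, 0 < e ->
  exists2 T, 0 <= T & forall t, T <= t -> `|distf (v t) x - distf mu x| < e.
Proof.
move=> /notin_msupp[r r0 mr] e e0.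
have [T T0 TE] := distG_approx x e0; exists T => // t Tt.
have t0 : 0 <= t by lra.
have := TE t Tt; have := dist_mu_ge x t0.
have r2 : x - r / 2 < x by rewrite ltrBlDr ltrDl divr_gt0.
have : distf mu (x - r / 2) = distf mu x.
  have [h1 [h2 h3]] : x - r <= x - r / 2 /\ x - r / 2 <= x /\ x < x + r by lra.
  exact: (dist_null mr h1 h2 h3).
have := distL_le r2; rewrite -muL => h4 h5 h6 h7.
rewrite ltr_norml; apply/andP; split; lra.
Qed.

Hypothesis mu_dense : forall p q, 0 <= p -> p < q -> exists x, p < x < q /\ ~ msupp mu x.

Let lip1 (phi : R -> R) := (forall x y, `|phi x - phi y| <= `|x - y|) /\ (forall x, `|phi x| <= 1).

Let J (nu : fmeasure R) (phi : R -> R) (A : set (measurableTypeR R)) : R := \int[nu]_(k in A) phi k.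

Let lip_cont phi : lip1 phi -> continuous phi.
Proof.
move=> [lip _] x; apply/cvgrPdist_lt => e e0; near=> y.
apply: (le_lt_trans (lip x y)); near: y.
by apply/nbhs_ballP; exists e.
Unshelve. all: by end_near. Qed.

Let Jint (nu : fmeasure R) phi (A : set (measurableTypeR R)) : lip1 phi -> measurable A -> nu.-integrable A (EFin \o phi).
Proof.
move=> lphi mA; apply: measurable_bounded_integrable => //.
- by have /fin_numPlt/andP[] := mu_fin nu mA.
- by apply: measurable_funTS; apply: continuous_measurable_fun; exact: lip_cont.
exists 1; split; [exact: num_real|move=> K K1 x _].
exact: le_trans (lphi.2 x) (ltW K1).
Qed.

Let J_osc nu phi A c h : lip1 phi -> measurable A -> (forall x, A x -> `|phi x - c| <= h) ->
  `|J nu phi A - c * fine (nu A)| <= h * fine (nu A).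
Proof.
move=> lphi mA osc.
have ic (r : R) : nu.-integrable A (EFin \o (fun=> r)) by exact: finite_measure_integrable_cst.
rewrite ler_norml; apply/andP; split.
  rewrite lerBrDr -mulNr -mulrDl -(Rintegral_cst nu mA).
  apply: le_Rintegral => //; first exact: Jint.
  by move=> x /osc; rewrite ler_norml; lra.
rewrite lerBlDr -mulrDl -(Rintegral_cst nu mA).
apply: le_Rintegral => //; first exact: Jint.
by move=> x /osc; rewrite ler_norml; lra.
Qed.

Let J_add nu phi A B : lip1 phi -> measurable A -> measurable B -> [disjoint A & B] ->
  J nu phi (A `|` B) = J nu phi A + J nu phi B.
Proof.
move=> lphi mA mB AB; apply: Rintegral_setU => //.
by apply: Jint => //; exact: measurableU.
Qed.

Let nu_0x (nu : fmeasure R) x : on_halfline nu -> fine (nu `[0, x]%classic) = distf nu x.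
Proof.
move=> nh; rewrite /distf [in RHS](on_halflineI nh); last exact: measurable_itv.
congr (fine (nu _)); apply/seteqP; split => y; rewrite /halfline/= !in_itv/= ?andbT.
  by move=> /andP[].
by move=> [-> ->].
Qed.

(** Induction over grid points off the support. Steps larger than [h / 2] reach any level in
    finitely many cells; steps smaller than [h] bound the oscillation of [phi] on each cell. [eta]
    is quantified after [x], so that a step can call the previous one with [eta / 3], and [T] does
    not depend on [phi], as the supremum in [d0] requires. *)
Let J_grid (h : R) (n : nat) : 0 < h -> exists x, [/\ n%:R * (h / 2) <= x, 0 <= x, ~ msupp mu x &
  forall eta, 0 < eta -> exists2 T, 0 <= T & forall t phi, T <= t -> lip1 phi ->
    `|J (v t) phi `[0, x]%classic - J mu phi `[0, x]%classic| <=
       h * (distf (v t) x + distf mu x) + eta].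
Proof.
move=> h0; elim: n => [|n [x [nx x0 xs H]]].
  have [x [/andP[x0 xh] xs]] := mu_dense (lexx 0) h0.
  exists x; split; [lra|lra|by []|].
  move=> eta eta0; have [T T0 TE] := dist_mu_lim xs eta0; exists T => // t phi Tt lphi.
  have t0 : 0 <= t by lra.
  have osc y : `[0, x]%classic y -> `|phi y - phi x| <= h.
    rewrite /= in_itv/= => /andP[y0 yx]; apply: (le_trans (lphi.1 y x)).
    by rewrite ler_norml; lra.
  have mI : measurable (`[0, x]%classic : set (measurableTypeR R)) by exact: measurable_itv.
  have := J_osc (v t) lphi mI osc; have := J_osc mu lphi mI osc.
  rewrite !nu_0x//; last exact: v_half.
  have : `|phi x * (distf (v t) x - distf mu x)| <= eta.
    rewrite normrM (le_trans _ (ltW (TE t Tt)))// ler_piMl//; exact: lphi.2.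
  by rewrite !ler_norml => /andP[? ?] /andP[? ?] /andP[? ?]; apply/andP; split; lra.
have xh2 : 0 <= x + h / 2 by lra.
have xh3 : x + h / 2 < x + h by lra.
have [y [/andP[y1 y2] ys]] := mu_dense xh2 xh3.
exists y; split; [by rewrite -natr1 mulrDl mul1r; lra|lra|by []|].
move=> eta eta0; have e3 : 0 < eta / 3 by rewrite divr_gt0.
have [T1 T10 H1] := H _ e3.
have [T2 T20 H2] := dist_mu_lim xs e3.
have [T3 T30 H3] := dist_mu_lim ys e3.
exists (Num.max T1 (Num.max T2 T3)); first by rewrite le_max T10.
move=> t phi; rewrite !ge_max => /andP[t1 /andP[t2 t3]] lphi.
have t0 : 0 <= t by lra.
have xy : x <= y by lra.
have split01 : `[0, y]%classic = `[0, x]%classic `|` `]x, y]%classic :> set R.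
  apply/seteqP; split => z /=; rewrite !in_itv/=.
    move=> /andP[z0 zy]; have [zx|zx] := leP z x; [left|right]; lra.
  by move=> [|] /andP[? ?]; lra.
have m1 : measurable (`[0, x]%classic : set (measurableTypeR R)) by exact: measurable_itv.
have m2 : measurable (`]x, y]%classic : set (measurableTypeR R)) by exact: measurable_itv.
have dis : [disjoint `[0, x]%classic & `]x, y]%classic : set (measurableTypeR R)].
  apply/eqP; rewrite -subset0 => z /= []; rewrite !in_itv/= => /andP[_ zx] /andP[xz _].
  by have := le_lt_trans zx xz; rewrite ltxx.
rewrite split01 !J_add//.
have osc z : `]x, y]%classic z -> `|phi z - phi y| <= h.
  rewrite /= in_itv/= => /andP[xz zy]; apply: (le_trans (lphi.1 z y)).
  by rewrite ler_norml; lra.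
have := J_osc (v t) lphi m2 osc; have := J_osc mu lphi m2 osc.
rewrite !mu_itv_oc//=.
have := H1 t phi t1 lphi.
have hx : `|phi y * (distf (v t) x - distf mu x)| <= eta / 3.
  rewrite normrM (le_trans _ (ltW (H2 t t2)))// ler_piMl//; exact: lphi.2.
have hy : `|phi y * (distf (v t) y - distf mu y)| <= eta / 3.
  rewrite normrM (le_trans _ (ltW (H3 t t3)))// ler_piMl//; exact: lphi.2.
move: hx hy; rewrite !ler_norml => /andP[? ?] /andP[? ?] /andP[? ?] /andP[? ?] /andP[? ?].
by apply/andP; split; lra.
Qed.

Lemma limit_d0 e : 0 < e -> exists2 T, 0 <= T & forall t, T <= t -> d0 (v t) mu <= e.
Proof.
move=> e0; have e4 : 0 < e / 4 by rewrite divr_gt0.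
have M0 : 0 <= M by rewrite -(v_mass (lexx 0)) mass_ge0.
pose h := e / 4 / (2 * M + 1).
have M1 : 0 < 2 * M + 1 by rewrite ltr_wpDl// mulr_ge0.
have h0 : 0 < h by rewrite divr_gt0.
have hM : h * (2 * M) <= e / 4.
  by rewrite /h -mulrA ler_piMr ?(ltW e4)// mulrC ler_pdivrMr// mul1r; lra.
(* Mass to the left of [L] can only grow, so a level chosen at time 0 bounds the tails of all [v t]
   and of [mu]. *)
have [L L0] := distf_near_mass (v 0) e4; rewrite v_mass// => LM.
have L2 : 0 <= L / (h / 2) by rewrite divr_ge0 ?(ltW L0)// divr_ge0// ltW.
have [x [nx x0 xs H]] := J_grid (Num.bound (L / (h / 2))) h0.
have Lx : L <= x.
  apply: le_trans nx; rewrite -ler_pdivrMr ?divr_gt0//; exact/ltW/archi_boundP.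
have [T T0 HT] := H _ e4; exists T => // t Tt.
have t0 : 0 <= t by lra.
apply: ge_sup; first by exists (pairing (v t) (cst 0) - pairing mu (cst 0));
  exists (cst 0) => //; split=> [a b _ _|a _]; rewrite /cst ?subrr normr0.
move=> _ [phi [lip b1] <-].
(* Test functions are constrained on the half-line only; [psi] is a 1-Lipschitz extension to the
   whole line, hence measurable. *)
pose psi (k : R) := phi (Num.max 0 k).
have max0 (a : R) : 0 <= Num.max 0 a by rewrite le_max lexx.
have lpsi : lip1 psi.
  split=> [a b|a]; last exact: b1.
  apply: (le_trans (lip _ _ (max0 a) (max0 b))).
  have [?|?] := leP 0 a; have [?|?] := leP 0 b; rewrite // !ler_norml ?normr_ge0;
    have := ler_norm (a - b); have := ler_norm (- (a - b)); rewrite normrN => *;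
    apply/andP; split; lra.
have pp nu : pairing nu phi = J nu psi (@halfline R).
  apply: eq_Rintegral => k; rewrite inE halflineE => k0.
  by rewrite /psi (max_idPr k0).
have spl : @halfline R = `[0, x]%classic `|` `]x, +oo[%classic.
  apply/seteqP; split => z; rewrite /halfline /= !in_itv/= ?andbT.
    by move=> z0; have [zx|zx] := leP z x; [left; rewrite z0|right].
  by move=> [/andP[]//|xz]; lra.
have m1 : measurable (`[0, x]%classic : set (measurableTypeR R)) by exact: measurable_itv.
have m2 : measurable (`]x, +oo[%classic : set (measurableTypeR R)) by exact: measurable_itv.
have dis : [disjoint `[0, x]%classic & `]x, +oo[%classic : set (measurableTypeR R)].
  apply/eqP; rewrite -subset0 => z /= []; rewrite !in_itv/= andbT => /andP[_ zx] xz.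
  by have := le_lt_trans zx xz; rewrite ltxx.
have osc z : `]x, +oo[%classic z -> `|psi z - 0| <= 1 by move=> _; rewrite subr0; exact: lpsi.2.
rewrite !pp spl !J_add//.
have := J_osc (v t) lpsi m2 osc; have := J_osc mu lpsi m2 osc.
rewrite !mu_itv_oy/= mass_mu v_mass//.
have := HT t psi Tt lpsi.
have dL : M - e / 4 < distf (v t) x.
  by apply: (lt_le_trans LM); apply: le_trans (distf_nd _ Lx) _; apply: v_nd.
have dm : distf (v t) x <= distf mu x by exact: dist_mu_ge.
have d1 : distf (v t) x <= M by rewrite -(v_mass t0) distf_le_mass.
have d2 : distf mu x <= M by rewrite -mass_mu distf_le_mass.
have hh : h * (distf (v t) x + distf mu x) <= e / 4.
  by apply: le_trans hM; rewrite ler_pM2l//; lra.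
rewrite !ler_norml => /andP[? ?] /andP[? ?] /andP[? ?]; lra.
Qed.

End limit_measure.

(** * Support and atoms of the limit *)

Section long_time.
Variables (R : realType) (m theta delta : R) (Phi : R * R -> R).
Hypotheses (m0 : 0 < m) (theta01 : 0 < theta < 1) (delta0 : 0 < delta).
Hypothesis Phi_cutoff : is_cutoff theta delta Phi.
Variables (v0 : fmeasure R) (v : R -> fmeasure R).
Hypothesis v0_half : on_halfline v0.
Hypothesis v_half : forall t, 0 <= t -> on_halfline (v t).
Hypothesis v_sol : weak_solution m Phi v0 v.
Hypothesis v_mass : forall t, 0 < t -> M0 (v t) = M0 v0.
Variable mu : fmeasure R.
Hypothesis mu_half : on_halfline mu.
Hypothesis muL : forall x, distf mu x = distL v x.
Notation D := (Dset theta delta).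
Notation H := (@halfline R).
Notation M := (mass v0).

Let nd s t x : 0 <= s -> s <= t -> distf (v s) x <= distf (v t) x.
Proof. exact: (dist_v_nd Phi_cutoff v_half v_sol). Qed.

Let ms t : 0 <= t -> mass (v t) = M.
Proof. exact: (mass_v v0_half v_half v_sol v_mass). Qed.

Let vge t x : 0 <= t -> distf v0 x <= distf (v t) x.
Proof. exact: (dist_v_ge Phi_cutoff v0_half v_half v_sol). Qed.

Let mu_ge0 x : distf v0 x <= distf mu x.
Proof. by apply: le_trans (vge x (lexx 0)) _; exact: (dist_mu_ge ms muL). Qed.

Let mass_muM : mass mu = M.
Proof. exact: (mass_mu ms muL). Qed.

Let v_null a b t : 0 <= a -> v0 `]a, b[%classic = 0%E -> 0 <= t -> v t `]a, b[%classic = 0%E.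
Proof. exact: (null_interval m0 theta01 delta0 Phi_cutoff v0_half v_half v_sol v_mass). Qed.

Lemma limit_const a b y z : 0 <= a -> v0 `]a, b[%classic = 0%E -> a <= y -> y <= z -> z < b ->
  distf mu y = distf mu z.
Proof.
move=> a0 v0ab ay yz zb.
have GL x : a <= x -> x < b -> distL v x = distG v x.
  move=> ax xb; apply/eqP; rewrite eq_le (distG_le_L ms) andbT.
  have xx : x < (x + b) / 2 by lra.
  apply: (le_trans (distL_le ms xx)).
  apply: ge_sup; first by exists (distf (v 0) ((x + b) / 2)); exists 0 => //=.
  move=> _ [t /= t0 <-]; apply: le_trans (distG_ge ms x t0).
  have [h1 h2] : x <= (x + b) / 2 /\ (x + b) / 2 < b by lra.
  by rewrite (dist_null (v_null a0 v0ab t0) ax h1 h2).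
rewrite !muL !GL; [|lra..].
apply/eqP; rewrite eq_le (distG_nd ms yz)/=.
apply: ge_sup; first by exists (distf (v 0) z); exists 0 => //=.
move=> _ [t /= t0 <-]; apply: le_trans (distG_ge ms y t0).
by rewrite (dist_null (v_null a0 v0ab t0) ay yz zb).
Qed.

Lemma limit_conserved a b x : 0 <= a -> v0 `]a, b[%classic = 0%E ->
  (forall k k', 0 <= k <= a -> b <= k' -> k * k' != 0 -> Phi (k, k') = 0) ->
  a <= x < b -> distf mu x = distf v0 x.
Proof.
move=> a0 v0ab dec /andP[ax xb]; apply/eqP; rewrite eq_le mu_ge0 andbT muL.
have [h1 h2] : x < (x + b) / 2 /\ (x + b) / 2 < b by lra.
apply: (le_trans (distL_le ms h1)).
apply: ge_sup; first by exists (distf (v 0) ((x + b) / 2)); exists 0 => //=.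
move=> _ [t /= t0 <-].
rewrite (gap_conserved m0 theta01 delta0 Phi_cutoff v0_half v_half v_sol v_mass a0 v0ab dec t0); last by lra.
by rewrite (dist_null v0ab ax (ltW h1) h2).
Qed.

Lemma msupp_ge0 (nu : fmeasure R) x : on_halfline nu -> msupp nu x -> 0 <= x.
Proof.
move=> nuh nx; rewrite leNgt; apply/negP => x0.
have : (0 < nu `](x - 1)%R, 0%R[%classic)%E.
  by apply: (msupp_itv nx); rewrite x0 andbT ltrBlDr ltrDl.
rewrite (_ : nu _ = 0%E) ?ltxx//.
apply: (@subset_measure0 _ _ _ nu _ `]-oo, 0[%classic) nuh => //; try exact: measurable_itv.
by move=> y /=; rewrite !in_itv/= => /andP[].
Qed.

Lemma not_msupp_const (nu : fmeasure R) x y z : y < x < z -> distf nu y = distf nu z -> ~ msupp nu x.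
Proof.
move=> /andP[yx xz] e nx.
have : (0 < nu `]y, z[%classic)%E by apply: (msupp_itv nx); rewrite yx.
rewrite (_ : nu _ = 0%E) ?ltxx//.
have n0 : nu `]y, z]%classic = 0%E.
  by rewrite mu_itv_oc ?e ?subrr// ltW// (lt_trans yx).
apply: (@subset_measure0 _ _ _ nu _ `]y, z]%classic) n0; try exact: measurable_itv.
by apply: subset_itvl; rewrite bnd_simp.
Qed.

Lemma msupp_limit x : msupp mu x -> msupp v0 x.
Proof.
move=> mx; apply: contrapT => nx; have x0 := msupp_ge0 mu_half mx.
have [e e0 ne] := notin_msupp nx.
have sub a b : x - e <= a -> b <= x + e -> v0 `]a, b[%classic = 0%E.
  move=> ae be; apply: (@subset_measure0 _ _ _ v0 _ `]x - e, x + e[%classic) ne; try exact: measurable_itv.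
  by apply: subset_itvW.
move: x0; rewrite le_eqVlt => /predU1P[x0|x0]; last first.
  pose a := Num.max 0 (x - e / 2); have a0 : 0 <= a by rewrite /a le_max lexx.
  have ax : a < x by rewrite /a gt_max x0/=; lra.
  have ae : x - e / 2 <= a by rewrite /a le_max lexx orbT.
  have vab : v0 `]a, x + e[%classic = 0%E by apply: sub => //; lra.
  have [h1 [h2 h3]] : a <= a /\ a <= x + e / 2 /\ x + e / 2 < x + e by lra.
  apply: (not_msupp_const (y := a) (z := x + e / 2)) mx; first by rewrite ax/=; lra.
  exact: (limit_const a0 vab h1 h2 h3).
(* At [x = 0] mass might reach the point from the right, out of the empty interval []0, e[]. With
   left end [a = 0] the decoupling condition is void, because [k = 0]; so the mass of [[0, e / 2]]
   is conserved, and it was 0. *)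
rewrite -x0 in ne sub mx nx *.
have v00 : v0 `]0, 0 + e[%classic = 0%E by apply: sub => //; lra.
apply: (not_msupp_const (y := -1) (z := e / 2)) mx; first by rewrite ltrN10 divr_gt0.
rewrite distf_lt0 ?ltrN10//.
rewrite (limit_conserved (lexx 0) v00); first last.
- by lra.
- move=> k k' /andP[k0 k0'] _; rewrite (_ : k = 0) ?mul0r ?eqxx//; lra.
have [h1 h2] : - (e / 2) <= e / 2 /\ e / 2 < 0 + e by lra.
have h3 : 0 - e <= - (e / 2) by lra.
rewrite -(dist_null ne h3 h1 h2) distf_lt0//; lra.
Qed.

Lemma limit_separated p q : msupp mu p -> msupp mu q -> 0 < p -> p < q -> Phi (p, q) = 0.
Proof.
move=> mp mq p0 pq; have [//|P0] := eqVneq (Phi (p, q)) 0.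
have [r r0 HH] := no_joint_mass m0 theta01 delta0 Phi_cutoff v0_half v_half v_sol v_mass p0 pq P0.
(* The right end grows from [x + r / 2] to [x + r] because [distL] bounds [distG] only at points
   strictly further right. *)
have gain x : msupp mu x -> exists2 a, 0 < a & exists2 T, 0 <= T & forall t, T <= t ->
    a <= fine (v t `]x - r, x + r]%classic).
  move=> mx; have xr : x - r < x < x + r / 2 by lra.
  pose a := distf mu (x + r / 2) - distf mu (x - r).
  have a0 : 0 < a.
    rewrite lt_neqAle eq_sym subr_eq0; apply/andP; split.
      by apply/eqP => e; apply: (not_msupp_const xr (esym e) mx).
    by rewrite subr_ge0 distf_nd//; lra.
  exists (a / 2); first by rewrite divr_gt0.
  have a2 : 0 < a / 2 by rewrite divr_gt0.
  have [T T0 HT] := distG_approx nd ms (x + r) a2; exists T => // t Tt.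
  have t0 : 0 <= t by lra.
  rewrite mu_itv_oc/=; last lra.
  have h1 : x + r / 2 < x + r by lra.
  have := HT t Tt; have := distL_le ms h1; have := distG_le_L ms (x - r).
  have := distG_ge ms (x - r) t0; rewrite -!muL /a; lra.
have [a a0 [T1 T10 H1]] := gain p mp.
have [b b0 [T2 T20 H2]] := gain q mq.
case: (HH a b (Num.max T1 T2) a0 b0); first by rewrite le_max T10.
by move=> t; rewrite ge_max => /andP[t1 t2]; split; [exact: H1|exact: H2].
Qed.

Lemma limit_separated_neq p q : msupp mu p -> msupp mu q -> p != q -> Phi (p, q) = 0.
Proof.
move=> mp mq; have p0 := msupp_ge0 mu_half mp; have q0 := msupp_ge0 mu_half mq.
wlog pq : p q mp mq p0 q0 / p < q.
  move=> W; rewrite neq_lt => /orP[pq|qp]; first by apply: W; rewrite ?lt_eqF.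
  by rewrite (cutoff_sym Phi_cutoff)//; apply: W; rewrite ?lt_eqF.
move=> _; move: p0; rewrite le_eqVlt => /predU1P[p0|p0]; last exact: limit_separated.
rewrite -p0 in pq *.
by have [_] := cutoff_axis theta01 Phi_cutoff pq.
Qed.

Lemma limit_isolated p : 0 < p -> exists2 r, 0 < r & forall k k', `|k - p| < r -> `|k' - p| < r ->
  msupp mu k -> msupp mu k' -> k = k'.
Proof.
move=> p0; have [r /andP[r0 _] P1] := cutoff_near_diagonal theta01 Phi_cutoff p0.
exists r => // k k' kp k'p mk mk'; apply/eqP; apply: contraT => kk'.
have [P _] := P1 k k' kp k'p; move: P; rewrite (limit_separated_neq mk mk' kk') => /eqP.
by rewrite eq_sym oner_eq0.
Qed.

(** Of the midpoint and a second point within its isolation radius, at most one lies in the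
    support. *)
Lemma limit_dense p q : 0 <= p -> p < q -> exists x, p < x < q /\ ~ msupp mu x.
Proof.
move=> p0 pq; have c0 : 0 < (p + q) / 2 by lra.
have [r r0 iso] := limit_isolated c0.
pose c := (p + q) / 2; pose e := Num.min r ((q - p) / 2) / 2.
have e0 : 0 < e by rewrite divr_gt0// lt_min r0 divr_gt0// subr_gt0.
have [e1 e2] : e <= r / 2 /\ e <= (q - p) / 2 / 2.
  by split; rewrite ler_pM2r// ge_min lexx ?orbT.
have [mc|mc] := pselect (msupp mu c); last by exists c; split => //; rewrite /c; lra.
exists (c + e); split; first by rewrite /c; lra.
move=> mce; have : c = c + e.
  apply: iso => //; rewrite -/c ?subrr ?normr0// addrAC subrr add0r gtr0_norm//; lra.
by lra.
Qed.

(** Balls of half the isolation radius around the positive support points are disjoint: if two of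
    them meet, their centres are closer than the larger radius, hence equal. The possible
    accumulation point 0 is added separately. *)
Lemma limit_countable : countable (msupp mu).
Proof.
have Spos : countable [set x | msupp mu x /\ 0 < x].
  have [r rP] : {r : R -> R & forall p, 0 < p -> 0 < r p /\ forall k k', `|k - p| < r p -> `|k' - p| < r p ->
      msupp mu k -> msupp mu k' -> k = k'}.
    apply: (@choice _ _ (fun p r => 0 < p -> 0 < r /\ forall k k', `|k - p| < r -> `|k' - p| < r ->
      msupp mu k -> msupp mu k' -> k = k')) => p.
    have [p0|p0] := ltP 0 p; last by exists 1; lra.
    by have [r r0 HH] := limit_isolated p0; exists r.
  apply: (@separated_open_countable R R (fun p => ball p (if 0 < p then r p / 2 else 1))).
  - by move=> p; exact: ball_open.
  - move=> p; exists p; apply: ballxx; case: ifPn => // p0.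
    by rewrite divr_gt0//; case: (rP p p0).
  - move=> p q [/= mp p0] [/= mq q0] [z [/= ]]; rewrite p0 q0 /ball/= => pz qz.
    have [rp HP] := rP p p0; have [rq HQ] := rP q q0.
    have pq : `|p - q| < r p / 2 + r q / 2.
      rewrite (_ : p - q = (p - z) + (z - q)); last by ring.
      by rewrite (le_lt_trans (ler_normD _ _))// ltrD// distrC.
    have [rr|rr] := leP (r q) (r p).
      by apply: HP => //; [rewrite subrr normr0|rewrite distrC; lra].
    by apply: HQ => //; [lra|rewrite subrr normr0].
pose B (b : bool) := if b then [set 0] else [set x | msupp mu x /\ 0 < x].
apply: (@sub_countable _ _ _ (\bigcup_(b in setT) B b)).
  apply: subset_card_le => x mx; have := msupp_ge0 mu_half mx.
  by rewrite le_eqVlt => /predU1P[<-|x0]; [exists true|exists false].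
by apply: bigcup_countable; [exact: countableP|case=> _ //=; exact: countable1].
Qed.

(** Atoms are indexed through an injection of the countable support into [nat], which [k'] inverts
    on its image [N]. A weight can be 0: the point 0 may belong to the support only as a limit of
    atoms. *)
Lemma limit_atoms : exists (N : set nat) (M' k' : nat -> R),
  [/\ forall i, N i -> msupp mu (k' i),
      forall i, 0 <= M' i,
      forall i j, N i -> N j -> k' i = k' j -> i = j,
      forall x, msupp mu x -> exists2 i, N i & k' i = x &
      forall A : set (measurableTypeR R), measurable A ->
        mu A = (\esum_(i in N) ((M' i)%:E * \d_(k' i) A))%E].
Proof.
have [f finj] : exists f : R -> nat, {in msupp mu &, injective f}.
  by have /pcard_injP[f fi] := limit_countable; exists f.
pose N := f @` msupp mu.
have [k' kP] : {k' : nat -> R & forall i, N i -> msupp mu (k' i) /\ f (k' i) = i}.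
  apply: (@choice _ _ (fun i x => N i -> msupp mu x /\ f x = i)) => i.
  have [[x mx fx]|nN] := pselect (N i); last by exists 0.
  by exists x.
pose M' i := fine (mu [set k' i]).
have k'f x : msupp mu x -> k' (f x) = x.
  move=> mx; have Nfx : N (f x) by exists x.
  have [mk fk] := kP _ Nfx.
  by apply: finj; rewrite ?inE.
have k'inj i j : N i -> N j -> k' i = k' j -> i = j.
  by move=> Ni Nj e; rewrite -(kP i Ni).2 -(kP j Nj).2 e.
exists N, M', k'; split => //.
- by move=> i Ni; exact: (kP i Ni).1.
- by move=> i; exact: fine_ge0.
- by move=> x mx; exists (f x); [exists x|exact: k'f].
move=> A mA.
have mS : measurable (msupp mu : set (measurableTypeR R)).
  by apply: closed_measurable; exact: closed_msupp.
have mI i : measurable ([set k' i] `&` A : set (measurableTypeR R)).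
  by apply: measurableI => //; exact: measurable_set1.
have -> : mu A = mu (\bigcup_(i in N) ([set k' i] `&` A)).
  have AS : \bigcup_(i in N) ([set k' i] `&` A) = A `&` msupp mu.
    apply/seteqP; split => x /=.
      by move=> [i Ni] [/= -> Ax]; split => //; exact: (kP i Ni).1.
    by move=> [Ax mx]; exists (f x); [exists x|split => //=; rewrite k'f].
  rewrite AS -[in LHS](setUIDK A (msupp mu)) measureU; last 3 first.
  - exact: measurableI.
  - exact: measurableD.
  - by rewrite setDE setIACA setICr setI0.
  rewrite [X in (_ + X)%E](_ : _ = 0%E) ?adde0//.
  by apply: mu_disj_msupp; [exact: measurableD|move=> x []].
rewrite measure_bigcup//; last first.
  by move=> i j Ni Nj [x [[/= -> _] [/= e _]]]; exact: k'inj.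
rewrite nneseries_esum// set_mem_set; apply: eq_esum => i Ni.
rewrite diracE; case: (boolP (k' i \in A)) => [/set_mem Ak|/negP Ak].
  rewrite mule1 /M' fineK; last by apply: mu_fin; exact: measurable_set1.
  by congr (mu _); apply/setIidPl => x /= ->.
rewrite mule0 (_ : _ `&` _ = set0) ?measure0//.
by rewrite -subset0 => x [/= -> /mem_set].
Qed.

End long_time.

(** * Gaps and clusters *)

Section cluster_masses.
Variables (R : realType) (m theta delta : R) (Phi : R * R -> R).
Hypotheses (m0 : 0 < m) (theta01 : 0 < theta < 1) (delta0 : 0 < delta).
Hypothesis Phi_cutoff : is_cutoff theta delta Phi.
Variables (v0 : fmeasure R) (v : R -> fmeasure R).
Hypothesis v0_half : on_halfline v0.
Hypothesis v_half : forall t, 0 <= t -> on_halfline (v t).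
Hypothesis v_sol : weak_solution m Phi v0 v.
Hypothesis v_mass : forall t, 0 < t -> M0 (v t) = M0 v0.
Variable mu : fmeasure R.
Hypothesis mu_half : on_halfline mu.
Hypothesis muL : forall x, distf mu x = distL v x.
Notation D := (Dset theta delta).
Notation H := (@halfline R).
Notation S0 := (msupp v0).
Notation U := (\bigcup_(I in selected_gaps D v0) I).

Let mu_ge0 x : distf v0 x <= distf mu x.
Proof.
apply: le_trans (dist_v_ge Phi_cutoff v0_half v_half v_sol x (lexx 0)) _.
exact: (dist_mu_ge (mass_v v0_half v_half v_sol v_mass) muL).
Qed.

Let mass_muM : mass mu = mass v0.
Proof. exact: (mass_mu (mass_v v0_half v_half v_sol v_mass) muL). Qed.

Let lim_const a b y z : 0 <= a -> v0 `]a, b[%classic = 0%E -> a <= y -> y <= z -> z < b ->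
  distf mu y = distf mu z.
Proof. exact: (limit_const m0 theta01 delta0 Phi_cutoff v0_half v_half v_sol v_mass muL). Qed.

Let lim_conserved a b x : 0 <= a -> v0 `]a, b[%classic = 0%E ->
  (forall k k', 0 <= k <= a -> b <= k' -> k * k' != 0 -> Phi (k, k') = 0) ->
  a <= x < b -> distf mu x = distf v0 x.
Proof. exact: (limit_conserved m0 theta01 delta0 Phi_cutoff v0_half v_half v_sol v_mass muL). Qed.

Lemma v0_null_itv a b : (forall y, a < y < b -> ~ S0 y) -> v0 `]a, b[%classic = 0%E.
Proof.
by move=> ab; apply: mu_disj_msupp => [|y]; [exact: measurable_itv|rewrite /= in_itv/=; exact: ab].
Qed.

Lemma gapP I : selected_gaps D v0 I ->
  [/\ forall z, I z -> 0 <= z /\ ~ S0 z,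
      forall x y z, I x -> I z -> x <= y <= z -> I y &
      forall z, I z -> exists2 r, 0 < r & forall y, 0 <= y -> `|y - z| < r -> I y].
Proof.
move=> [[x0 [Hx0 Sx0] <-] _].
have sub := @connected_component_sub _ (H `\` S0) x0.
split.
- by move=> z /sub [/=]; rewrite halflineE.
- move=> x y z Ix Iz xyz.
  have /connected_intervalP iI := @component_connected _ (H `\` S0) x0.
  exact: (iI x z Ix Iz).
move=> z Iz; have [zH zS] := sub _ Iz.
have [r r0 nr] : exists2 r, 0 < r & forall y, `|y - z| < r -> ~ S0 y.
  have [e e0 ne] := notin_msupp zS; exists e => // y yz sy.
  have : (0 < v0 `](z - e)%R, (z + e)%R[%classic)%E.
    by apply: (msupp_itv sy); move: yz; rewrite ltr_distl.
  by rewrite ne ltxx.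
exists r => // y y0 yz.
rewrite (same_connected_component Iz).
pose B : set R := [set w | 0 <= w /\ `|w - z| < r].
have Bc : connected B.
  apply/connected_intervalP => a b [/= a0 az] [/= b0 bz] c /andP[ac cb].
  split; first lra.
  by move: az bz; rewrite !ltr_norml => /andP[? ?] /andP[? ?]; apply/andP; split; lra.
have Bz : B z by split; [rewrite halflineE in zH|rewrite subrr normr0].
have BS : B `<=` H `\` S0 by move=> w [/= w0 wz]; split; [rewrite halflineE|exact: nr].
by apply: (connected_component_max Bz BS Bc).
Qed.

(** For a bounded gap the selection criterion decouples its two sides. To the right of a point of an
    unbounded gap [v0] has no mass, so [distf v0 z] is already the total mass. *)
Lemma gap_conserved_limit z : U z -> distf mu z = distf v0 z.
Proof.
move=> [I sI Iz]; have [IH Iitv Iop] := gapP sI.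
have [z0 _] := IH z Iz.
have [r r0 rI] := Iop z Iz.
have [ubI|nub] := pselect (has_ubound I); last first.
  have big y : z <= y -> I y.
    move=> zy; have /existsNP[w /not_implyP[Iw /negP]] : ~ ubound I y by move=> uy; apply: nub; exists y.
    by rewrite -ltNge => yw; apply: (Iitv z y w) => //; rewrite zy ltW.
  apply/eqP; rewrite eq_le mu_ge0 andbT.
  have : v0 `]z, +oo[%classic = 0%E.
    apply: mu_disj_msupp => [|y]; first exact: measurable_itv.
    by rewrite /= in_itv/= andbT => zy; case: (IH y (big y (ltW zy))).
  rewrite mu_itv_oy => -[/eqP]; rewrite subr_eq0 => /eqP <-.
  by rewrite -mass_muM distf_le_mass.
have lbI : has_lbound I by exists 0 => y /IH[].
have I0 : I !=set0 by exists z.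
pose a := inf I; pose b := sup I.
have az : a <= z by apply: ge_inf.
have zb : z < b.
  apply: (@lt_le_trans _ _ (z + r / 2)); first by rewrite ltrDl divr_gt0.
  apply: ub_le_sup => //; apply: rI; first lra.
  by rewrite addrAC subrr add0r gtr0_norm; lra.
have a0 : 0 <= a by apply: lb_le_inf => // y /IH[].
have inI y : a < y < b -> I y.
  move=> /andP[ay yb].
  have yb0 : 0 < b - y by rewrite subr_gt0.
  have ya0 : 0 < y - a by rewrite subr_gt0.
  have [w Iw wb] := sup_adherent yb0 (conj I0 ubI).
  have [u Iu ua] := inf_adherent ya0 (conj I0 lbI).
  apply: (Iitv u y w) => //; move: wb ua; rewrite -/a -/b; lra.
have vab : v0 `]a, b[%classic = 0%E by apply: v0_null_itv => y /inI /IH[].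
have ag : a <= gamma1 D b.
  by have [_] := sI; rewrite /gap_selected ereal_inf_EFin// ereal_sup_EFin.
apply: (lim_conserved a0 vab); last by rewrite az.
move=> k k' ka bk' kk'.
by apply: (cutoff_decoupled theta01 delta0 Phi_cutoff a0 (le_lt_trans az zb) ag).
Qed.

(** Components of a subset of the line are determined by the order; this description replaces
    connectedness in what follows. *)
Lemma blockP E x : blocks D v0 E -> E x ->
  [/\ 0 <= x, ~ U x & forall y, 0 <= y ->
    E y <-> (forall z, U z -> ~~ (y <= z <= x) && ~~ (x <= z <= y))].
Proof.
move=> [e Ce <-] Ex.
have sub := @connected_component_sub _ (H `\` U) e.
have [xH xU] := sub _ Ex; rewrite halflineE in xH.
split => // y y0; split.
  move=> Ey z Uz; apply/andP; split; apply/negP => zz.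
    have /connected_intervalP iI := @component_connected _ (H `\` U) e.
    by have [_] := sub _ (iI y x Ey Ex z zz).
  have /connected_intervalP iI := @component_connected _ (H `\` U) e.
  by have [_] := sub _ (iI x y Ex Ey z zz).
move=> nz; rewrite (same_connected_component Ex).
pose B : set R := [set w | y <= w <= x \/ x <= w <= y].
have Bc : connected B.
  apply/connected_intervalP => a b [/= /andP[? ?]|/= /andP[? ?]] [/= /andP[? ?]|/= /andP[? ?]] c /andP[? ?];
    have [?|?] := leP x y; rewrite /B /=; try (by left; lra); try (by right; lra).
have Bx : B x by rewrite /B /=; have [?|/ltW ?] := leP x y; [right|left]; rewrite lexx ?andbT.
have By : B y by rewrite /B /=; have [?|/ltW ?] := leP x y; [right|left]; rewrite lexx ?andbT.
have BS : B `<=` H `\` U.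
  move=> w Bw; split.
    by rewrite halflineE; case: Bw => /andP[? ?]; lra.
  by move=> /nz /andP[/negP h1 /negP h2]; case: Bw.
by apply: (connected_component_max Bx BS Bc).
Qed.

(* Selected gaps may accumulate at an end of a block (at 0), whence the
   exhaustion by a sequence of gaps. *)
Lemma mu_left x : ~ U x ->
  mu (\bigcup_(z in U `&` [set z | z < x]) `]-oo, z]%classic) =
  v0 (\bigcup_(z in U `&` [set z | z < x]) `]-oo, z]%classic).
Proof.
move=> nUx; set Q := U `&` _; set L := \bigcup_(z in _) _.
have [[q Qq]|Q0] := pselect (Q !=set0); last first.
  rewrite (_ : L = set0) ?measure0// -subset0 => y [z Qz _].
  by apply: Q0; exists z.
have ubQ : has_ubound Q by exists x => y [_ /= /ltW].
have hQ : has_sup Q by split => //; exists q.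
pose s := sup Q.
have adh n : exists z, Q z /\ s - n.+1%:R^-1 < z.
  have n0 : 0 < n.+1%:R^-1 :> R by rewrite invr_gt0.
  by have [z Qz sz] := sup_adherent n0 hQ; exists z.
have [w wP] : {w : nat -> R & forall n, Q (w n) /\ s - n.+1%:R^-1 < w n}.
  exact: (@choice _ _ (fun n z => Q z /\ s - n.+1%:R^-1 < z)).
(* Gaps extend to the right of each of their points, so the supremum is not attained. The closed
   half-lines []-oo, z]] need this strictness; their union is then []-oo, s[]. *)
have Qlt z : Q z -> z < s.
  move=> [[I sI Iz] /= zx]; have [IH Iitv Iop] := gapP sI.
  have [r r0 rI] := Iop z Iz; have [z0 _] := IH z Iz.
  pose y := z + r / 2; have Iy : I y.
    by apply: rI; [rewrite /y; lra|rewrite /y addrAC subrr add0r gtr0_norm; lra].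
  apply: (@lt_le_trans _ _ y); first by rewrite /y ltrDl divr_gt0.
  apply: ub_le_sup => //; split; first by exists I.
  rewrite /= ltNge; apply/negP => xy; apply: nUx; exists I => //.
  by apply: (Iitv z x y) => //; rewrite (ltW zx).
apply: (@eq_mu_exhaust R mu v0 L (fun n => `]-oo, s - n.+1%:R^-1]%classic)
   (fun n => `]-oo, w n]%classic)).
- apply/seteqP; split => y.
    move=> [n _]; rewrite /= in_itv/= => ys; exists (w n); first exact: (wP n).1.
    by rewrite /= in_itv/= (le_trans ys)// ltW// (wP n).2.
  move=> [z Qz]; rewrite /= in_itv/= => yz.
  have ys : 0 < s - y by rewrite subr_gt0 (le_lt_trans yz)// Qlt.
  have sy : 0 <= (s - y)^-1 by rewrite invr_ge0 ltW.
  exists (Num.bound (s - y)^-1) => //; rewrite /= in_itv/= lerBrDr -lerBrDl.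
  rewrite invf_ple ?posrE// (le_trans (ltW (archi_boundP sy)))//.
  by rewrite ler_nat.
- move=> i j ij; apply: subset_itvl; rewrite bnd_simp lerB// lef_pV2 ?posrE//.
  by rewrite ler_nat.
- by move=> n; exact: measurable_itv.
- by move=> n; exact: measurable_itv.
- by move=> n; apply: subset_itvl; rewrite bnd_simp ltW// (wP n).2.
- by move=> n y yw; exists (w n) => //; exact: (wP n).1.
- by move=> n; rewrite !distfE gap_conserved_limit//; exact: (wP n).1.1.
Qed.

Lemma mu_right x :
  mu (\bigcup_(z in U `&` [set z | x < z]) `]z, +oo[%classic) =
  v0 (\bigcup_(z in U `&` [set z | x < z]) `]z, +oo[%classic).
Proof.
set Q := U `&` _; set L := \bigcup_(z in _) _.
have [[q Qq]|Q0] := pselect (Q !=set0); last first.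
  rewrite (_ : L = set0) ?measure0// -subset0 => y [z Qz _].
  by apply: Q0; exists z.
have lbQ : has_lbound Q by exists x => y [_ /= /ltW].
have hQ : has_inf Q by split => //; exists q.
pose s := inf Q.
have adh n : exists z, Q z /\ z < s + n.+1%:R^-1.
  have n0 : 0 < n.+1%:R^-1 :> R by rewrite invr_gt0.
  by have [z Qz sz] := inf_adherent n0 hQ; exists z.
have [w wP] : {w : nat -> R & forall n, Q (w n) /\ w n < s + n.+1%:R^-1}.
  exact: (@choice _ _ (fun n z => Q z /\ z < s + n.+1%:R^-1)).
have Qle z : Q z -> s <= z by move=> Qz; apply: ge_inf.
apply: (@eq_mu_exhaust R mu v0 L (fun n => `]s + n.+1%:R^-1, +oo[%classic)
   (fun n => `]w n, +oo[%classic)).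
- apply/seteqP; split => y.
    move=> [n _]; rewrite /= in_itv/= andbT => ys; exists (w n); first exact: (wP n).1.
    by rewrite /= in_itv/= andbT (lt_trans _ ys)// (wP n).2.
  move=> [z Qz]; rewrite /= in_itv/= andbT => yz.
  have ys : 0 < y - s by rewrite subr_gt0 (le_lt_trans _ yz)// Qle.
  have sy : 0 <= (y - s)^-1 by rewrite invr_ge0 ltW.
  exists (Num.bound (y - s)^-1) => //; rewrite /= in_itv/= andbT -ltrBrDl.
  rewrite invf_plt ?posrE// (lt_le_trans (archi_boundP sy))//.
  by rewrite ler_nat.
- move=> i j ij; apply: subset_itvr; rewrite bnd_simp lerD2l lef_pV2 ?posrE//.
  by rewrite ler_nat.
- by move=> n; exact: measurable_itv.
- by move=> n; exact: measurable_itv.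
- by move=> n; apply: subset_itvr; rewrite bnd_simp ltW// (wP n).2.
- by move=> n y yw; exists (w n) => //; exact: (wP n).1.
- by move=> n; rewrite !mu_itv_oy gap_conserved_limit ?mass_muM//; exact: (wP n).1.1.
Qed.

(** Within [S0], the cluster is the complement of [L] and [Rr], the parts cut off by selected gaps
    to the left and to the right of [x]. Both parts and the total keep their masses, and [mu] does
    not charge the complement of [S0]. *)
Lemma cluster_mass An : clusters D v0 An ->
  measurable (An : set (measurableTypeR R)) /\ mu An = v0 An.
Proof.
move=> [E bE <-].
have [x Ex] : exists x, E x.
  by case: bE => e Ce <-; exists e; exact: connected_component_refl.
have [x0 nUx EP] := blockP bE Ex.
pose L : set (measurableTypeR R) := \bigcup_(z in U `&` [set z | z < x]) `]-oo, z]%classic.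
pose Rr : set (measurableTypeR R) := \bigcup_(z in U `&` [set z | x < z]) `]z, +oo[%classic.
have mL : measurable L.
  apply: is_interval_measurable => a b [z [Uz zx] /= az] [z' [Uz' z'x] /= bz'] c /andP[ac cb].
  by exists z' => //=; move: bz'; rewrite !in_itv/=; exact: le_trans.
have mR : measurable Rr.
  apply: is_interval_measurable => a b [z [Uz zx] /= az] [z' [Uz' z'x] /= bz'] c /andP[ac cb].
  by exists z => //=; move: az; rewrite !in_itv/= !andbT => za; exact: lt_le_trans ac.
have LR : [disjoint L & Rr].
  apply/eqP; rewrite -subset0 => y [[z [_ /= zx]]]; rewrite in_itv/= => yz.
  move=> [z' [_ /= xz']]; rewrite in_itv/= andbT => z'y.
  by have := lt_le_trans z'y yz; rewrite ltNge (ltW (lt_trans zx xz')).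
have ES : E `&` S0 = S0 `&` ~` (L `|` Rr).
  apply/seteqP; split => y [].
    move=> Ey Sy; split => //; have y0 := msupp_ge0 v0_half Sy.
    move=> [] [z [Uz /= zx]]; rewrite in_itv/= => yz.
      by move/(EP y y0) : Ey => /(_ z Uz); rewrite yz (ltW zx).
    move/(EP y y0) : Ey => /(_ z Uz); rewrite andbT in yz.
    by rewrite (ltW yz) (ltW zx) andbF.
  move=> Sy nLR; have y0 := msupp_ge0 v0_half Sy; split => //.
  apply/(EP y y0) => z Uz; apply/andP; split; apply/negP => /andP[h1 h2].
    apply: nLR; left; exists z; last by rewrite /= in_itv.
    split => //=; rewrite lt_neqAle h2 andbT; apply/eqP => e.
    by apply: nUx; rewrite -e.
  apply: nLR; right; exists z.
    split => //=; rewrite lt_neqAle h1 andbT; apply/eqP => e.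
    by apply: nUx; rewrite e.
  rewrite /= in_itv/= andbT lt_neqAle h2 andbT; apply/eqP => e.
  have [I sI Iz] := Uz; have [IH _ _] := gapP sI.
  by have [_] := IH z Iz; rewrite e.
have mS : measurable (S0 : set (measurableTypeR R)).
  by apply: closed_measurable; exact: closed_msupp.
have mLR : measurable (~` (L `|` Rr)) by apply: measurableC; exact: measurableU.
rewrite ES; split; first exact: measurableI.
have drop (nu : fmeasure R) : (forall y, msupp nu y -> S0 y) ->
    nu (S0 `&` ~` (L `|` Rr)) = (mass nu - fine (nu L) - fine (nu Rr))%:E.
  move=> sub.
  have -> : nu (S0 `&` ~` (L `|` Rr)) = nu (~` (L `|` Rr)).
    rewrite -[in RHS](setUIDK (~` (L `|` Rr)) S0) measureU; last 3 first.
    - exact: measurableI.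
    - exact: measurableD.
    - by rewrite setDE setIACA setICr setI0.
    rewrite [X in (_ + X)%E](_ : _ = 0%E) ?adde0 1?setIC//.
    by apply: mu_disj_msupp; [exact: measurableD|move=> y [_ nS] /sub].
  have mLE : nu L = (fine (nu L))%:E by rewrite fineK ?mu_fin.
  have mRE : nu Rr = (fine (nu Rr))%:E by rewrite fineK ?mu_fin.
  transitivity (nu setT - (nu L + nu Rr))%E.
    rewrite -setTD measureD//; last 2 first.
    - exact: measurableU.
    - exact: (eq_ind_r (fun z => (z < +oo)%E) (ltry _) (massE nu)).
    by rewrite setTI measureU//; exact/eqP.
  by rewrite (massE nu) mLE mRE /= -addrA -opprD.
rewrite !drop//; last exact: (msupp_limit m0 theta01 delta0 Phi_cutoff v0_half v_half v_sol v_mass mu_half muL).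
by rewrite mass_muM mu_left// mu_right.
Qed.

(** If [kn] were off the support of [mu], [distf mu] would be constant around [kn]. It agrees with
    [distf v0] just to the left and dominates it to the right, so [distf v0] would be constant
    around [kn] as well, against [S0 kn]. *)
Lemma cluster_min An kn : clusters D v0 An -> An kn -> (forall k, An k -> kn <= k) -> 0 < kn ->
  msupp mu kn.
Proof.
move=> [E bE <-] [Ekn Skn] kmin k0.
have [_ nUk EP] := blockP bE Ekn.
suff [a [a0 ak vak mua]] : exists a, [/\ 0 <= a, a < kn, v0 `]a, kn[%classic = 0%E &
    forall y, a <= y < kn -> distf mu y = distf v0 y].
  apply: contrapT => /notin_msupp[e e0 ne].
  pose y := Num.max a (kn - e / 2); pose w := kn + e / 2.
  have ya : a <= y by rewrite /y le_max lexx.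
  have ye : kn - e / 2 <= y by rewrite /y le_max lexx orbT.
  have yk : y < kn by rewrite /y gt_max ak/=; lra.
  have [h1 [h2 h3]] : kn - e <= y /\ y <= w /\ w < kn + e by rewrite /w; lra.
  have e1 := dist_null ne h1 h2 h3.
  have e2 : distf mu y = distf v0 y by apply: mua; rewrite ya.
  have e3 : distf v0 y = distf v0 w.
    by apply/eqP; rewrite eq_le distf_nd//= -e2 e1 mu_ge0.
  by apply: (not_msupp_const (y := y) (z := w)) Skn => //; rewrite yk /w ltrDl divr_gt0.
(* By minimality of [kn], a support point below it lies in another block, so a selected gap
   separates the two. *)
have between p : S0 p -> p < kn -> exists2 z, U z & p < z < kn.
  move=> Sp pk; have p0 := msupp_ge0 v0_half Sp.
  have nE : ~ E p by move=> Ep; have := kmin p (conj Ep Sp); rewrite leNgt pk.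
  have : ~ (forall z, U z -> ~~ (p <= z <= kn) && ~~ (kn <= z <= p)).
    by move=> h; apply: nE; apply/(EP p p0).
  move=> /existsNP[z /not_implyP[Uz]]; rewrite -negb_or => /negP; rewrite negbK => hz.
  have [I sI Iz] := Uz; have [IH _ _] := gapP sI; have [_ nSz] := IH z Iz.
  exists z => //.
  have pz : z != p by apply/eqP => e; apply: nSz; rewrite e.
  have zk : z != kn by apply/eqP => e; apply: nSz; rewrite e.
  move: pz zk; rewrite !neq_lt; case/orP: hz => /andP[? ?] /orP[?|?] /orP[?|?]; lra.
(* If [Q] is empty, the gap below [kn] starts at 0, where decoupling is automatic. Otherwise the
   cases are [sup Q < kn], with a selected gap in between, and [sup Q = kn], which is impossible. *)
pose Q := [set s | S0 s /\ s < kn].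
have [[q Qq]|Q0] := pselect (Q !=set0); last first.
  have vak : v0 `]0, kn[%classic = 0%E.
    by apply: v0_null_itv => y /andP[_ yk] Sy; apply: Q0; exists y.
  exists 0; split => // y yk; apply: (lim_conserved (lexx 0) vak _ yk).
  by move=> k k' /andP[k00 k00'] _; rewrite (_ : k = 0) ?mul0r ?eqxx//; lra.
have ubQ : has_ubound Q by exists kn => y [_ /ltW].
have hQ : has_sup Q by split => //; exists q.
pose p := sup Q.
have pk : p <= kn by apply: ge_sup; [exists q|move=> y [_ /ltW]].
have Sp : S0 p.
  apply: (@closed_msupp _ v0) => B /nbhs_ballP[e /= e0 eB].
  have [s Qs ps] := sup_adherent e0 hQ; exists s; split; first by case: Qs.
  apply: eB; rewrite /ball/= ger0_norm ?subr_ge0; first by move: ps; rewrite -/p; lra.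
  exact: ub_le_sup.
move: pk; rewrite le_eqVlt => /predU1P[pk|pk]; last first.
  have [z Uz /andP[pz zk]] := between p Sp pk.
  have p0 := msupp_ge0 v0_half Sp.
  have vpk : v0 `]p, kn[%classic = 0%E.
    apply: v0_null_itv => y /andP[py yk] Sy; have : y <= p by apply: ub_le_sup => //.
    by rewrite leNgt py.
  (* Both distribution functions are constant on [[p, kn[], so their equality at the single point
     [z] of the selected gap spreads to the whole interval. *)
  have cst (nu : fmeasure R) : (forall a b, p <= a -> a <= b -> b < kn -> distf nu a = distf nu b) ->
      forall y, p <= y < kn -> distf nu y = distf nu z.
    move=> cc y /andP[py yk]; have [yz|/ltW zy] := leP y z; first exact: cc.
    by apply/esym; apply: cc => //; exact: ltW.
  exists p; split => // y pyk.
  rewrite (cst mu) ?(cst v0)//.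
  - exact: gap_conserved_limit.
  - by move=> a b; exact: (dist_null vpk).
  - by move=> a b; exact: (lim_const p0 vpk).
(* Selected gaps cannot accumulate at [kn > 0], since [D] is a neighbourhood of
   [(kn, kn)]. *)
have [r /andP[r0 rk] rD] := cutoff_near_diagonal theta01 Phi_cutoff k0.
have [s [Ss sk] ps] := sup_adherent r0 hQ.
have [z Uz /andP[sz zk]] := between s Ss sk.
have [I sI Iz] := Uz; have [IH Iitv Iop] := gapP sI.
exfalso.
have Is y : I y -> s <= y.
  move=> Iy; rewrite leNgt; apply/negP => ys.
  have ysz : y <= s <= z by rewrite !ltW.
  by have [_] := IH s (Iitv y s z Iy Iz ysz).
have Ik y : I y -> y <= kn.
  move=> Iy; rewrite leNgt; apply/negP => ky.
  have zky : z <= kn <= y by rewrite !ltW.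
  by have [_] := IH kn (Iitv z kn y Iz Iy zky).
have lbI : has_lbound I by exists s.
have ubI : has_ubound I by exists kn.
have I0 : I !=set0 by exists z.
pose a := inf I; pose b := sup I.
have sa : s <= a by apply: lb_le_inf.
have ak : a <= kn by apply: le_trans (ltW zk); apply: ge_inf.
have bk : b <= kn by apply: ge_sup.
have sb : s <= b by apply: le_trans (ltW sz) _; apply: ub_le_sup.
have : a <= gamma1 D b.
  by have [_] := sI; rewrite /gap_selected ereal_inf_EFin// ereal_sup_EFin.
rewrite leNgt => /negP; apply.
move: ps; rewrite -/p pk => ps.
(* This point lies below [a], yet it is within [r] of [kn], as is [b]; so it belongs to the section
   of [D] at [b] and forces [gamma1 D b < a]. *)
have [h1 h2] : kn - r < (kn - r + a) / 2 /\ (kn - r + a) / 2 < a by lra.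
apply: le_lt_trans h2; apply: ge_inf; first by exists 0 => y [].
split; first by lra.
by apply: (rD _ _ _ _).2; rewrite ltr_norml; apply/andP; split; lra.
Qed.

End cluster_masses.

(** * Convergence to a sum of atoms *)

Unset Implicit Arguments.

Theorem theorem8 (R : realType) (m theta delta : R) (Phi : R * R -> R)
    (m_gt0 : 0 < m) (theta01 : 0 < theta < 1) (delta_gt0 : 0 < delta)
    (Phi_cutoff : is_cutoff theta delta Phi)
    (eta : R) (eta_gt : (1 - theta) / 2 < eta)
    (v0 : fmeasure R) (v0_half : on_halfline v0)
    (v0_exp : (Xexp eta v0 < +oo)%E)
    (v : R -> fmeasure R) (v_half : forall t : R, 0 <= t -> on_halfline (v t))
    (v_cont : narrow_continuous v)
    (v_sol : weak_solution m Phi v0 v)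
    (v_mass : forall t : R, 0 < t -> M0 (v t) = M0 v0)
    (v_exp : forall t : R, 0 < t -> (Xexp eta (v t) <= Xexp eta v0)%E) :
  exists (mu : fmeasure R) (N : set nat) (M' k' : nat -> R),
    [/\ on_halfline mu,
        shifts_converge v mu,
        forall A : set R, measurable A ->
          mu A = (\esum_(i in N) ((M' i)%:E * \d_(k' i) A))%E &
        forall i, N i -> 0 <= M' i /\ 0 <= k' i] /\
    [/\ forall i, N i -> msupp v0 (k' i),
        forall i j, N i -> N j -> i <> j -> Phi (k' i, k' j) = 0,
        forall An, clusters (Dset theta delta) v0 An ->
          (\esum_(i in [set i | [/\ N i, An (k' i) & 0 < M' i]%R]) (M' i)%:E)%E
          = v0 An &
        forall An, clusters (Dset theta delta) v0 An ->
          forall kn : R, An kn -> (forall k : R, An k -> kn <= k) -> 0 < kn ->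
            exists i, N i /\ k' i = kn].
Proof.
have nd s t x : 0 <= s -> s <= t -> distf (v s) x <= distf (v t) x.
  exact: (dist_v_nd Phi_cutoff v_half v_sol).
have ms t : 0 <= t -> mass (v t) = mass v0 by exact: (mass_v v0_half v_half v_sol v_mass).
have [mu [muh muL]] := limit_exists v_half ms.
have [N [M' [k' [kS M'0 kinj kall muA]]]] :=
  limit_atoms m_gt0 theta01 delta_gt0 Phi_cutoff v0_half v_half v_sol v_mass muh muL.
exists mu, N, M', k'; split; split.
- exact: muh.
- move=> S eps S0 eps0; have e2 : 0 < eps / 2 by rewrite divr_gt0.
  have dense := limit_dense m_gt0 theta01 delta_gt0 Phi_cutoff v0_half v_half v_sol v_mass muh muL.
  have [T T0 HT] := limit_d0 v_half nd ms muh muL dense e2.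
  exists T; split => // t s Tt /andP[s0 _].
  by apply: le_lt_trans (HT (t + s) _) _; lra.
- exact: muA.
- by move=> i Ni; split => //; exact: (msupp_ge0 muh (kS i Ni)).
- by move=> i Ni; apply: (msupp_limit m_gt0 theta01 delta_gt0 Phi_cutoff v0_half v_half v_sol v_mass muh muL); exact: kS.
- move=> i j Ni Nj ij.
  apply: (limit_separated_neq m_gt0 theta01 delta_gt0 Phi_cutoff v0_half v_half v_sol v_mass muh muL).
  + exact: kS.
  + exact: kS.
  + by apply/eqP => e; apply: ij; exact: kinj.
- move=> An cAn.
  have [mAn <-] := cluster_mass m_gt0 theta01 delta_gt0 Phi_cutoff v0_half v_half v_sol v_mass muh muL cAn.
  rewrite muA// esum_mkcond [RHS]esum_mkcond; apply: eq_esum => i _.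
  rewrite diracE; case: (boolP (i \in N)) => [/set_mem Ni|nN]; last first.
    by rewrite ifF//; apply/negbTE; apply: contra nN => /set_mem[/mem_set].
  case: (boolP (k' i \in An)) => [/set_mem Ai|nA]; last first.
    by rewrite mule0 ifF//; apply/negbTE; apply: contra nA => /set_mem[_ /mem_set].
  rewrite mule1; case: (boolP (i \in _)) => // /negP nn.
  have := M'0 i; rewrite le_eqVlt => /predU1P[<-//|Mi].
  by case: nn; apply/mem_set.
- move=> An cAn kn Akn kmin k0.
  have [i Ni e] := kall kn (cluster_min m_gt0 theta01 delta_gt0 Phi_cutoff v0_half v_half v_sol v_mass muL cAn Akn kmin k0).
  by exists i.
Qed.
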